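(* Let $R(D)\in\mathcal{M}[D]^{m\times n}$ have full row rank, and let $$R(D)=U(D)^{-1}\begin{bmatrix} I_{m-1} & & \\ & r(D) & 0_{m\times(n-m)}\end{bmatrix}V(D)^{-1}$$ be a Teichmüller-Nakayama factorization of $R(D)$, i.e. the middle factor is the $m\times n$ matrix $[\operatorname{diag}(1,\dots,1,r(D))\mid 0_{m\times(n-m)}]$ with $m-1$ ones, $U(D)\in\mathcal{M}[D]^{m\times m}$ and $V(D)\in\mathcal{M}[D]^{n\times n}$ are unimodular, and $r(D)\in\mathcal{M}[D]\setminus\{0\}$. Let $L\in\{-1,0,1,\dots,\infty\}$ satisfy $L\ge\deg V(D)^{-1}+\deg r(D)-1$. Then the local behaviour $\ker^{L,\infty,\infty}_{\mathbf{Int}}R(\tfrac{\mathrm{d}}{\mathrm{d}t})$ is controllable if and only if $R(D)$ is right invertible.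
   Context: Algebra. $\mathcal{M}$ is the field of real meromorphic functions on $\mathbb{R}$ (quotients of real analytic functions on $\mathbb{R}$ with nonzero denominator). $\mathcal{M}[D]$ is the skew polynomial ring of polynomials in $D$ with coefficients in $\mathcal{M}$, with multiplication determined by $D\cdot f=f\cdot D+\frac{\mathrm{d}}{\mathrm{d}t}f$ for $f\in\mathcal{M}$; it is a left and right Euclidean domain. An element of $\mathcal{M}[D]^{m\times n}$ is written $R(D)=\sum_{i=0}^N R_iD^i$ with $R_i\in\mathcal{M}^{m\times n}$; its degree is the largest $i$ with $R_i\neq0$. Full row rank means that the rank over $\mathcal{M}[D]$ equals $m$ (the rows are left linearly independent over $\mathcal{M}[D]$). $R(D)\in\mathcal{M}[D]^{m\times n}$ is right invertible if there is $B(D)\in\mathcal{M}[D]^{n\times m}$ with $R(D)B(D)=I_m$. A square matrix over $\mathcal{M}[D]$ is unimodular if it has a two-sided inverse over $\mathcal{M}[D]$. Function spaces. For $a<b$, $\mathcal{C}^{-1}[a,b]$ is the vector space of functions $f:[a,b]\setminus E\to\mathbb{R}$ with $E\subseteq[a,b]$ finite, modulo equality outside a finite set. $\mathcal{C}^L[a,b]$ for $L\in\mathbb{N}_0\cup\{\infty\}$ is the space of $L$ times continuously differentiable functions on $[a,b]$ (one-sided derivatives at the endpoints), viewed as a subspace of $\mathcal{C}^{-1}[a,b]$. $\mathcal{C}^\infty_{\mathrm{pw}}[a,b]$ is the space of classes in $\mathcal{C}^{-1}[a,b]$ having a representative that is $\mathcal{C}^\infty$ on its domain. For $L\in\{-1,0,1,\dots,\infty\}$,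 $$\mathcal{C}^{L,\infty,\infty}[a,b]=\{f\in\mathcal{C}^L[a,b]\cap\mathcal{C}^\infty_{\mathrm{pw}}[a,b] : \exists E\subseteq[a,b]\text{ finite such that } f|_{[x,y]}\in\mathcal{C}^\infty[x,y]\text{ for all nonempty }(x,y)\subseteq(a,b)\setminus E\}.$$ A meromorphic function restricts to an element of $\mathcal{C}^\infty_{\mathrm{pw}}[a,b]$, so $R(\frac{\mathrm{d}}{\mathrm{d}t})w=\sum_{i=0}^N R_i\frac{\mathrm{d}^i}{\mathrm{d}t^i}w\in(\mathcal{C}^\infty_{\mathrm{pw}}[a,b])^m$ is defined for $w\in(\mathcal{C}^\infty_{\mathrm{pw}}[a,b])^n$, computed away from finitely many points. The local behaviour. $\mathbf{Int}$ is the poset (under inclusion) of compact real intervals $[a,b]$, $a\le b$. The $\mathbf{Int}$-sheaf of vector spaces $\mathcal{S}:=\ker^{L,\infty,\infty}_{\mathbf{Int}}R(\frac{\mathrm{d}}{\mathrm{d}t})$ is given by $$\mathcal{S}[a,b]=\{w\in(\mathcal{C}^{L,\infty,\infty}[a,b])^n : R(\tfrac{\mathrm{d}}{\mathrm{d}t})w=0\}\quad(a<b),\qquad \mathcal{S}[b,b]=\{b\}\times(\mathbb{R}^n)^{L+1}$$ (meaning $\{b\}\times(\mathbb{R}^n)^{\mathbb{N}_0}$ if $L=\infty$, and the one-point space $\{b\}\times(\mathbb{R}^n)^0$ if $L=-1$), with the usual restriction of functions between nondegenerate intervals, and $f|_{[b,b]}=(b,f(b),\dot f(b),\dots,f^{(L)}(b))$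 for $f\in\mathcal{S}[a,c]$, $a<c$, $b\in[a,c]$. Controllability. $\mathcal{S}$ is controllable if for all $a<b<c<d$, all $f\in\mathcal{S}[a,b]$ and all $h\in\mathcal{S}[c,d]$ there is $g\in\mathcal{S}[b,c]$ with $f|_{[b,b]}=g|_{[b,b]}$ and $g|_{[c,c]}=h|_{[c,c]}$. *)

(* Defs.v *)
From Stdlib Require Import Reals Lra.
From HB Require Import structures.
From mathcomp Require Import all_boot all_algebra.
From mathcomp Require Import generic_quotient boolp classical_sets.
From mathcomp Require Import reals Rstruct.
From Coquelicot Require Import Coquelicot.

Set Implicit Arguments.
Unset Strict Implicit.
Unset Printing Implicit Defensive.

Import GRing.Theory.

Local Open Scope R_scope.

(** * Real analytic functions on the real line *)

Definition analytic_at (f : R -> R) (x : R) : Prop :=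
  exists (a : nat -> R) (r : R), 0 < r /\
    forall y, Rabs (y - x) < r -> is_pseries a (y - x) (f y).

Definition analytic (f : R -> R) : Prop := forall x, analytic_at f x.

Lemma pseries_radius (a : nat -> R) (r : R) (g : R -> R) :
  (forall h, Rabs h < r -> is_pseries a h (g h)) ->
  forall h, Rabs h < r -> Rbar_lt (Rabs h) (CV_radius a).
Proof.
move=> Hg h hr.
set k := (Rabs h + r) / 2.
have k0 : Rabs k = k.
  by apply: Rabs_right; rewrite /k; have := Rabs_pos h; lra.
have hk : Rabs h < k by rewrite /k; lra.
have kr : Rabs k < r by rewrite k0 /k; lra.
case: (Rbar_lt_le_dec (CV_radius a) (Finite k)) => [lt|le]; last first.
  exact: Rbar_lt_le_trans le.
exfalso; apply: (CV_disk_outside a k); first by rewrite k0.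
apply: ex_series_lim_0.
have [l Hl] : ex_pseries a k by exists (g k); exact: Hg.
exists l; apply: is_series_ext Hl => n.
by rewrite pow_n_pow /scal /= /mult /= Rmult_comm.
Qed.

Lemma analytic_const (c : R) : analytic (fun=> c).
Proof.
move=> x; exists (fun n => if n is 0%nat then c else 0), 1; split; first lra.
move=> y _; apply/is_series_Reals => e e0; exists 0%nat => n _.
have -> : sum_f_R0 (fun k => scal (pow_n (y - x) k)
    (if k is 0%nat then c else 0)) n = c.
  elim: n => [|n IHn] /=; first by rewrite /scal /= /mult /one /=; ring.
  by rewrite IHn /scal /= /mult /=; ring.
by rewrite /R_dist Rminus_diag_eq // Rabs_R0.
Qed.

Lemma analytic_plus (f g : R -> R) :
  analytic f -> analytic g -> analytic (fun x => f x + g x).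
Proof.
move=> Hf Hg x; have [a [r [r0 Ha]]] := Hf x; have [b [s [s0 Hb]]] := Hg x.
exists (PS_plus a b), (Rmin r s); split; first exact: Rmin_pos.
move=> y Hy; apply: is_pseries_plus.
- by apply: Ha; apply: Rlt_le_trans Hy _; exact: Rmin_l.
- by apply: Hb; apply: Rlt_le_trans Hy _; exact: Rmin_r.
Qed.

Lemma analytic_opp (f : R -> R) : analytic f -> analytic (fun x => - f x).
Proof.
move=> Hf x; have [a [r [r0 Ha]]] := Hf x.
by exists (PS_opp a), r; split=> // y /Ha; exact: is_pseries_opp.
Qed.

Lemma shift_pseries (a : nat -> R) (r x : R) (f : R -> R) :
  (forall y, Rabs (y - x) < r -> is_pseries a (y - x) (f y)) ->
  forall h, Rabs h < r -> is_pseries a h (f (h + x)).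
Proof.
move=> Ha h hr; have hx : h + x - x = h by ring.
by have := Ha (h + x); rewrite hx; exact.
Qed.

Lemma analytic_mult (f g : R -> R) :
  analytic f -> analytic g -> analytic (fun x => f x * g x).
Proof.
move=> Hf Hg x; have [a [r [r0 Ha]]] := Hf x; have [b [s [s0 Hb]]] := Hg x.
exists (PS_mult a b), (Rmin r s); split; first exact: Rmin_pos.
move=> y Hy.
have yr : Rabs (y - x) < r by apply: Rlt_le_trans Hy _; exact: Rmin_l.
have ys : Rabs (y - x) < s by apply: Rlt_le_trans Hy _; exact: Rmin_r.
apply: is_pseries_mult (Ha _ yr) (Hb _ ys) _ _.
- exact: pseries_radius (shift_pseries Ha) _ yr.
- exact: pseries_radius (shift_pseries Hb) _ ys.
Qed.

Lemma analytic_is_derive (f : R -> R) (x : R) (a : nat -> R) (r : R) :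
  (forall y, Rabs (y - x) < r -> is_pseries a (y - x) (f y)) ->
  forall y, Rabs (y - x) < r -> is_derive f y (PSeries (PS_derive a) (y - x)).
Proof.
move=> Ha y yr.
have ar := pseries_radius (shift_pseries Ha) yr.
apply: (is_derive_ext_loc (fun z => PSeries a (z - x))).
  have e0 : 0 < r - Rabs (y - x) by lra.
  exists (mkposreal _ e0) => z; rewrite /ball /= /AbsRing_ball /=.
  rewrite /abs /minus /plus /opp /= => yz.
  apply: is_pseries_unique; apply: Ha.
  have -> : z - x = (z + - y) + (y - x) by ring.
  by apply: Rle_lt_trans (Rabs_triang _ _) _; lra.
have -> : PSeries (PS_derive a) (y - x) =
    scal 1 (PSeries (PS_derive a) (y - x)).
  by rewrite /scal /= /mult /=; ring.
apply: (is_derive_comp (PSeries a) (fun z => z - x)).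
  exact: is_derive_PSeries.
by auto_derive=> //; ring.
Qed.

Lemma analytic_ex_derive (f : R -> R) (x : R) : analytic f -> ex_derive f x.
Proof.
move=> /(_ x) [a [r [r0 Ha]]].
exists (PSeries (PS_derive a) (x - x)); apply: (analytic_is_derive Ha).
by rewrite Rminus_diag_eq // Rabs_R0.
Qed.

Lemma analytic_Derive (f : R -> R) : analytic f -> analytic (Derive f).
Proof.
move=> Hf x; have [a [r [r0 Ha]]] := Hf x.
exists (PS_derive a), r; split=> // y yr.
rewrite (is_derive_unique _ _ _ (analytic_is_derive Ha yr)).
apply: PSeries_correct; apply: CV_radius_inside; rewrite CV_radius_derive.
exact: pseries_radius (shift_pseries Ha) _ yr.
Qed.

Definition vanishes_near (f : R -> R) (x : R) := locally x (fun y => f y = 0).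

(** Zeros of an analytic function are isolated, or the function vanishes near
    them. *)
Lemma analytic_dichotomy (f : R -> R) (x : R) : analytic f ->
  vanishes_near f x \/ locally' x (fun y => f y <> 0).
Proof.
move=> /(_ x) [a [r [r0 Ha]]].
have [a0|/existsNP aN0] := pselect (forall n, a n = 0).
  left; exists (mkposreal _ r0) => y yr.
  rewrite -(is_pseries_unique _ _ _ (Ha y yr)).
  by rewrite (PSeries_ext _ (fun=> 0)) ?PSeries_const_0.
right.
have [k ak kmin] : exists2 k, a k <> 0 & forall j, (j < k)%coq_nat -> a j = 0.
  have ex : exists k, `[< a k <> 0 >].
    by have [k Hk] := aN0; exists k; apply/asboolP.
  exists (ex_minn ex); first by case: ex_minnP => k /asboolP.
  case: ex_minnP => k _ kmin j jk; apply: contrapT => aj.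
  have : leq k j by apply: kmin; apply/asboolP.
  by move=> /leP; apply/PeanoNat.Nat.lt_nge.
have R0 : Rbar_lt (Rabs 0) (CV_radius (PS_decr_n a k)).
  have -> : CV_radius (PS_decr_n a k) = CV_radius a.
    elim: (k) => [|j IHj].
      by apply: CV_radius_ext => n; rewrite /PS_decr_n.
    rewrite -IHj -[RHS]CV_radius_decr_1; apply: CV_radius_ext => n.
    by rewrite /PS_decr_1 /PS_decr_n /= PeanoNat.Nat.add_succ_r.
  by apply: pseries_radius (shift_pseries Ha) _ _; rewrite Rabs_R0.
have ct := PSeries_continuity _ _ R0.
have q0 : PSeries (PS_decr_n a k) 0 = a k.
  by rewrite PSeries_0 /PS_decr_n PeanoNat.Nat.add_0_r.
have [d [d0 Hd]] := ct (Rabs (a k)) (Rabs_pos_lt _ ak).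
have e0 : 0 < Rmin r d by exact: Rmin_pos.
exists (mkposreal _ e0) => y; rewrite /ball /= /AbsRing_ball /=.
rewrite /abs /minus /plus /opp /= => yr yx.
have yr' : Rabs (y - x) < r by apply: Rlt_le_trans yr _; exact: Rmin_l.
have yd : Rabs (y - x) < d by apply: Rlt_le_trans yr _; exact: Rmin_r.
rewrite -(is_pseries_unique _ _ _ (Ha y yr')) (PSeries_decr_n_aux _ _ _ kmin).
apply: Rmult_integral_contrapositive_currified.
  by apply: pow_nonzero; lra.
move=> z.
have := Hd (y - x); rewrite /= /R_dist z q0.
have -> : 0 - a k = - a k by ring.
rewrite Rabs_Ropp => HH.
suff : Rabs (a k) < Rabs (a k) by exact: Rlt_irrefl.
apply: HH; split; last by rewrite Rminus_0_r.
by split=> //; lra.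
Qed.

Lemma locally'_point (x : R) (P : R -> Prop) : locally' x P -> exists y, P y.
Proof.
move=> [e He]; exists (x + e / 2); have ep := cond_pos e; apply: He; last lra.
rewrite /ball /= /AbsRing_ball /= /abs /minus /plus /opp /=.
have -> : x + e / 2 + - x = e / 2 by ring.
by rewrite Rabs_right; lra.
Qed.

Lemma analytic_vanishes (f : R -> R) (x : R) :
  analytic f -> vanishes_near f x -> forall y, f y = 0.
Proof.
move=> Hf Hx y.
pose chi z := if `[< vanishes_near f z >] then 1 else 0.
suff chiE z : chi x = chi z.
  have := chiE y; rewrite /chi asboolT //; case: asboolP; last by lra.
  by move=> /locally_singleton.
have chi' t : is_derive chi t 0.
  apply: (is_derive_ext_loc (fun=> chi t)); last exact: is_derive_const.
  have [Ht|Ht] := analytic_dichotomy t Hf.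
    apply: filter_imp (locally_locally _ _ Ht) => u Hu.
    by rewrite /chi !asboolT.
  have [e He] := Ht.
  have nvan u : ball t e u -> ~ vanishes_near f u.
    move=> tu Hu; have [ut|ut] := pselect (u = t).
      subst u; have : locally' t (fun _ => False).
        have : locally' t (fun v => f v <> 0 /\ f v = 0).
          apply: filter_and => //.
          by apply: filter_imp Hu => v.
        by apply: filter_imp => v [].
      by move=> /locally'_point [].
    exact: He tu ut (locally_singleton _ _ Hu).
  exists e => u tu; rewrite /chi !asboolF //; apply: nvan => //.
  exact: ball_center.
have [xz|[->//|zx]] := Rtotal_order x z.
- by apply: eq_is_derive xz => t _; exact: chi'.
- by symmetry; apply: eq_is_derive zx => t _; exact: chi'.
Qed.

Lemma analytic_integral (f g : R -> R) : analytic f -> analytic g ->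
  (forall x, f x * g x = 0) -> (forall x, f x = 0) \/ (forall x, g x = 0).
Proof.
move=> Hf Hg fg.
have [H|Hf0] := analytic_dichotomy 0 Hf.
  by left; exact: analytic_vanishes H.
have [H|Hg0] := analytic_dichotomy 0 Hg.
  by right; exact: analytic_vanishes H.
have [y [fy gy]] := locally'_point (filter_and _ _ Hf0 Hg0).
by case: (Rmult_integral _ _ (fg y)).
Qed.

Record anfun := AnFun { anfun_val :> R -> R; anfunP : analytic anfun_val }.

Lemma anfun_eq (f g : anfun) : (forall x, f x = g x) -> f = g.
Proof.
case: f g => [f Hf] [g Hg] /= /funext fg; subst g.
by rewrite (Prop_irrelevance Hf Hg).
Qed.

HB.instance Definition _ := gen_eqMixin anfun.
HB.instance Definition _ := gen_choiceMixin anfun.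

Definition anfun_const c := AnFun (analytic_const c).
Definition anfun_add (f g : anfun) :=
  AnFun (analytic_plus (anfunP f) (anfunP g)).
Definition anfun_opp (f : anfun) := AnFun (analytic_opp (anfunP f)).
Definition anfun_mul (f g : anfun) :=
  AnFun (analytic_mult (anfunP f) (anfunP g)).
Definition anfun_derive (f : anfun) := AnFun (analytic_Derive (anfunP f)).

Lemma anfun_addA : associative anfun_add.
Proof. by move=> f g h; apply: anfun_eq => x /=; ring. Qed.
Lemma anfun_addC : commutative anfun_add.
Proof. by move=> f g; apply: anfun_eq => x /=; ring. Qed.
Lemma anfun_add0 : left_id (anfun_const 0) anfun_add.
Proof. by move=> f; apply: anfun_eq => x /=; ring. Qed.
Lemma anfun_addN : left_inverse (anfun_const 0) anfun_opp anfun_add.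
Proof. by move=> f; apply: anfun_eq => x /=; ring. Qed.

HB.instance Definition _ :=
  GRing.isZmodule.Build anfun anfun_addA anfun_addC anfun_add0 anfun_addN.

Lemma anfun_mulA : associative anfun_mul.
Proof. by move=> f g h; apply: anfun_eq => x /=; ring. Qed.
Lemma anfun_mulC : commutative anfun_mul.
Proof. by move=> f g; apply: anfun_eq => x /=; ring. Qed.
Lemma anfun_mul1 : left_id (anfun_const 1) anfun_mul.
Proof. by move=> f; apply: anfun_eq => x /=; ring. Qed.
Lemma anfun_mulDl : left_distributive anfun_mul anfun_add.
Proof. by move=> f g h; apply: anfun_eq => x /=; ring. Qed.
Lemma anfun_1neq0 : anfun_const 1 != 0%R.
Proof. by apply/eqP => /(congr1 (fun f : anfun => f 0)) /=; lra. Qed.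

HB.instance Definition _ := GRing.Zmodule_isComNzRing.Build anfun
  anfun_mulA anfun_mulC anfun_mul1 anfun_mulDl anfun_1neq0.

Local Open Scope ring_scope.

Definition anfun_unit : pred anfun := fun f =>
  `[< exists g : anfun, g * f = 1 >].

Definition anfun_inv (f : anfun) : anfun :=
  if pselect (exists g : anfun, g * f = 1) is left e then sval (cid e) else f.

Lemma anfun_mulVx : {in anfun_unit, left_inverse 1 anfun_inv *%R}.
Proof.
move=> f /asboolP Hf; rewrite /anfun_inv; case: pselect => // e.
exact: svalP (cid e).
Qed.

Lemma anfun_unitPl (f g : anfun) : g * f = 1 -> anfun_unit f.
Proof. by move=> gf; apply/asboolP; exists g. Qed.

Lemma anfun_inv_out : {in [predC anfun_unit], anfun_inv =1 id}.
Proof. by move=> f /asboolP Hf; rewrite /anfun_inv; case: pselect. Qed.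

HB.instance Definition _ := GRing.ComNzRing_hasMulInverse.Build anfun
  anfun_mulVx anfun_unitPl anfun_inv_out.

Lemma anfun_mulf_eq0 (f g : anfun) : f * g = 0 -> (f == 0) || (g == 0).
Proof.
move=> fg; have fgx (x : R) : (f x * g x)%R = 0.
  exact: (congr1 (fun h : anfun => h x) fg).
have [H|H] := analytic_integral (anfunP f) (anfunP g) fgx.
- by apply/orP; left; apply/eqP; apply: anfun_eq.
- by apply/orP; right; apply/eqP; apply: anfun_eq.
Qed.

HB.instance Definition _ :=
  GRing.ComUnitRing_isIntegral.Build anfun anfun_mulf_eq0.

Lemma anfun_deriveD (f g : anfun) :
  anfun_derive (f + g) = anfun_derive f + anfun_derive g.
Proof.
apply: anfun_eq => x /=; apply: Derive_plus.
- exact: analytic_ex_derive (anfunP f).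
- exact: analytic_ex_derive (anfunP g).
Qed.

Lemma anfun_deriveM (f g : anfun) :
  anfun_derive (f * g) = anfun_derive f * g + f * anfun_derive g.
Proof.
apply: anfun_eq => x /=; apply: Derive_mult.
- exact: analytic_ex_derive (anfunP f).
- exact: analytic_ex_derive (anfunP g).
Qed.

(** * Real meromorphic functions *)

Definition mero := {fraction anfun}.

HB.instance Definition _ := GRing.Field.on mero.

Definition mero_of (f : anfun) : mero := tofrac f.

Definition mero_num (f : mero) : anfun := \n_(repr f).
Definition mero_den (f : mero) : anfun := \d_(repr f).

Lemma mero_den_neq0 (f : mero) : mero_den f != 0.
Proof. exact: denom_ratioP. Qed.

Lemma mero_of_eq0 (f : anfun) : (mero_of f == 0) = (f == 0).
Proof. exact: tofrac_eq0. Qed.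

Lemma mero_numden (f : mero) : f = mero_of (mero_num f) / mero_of (mero_den f).
Proof.
apply: (@mulIf _ (mero_of (mero_den f))).
  by rewrite mero_of_eq0 mero_den_neq0.
rewrite divfK ?mero_of_eq0 ?mero_den_neq0 // /mero_num /mero_den /mero_of.
rewrite -[X in X * _ = _]reprK; move: (repr f) => x; unlock tofrac.
rewrite -[LHS]FracField.pi_mul; apply/eqmodP; rewrite /= FracField.equivfE.
rewrite /FracField.mulf !numden_Ratio ?mulf_neq0 ?oner_eq0 ?denom_ratioP //.
by rewrite !mulr1 mulrC.
Qed.

(** Values are meaningful off the zeros of the chosen denominator, which are
    finitely many in each compact interval. *)
Definition mero_eval (f : mero) (t : R) : R := mero_num f t / mero_den f t.

Definition mero_derive (f : mero) : mero :=
  mero_of (anfun_derive (mero_num f) * mero_den f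
           - mero_num f * anfun_derive (mero_den f))
  / mero_of (mero_den f ^+ 2).

(** Required only here, since it rebinds the [ring] tactic used above for the
    Stdlib operations on [R]. *)
From mathcomp Require Import ring.

Lemma quotient_rule (F : fieldType) (n d p q n' d' p' q' : F) :
  d != 0 -> q != 0 -> p * d = n * q ->
  p' * d + p * d' = n' * q + n * q' ->
  (n' * d - n * d') / d ^+ 2 = (p' * q - p * q') / q ^+ 2.
Proof.
move=> d0 q0 e e'.
apply/eqP; rewrite eqr_div ?expf_neq0 //; apply/eqP.
have {}e' : n' * q = p' * d + p * d' - n * q' by rewrite e' addrK.
have -> : (n' * d - n * d') * q ^+ 2 = d * q * (n' * q) - d' * q * (n * q).
  by ring.
rewrite e' -e.
have -> : d * q * (p' * d + p * d' - n * q') - d' * q * (p * d) =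
  p' * q * d ^+ 2 - d * q' * (n * q) by ring.
by rewrite -e; ring.
Qed.

Lemma quotient_ruleD (F : fieldType) (n d p q n' d' p' q' : F) :
  d != 0 -> q != 0 ->
  ((n' * q + n * q' + (p' * d + p * d')) * (d * q)
   - (n * q + p * d) * (d' * q + d * q')) / (d * q) ^+ 2 =
  (n' * d - n * d') / d ^+ 2 + (p' * q - p * q') / q ^+ 2.
Proof. by move=> d0 q0; field; apply/andP. Qed.

Lemma quotient_ruleM (F : fieldType) (n d p q n' d' p' q' : F) :
  d != 0 -> q != 0 ->
  ((n' * p + n * p') * (d * q) - n * p * (d' * q + d * q')) / (d * q) ^+ 2 =
  (n' * d - n * d') / d ^+ 2 * (p / q) + n / d * ((p' * q - p * q') / q ^+ 2).
Proof. by move=> d0 q0; field; apply/andP. Qed.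

HB.instance Definition _ := GRing.isZmodMorphism.Build anfun mero mero_of
  (@tofrac_is_zmod_morphism anfun).
HB.instance Definition _ := GRing.isMonoidMorphism.Build anfun mero mero_of
  (@tofrac_is_monoid_morphism anfun).

Lemma mero_deriveE (f : mero) (p q : anfun) : q != 0 ->
  f = mero_of p / mero_of q ->
  mero_derive f = mero_of (anfun_derive p * q - p * anfun_derive q)
                  / mero_of (q ^+ 2).
Proof.
move=> q0 fE; rewrite /mero_derive !rmorphXn !rmorphB !rmorphM /=.
have e : p * mero_den f = mero_num f * q.
  apply/eqP; rewrite -subr_eq0 -mero_of_eq0 rmorphB !rmorphM subr_eq0 /=.
  rewrite -eqr_div ?mero_of_eq0 ?mero_den_neq0 //; apply/eqP.
  by rewrite -fE [LHS]mero_numden.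
apply: quotient_rule; rewrite ?mero_of_eq0 ?mero_den_neq0 //.
- by rewrite -!rmorphM e.
- by rewrite -!rmorphM -!rmorphD -!anfun_deriveM e.
Qed.

Lemma mero_deriveD : {morph mero_derive : f g / f + g}.
Proof.
move=> f g; set n := mero_num f; set d := mero_den f.
set p := mero_num g; set q := mero_den g.
have d0 : d != 0 by exact: mero_den_neq0.
have q0 : q != 0 by exact: mero_den_neq0.
have Md0 : mero_of d != 0 by rewrite mero_of_eq0.
have Mq0 : mero_of q != 0 by rewrite mero_of_eq0.
rewrite (@mero_deriveE _ (n * q + p * d) (d * q)) ?mulf_neq0 //; last first.
  rewrite [f in LHS]mero_numden [g in LHS]mero_numden -/n -/d -/p -/q.
  by rewrite addf_div // rmorphD !rmorphM.
rewrite /mero_derive -/n -/d -/p -/q !anfun_deriveD !anfun_deriveM.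
rewrite !(rmorphXn, rmorphB, rmorphM, rmorphD) /=.
exact: quotient_ruleD.
Qed.

Lemma mero_deriveM (f g : mero) :
  mero_derive (f * g) = mero_derive f * g + f * mero_derive g.
Proof.
set n := mero_num f; set d := mero_den f.
set p := mero_num g; set q := mero_den g.
have d0 : d != 0 by exact: mero_den_neq0.
have q0 : q != 0 by exact: mero_den_neq0.
have Md0 : mero_of d != 0 by rewrite mero_of_eq0.
have Mq0 : mero_of q != 0 by rewrite mero_of_eq0.
have fE : f = mero_of n / mero_of d by exact: mero_numden.
have gE : g = mero_of p / mero_of q by exact: mero_numden.
rewrite (@mero_deriveE _ (n * p) (d * q)) ?mulf_neq0 //; last first.
  by rewrite fE gE mulf_div !rmorphM.
rewrite (mero_deriveE d0 fE) (mero_deriveE q0 gE) [in RHS]fE [in RHS]gE.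
rewrite !anfun_deriveM !(rmorphXn, rmorphB, rmorphM, rmorphD) /=.
exact: quotient_ruleM.
Qed.

Lemma mero_derive0 : mero_derive 0 = 0.
Proof. by apply: (addrI (mero_derive 0)); rewrite -mero_deriveD !addr0. Qed.

Lemma mero_derive_sum (I : Type) (s : seq I) (P : pred I) (F : I -> mero) :
  mero_derive (\sum_(i <- s | P i) F i) = \sum_(i <- s | P i) mero_derive (F i).
Proof. exact: (big_morph _ mero_deriveD mero_derive0). Qed.

(** * The skew polynomial ring *)

(** [a_0 + a_1 D + ... + a_N D^N] is represented by the polynomial with
    coefficients [a_i]; only the multiplication differs from [{poly mero}]. *)
Definition skewpoly := {poly mero}.

HB.instance Definition _ := GRing.Zmodule.on skewpoly.

Definition skew_poly (a : skewpoly) : {poly mero} := a.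

(** Left multiplication by [D]: [D * (b D^j) = b D^(j+1) + b' D^j]. *)
Definition skew_mulD (b : {poly mero}) : {poly mero} :=
  b * 'X + map_poly mero_derive b.

Definition skew_mul (a b : skewpoly) : skewpoly :=
  \sum_(i < size (skew_poly a)) (skew_poly a)`_i *: iter i skew_mulD b.

Lemma map_mero_deriveD : {morph map_poly mero_derive : a b / a + b}.
Proof.
move=> a b; apply/polyP => i.
by rewrite coefD !coef_map_id0 ?coefD ?mero_derive0 // mero_deriveD.
Qed.

Lemma map_mero_deriveZ (c : mero) (b : {poly mero}) :
  map_poly mero_derive (c *: b) =
  mero_derive c *: b + c *: map_poly mero_derive b.
Proof.
apply/polyP => i.
rewrite coefD !coefZ !coef_map_id0 ?coefZ ?mero_derive0 //.
by rewrite mero_deriveM.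
Qed.

Lemma skew_mulDD : {morph skew_mulD : a b / a + b}.
Proof.
by move=> a b; rewrite /skew_mulD map_mero_deriveD mulrDl addrACA.
Qed.

Lemma skew_mulD0 : skew_mulD 0 = 0.
Proof. by apply: (addrI (skew_mulD 0)); rewrite -skew_mulDD !addr0. Qed.

Lemma skew_mulDZ (c : mero) (b : {poly mero}) :
  skew_mulD (c *: b) = c *: skew_mulD b + mero_derive c *: b.
Proof.
rewrite /skew_mulD map_mero_deriveZ scalerDr -scalerAl -!addrA; congr (_ + _).
exact: addrC.
Qed.

Lemma skew_mulD_sum (I : Type) (s : seq I) (P : pred I) (F : I -> {poly mero}) :
  skew_mulD (\sum_(i <- s | P i) F i) = \sum_(i <- s | P i) skew_mulD (F i).
Proof. exact: (big_morph _ skew_mulDD skew_mulD0). Qed.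

Lemma iter_skew_mulDD i : {morph iter i skew_mulD : a b / a + b}.
Proof. by elim: i => // i IHi a b; rewrite !iterS IHi skew_mulDD. Qed.

Lemma iter_skew_mulD0 i : iter i skew_mulD 0 = 0.
Proof. by elim: i => // i IHi; rewrite iterS IHi skew_mulD0. Qed.

Lemma skew_mul_wide n (a b : skewpoly) : (size (skew_poly a) <= n)%N ->
  skew_mul a b = \sum_(i < n) (skew_poly a)`_i *: iter i skew_mulD b.
Proof.
move=> an; rewrite /skew_mul.
rewrite (big_ord_widen n (fun i => (skew_poly a)`_i *: iter i skew_mulD b)) //.
rewrite big_mkcond; apply: eq_bigr => i _.
by case: ltnP => // ai; rewrite nth_default // scale0r.
Qed.

Lemma skew_mulDl : left_distributive skew_mul +%R.
Proof.
move=> a b c; pose n := maxn (size (skew_poly a)) (size (skew_poly b)).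
rewrite !(@skew_mul_wide n) ?leq_maxl ?leq_maxr //; last exact: size_polyD.
by rewrite -big_split; apply: eq_bigr => i _; rewrite /skew_poly coefD scalerDl.
Qed.

Lemma skew_mulDr : right_distributive skew_mul +%R.
Proof.
move=> a b c; rewrite /skew_mul -big_split; apply: eq_bigr => i _.
by rewrite iter_skew_mulDD scalerDr.
Qed.

Lemma skew_mul0l (b : skewpoly) : skew_mul 0 b = 0.
Proof. by rewrite /skew_mul /skew_poly size_poly0 big_ord0. Qed.

Lemma skew_mul_suml (I : Type) (s : seq I) (P : pred I) (F : I -> skewpoly)
    (b : skewpoly) :
  skew_mul (\sum_(i <- s | P i) F i) b = \sum_(i <- s | P i) skew_mul (F i) b.
Proof.
apply: (big_morph (fun a => skew_mul a b)) => [a c|]; first exact: skew_mulDl.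
exact: skew_mul0l.
Qed.

Lemma skew_mulZl (c : mero) (a b : skewpoly) :
  skew_mul (c *: skew_poly a) b = c *: skew_poly (skew_mul a b).
Proof.
rewrite (@skew_mul_wide (size (skew_poly a))) ?size_scale_leq //.
rewrite /skew_mul /skew_poly scaler_sumr; apply: eq_bigr => i _.
by rewrite coefZ scalerA.
Qed.

Lemma skew_mul_mulDl (a b : skewpoly) :
  skew_mul (skew_mulD a) b = skew_mulD (skew_mul a b).
Proof.
pose n := size (skew_poly a).
rewrite (@skew_mul_wide n.+1); last first.
  apply: leq_trans (size_polyD _ _) _; rewrite geq_max; apply/andP; split.
    by apply: leq_trans (size_polyMleq _ _) _; rewrite size_polyX addn2.
  by apply: leq_trans (size_poly _ _) _; rewrite ltnW.
rewrite (@skew_mul_wide n) // skew_mulD_sum.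
under [RHS]eq_bigr => i _ do rewrite skew_mulDZ -iterS.
rewrite big_split /= /skew_mulD /skew_poly.
under [LHS]eq_bigr => i _.
  rewrite coefD coefMX coef_map_id0 ?mero_derive0 // scalerDl; over.
rewrite big_split /=; congr (_ + _).
  by rewrite big_ord_recl /= scale0r add0r.
rewrite big_ord_recr /= [X in mero_derive X]nth_default ?leqnn //.
by rewrite mero_derive0 scale0r addr0.
Qed.

Lemma skew_mulA : associative skew_mul.
Proof.
move=> a b c; have iterE i : skew_mul (iter i skew_mulD b) c =
    iter i skew_mulD (skew_mul b c).
  by elim: i => // i IHi; rewrite !iterS -IHi; exact: skew_mul_mulDl.
rewrite [skew_mul a b]/skew_mul skew_mul_suml [LHS]/skew_mul.
by apply: eq_bigr => i _; rewrite -iterE skew_mulZl.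
Qed.

Lemma skew_mul1l : left_id (1 : {poly mero}) skew_mul.
Proof.
by move=> b; rewrite /skew_mul /skew_poly size_poly1 big_ord1 coef1 scale1r.
Qed.

Lemma mero_derive1 : mero_derive 1 = 0.
Proof.
have := mero_deriveM 1 1; rewrite !mulr1 mul1r => e.
by apply: (addrI (mero_derive 1)); rewrite addr0 -e.
Qed.

Lemma skew_mul1r : right_id (1 : {poly mero}) skew_mul.
Proof.
move=> a; have iterE i : iter i skew_mulD 1 = 'X^i.
  elim: i => [|i IHi]; first by rewrite expr0.
  rewrite iterS IHi /skew_mulD -exprSr -[RHS]addr0; congr (_ + _).
  apply/polyP => j; rewrite coef_map_id0 ?mero_derive0 // coefXn coef0.
  by case: (j == i); rewrite ?mero_derive1 ?mero_derive0.
rewrite /skew_mul -[RHS](coefK (skew_poly a)) poly_def.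
by apply: eq_bigr => i _; rewrite iterE.
Qed.

Lemma skew_1neq0 : (1 : {poly mero}) != 0 :> skewpoly.
Proof. exact: oner_neq0. Qed.

HB.instance Definition _ := GRing.Zmodule_isNzRing.Build skewpoly
  skew_mulA skew_mul1l skew_mul1r skew_mulDl skew_mulDr skew_1neq0.

Definition skew_D : skewpoly := 'X.
Definition skew_const (f : mero) : skewpoly := f%:P.

Lemma skew_D_const (f : mero) :
  skew_D * skew_const f = skew_const f * skew_D + skew_const (mero_derive f).
Proof.
change (skew_mul 'X f%:P =
  (skew_mul f%:P 'X : {poly mero}) + (mero_derive f)%:P).
rewrite {1}/skew_mul /skew_poly size_polyX big_ord_recl big_ord1 !coefX /=.
rewrite scale0r add0r scale1r (@skew_mul_wide 1) ?size_polyC ?leq_b1 //.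
rewrite big_ord1 /= /skew_poly coefC /= /skew_mulD mul_polyC; congr (_ + _).
by apply/polyP => j; rewrite coef_map_id0 ?mero_derive0 // !coefC;
  case: eqP => // _; rewrite mero_derive0.
Qed.

Definition skew_deg (a : skewpoly) : nat := (size (skew_poly a)).-1.

Definition mx_deg (m n : nat) (A : 'M[skewpoly]_(m, n)) : nat :=
  \max_(i < m) \max_(j < n) skew_deg (A i j).

Definition full_row_rank (m n : nat) (A : 'M[skewpoly]_(m, n)) : Prop :=
  forall x : 'rV[skewpoly]_m, x *m A = 0 -> x = 0.

Definition right_invertible (m n : nat) (A : 'M[skewpoly]_(m, n)) : Prop :=
  exists B : 'M[skewpoly]_(n, m), A *m B = 1%:M.

Definition two_sided_inverse (n : nat) (A B : 'M[skewpoly]_n) : Prop :=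
  A *m B = 1%:M /\ B *m A = 1%:M.

Definition unimodular (n : nat) (A : 'M[skewpoly]_n) : Prop :=
  exists B, two_sided_inverse A B.

(** The inverse of [A] when [A] is unimodular, and [A] itself otherwise;
    [invmx] is only available over commutative rings. *)
Definition skew_invmx (n : nat) (A : 'M[skewpoly]_n) : 'M[skewpoly]_n :=
  xget A (two_sided_inverse A).

Lemma skew_invmxP (n : nat) (A : 'M[skewpoly]_n) :
  unimodular A -> two_sided_inverse A (skew_invmx A).
Proof. by move=> [B HB]; exact: (xgetPex A (ex_intro _ B HB)). Qed.

(** [[diag(1, ..., 1, r) | 0]], with [m - 1] ones. A matrix of full row rank has
    a factorization through it only if [m <= n]. *)
Definition tn_middle (m n : nat) (r : skewpoly) : 'M[skewpoly]_(m, n) :=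
  \matrix_(i, j)
    (if val i == val j then (if i.+1 == m then r else 1) else 0).

Definition tn_factorization (m n : nat) (A : 'M[skewpoly]_(m, n))
    (U : 'M[skewpoly]_m) (r : skewpoly) (V : 'M[skewpoly]_n) : Prop :=
  [/\ unimodular U, unimodular V, r != 0 &
      A = skew_invmx U *m tn_middle m n r *m skew_invmx V].

(** * Function spaces *)

(** The exponents [-1], [k : nat] and [oo]. *)
Inductive regularity := RegM1 | RegFin of nat | RegInf.

Definition reg_ge (L : regularity) (z : int) : bool :=
  match L with
  | RegM1 => (z <= -1)%R
  | RegFin k => (z <= k%:Z)%R
  | RegInf => true
  end.

Local Close Scope ring_scope.
Local Open Scope R_scope.

(** Continuity and differentiability relative to a set [D], so that the
    derivatives at the endpoints of an interval are one-sided. *)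
Definition continuous_within (D : R -> Prop) (f : R -> R) (x : R) : Prop :=
  filterlim f (within D (locally x)) (locally (f x)).

Definition is_derive_within (D : R -> Prop) (f : R -> R) (x l : R) : Prop :=
  filterlim (fun y => (f y - f x) / (y - x))
    (within D (locally' x)) (locally l).

Definition derive_within (D : R -> Prop) (f : R -> R) (x : R) : R :=
  xget 0 (is_derive_within D f x).

Definition derive_within_n (D : R -> Prop) (k : nat) (f : R -> R) : R -> R :=
  iter k (derive_within D) f.

Definition C_on (D : R -> Prop) (L : regularity) (f : R -> R) : Prop :=
  (forall (k : nat) x, reg_ge L k.+1 -> D x ->
     exists l, is_derive_within D (derive_within_n D k f) x l) /\
  (forall (k : nat) x, reg_ge L k -> D x ->
     continuous_within D (derive_within_n D k f) x).

Definition segment (a b x : R) : Prop := a <= x <= b.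

(** Elements of [C^{-1}[a,b]] are represented by total functions modulo [pw_eq];
    the predicates on functions below are invariant under [pw_eq a b]. *)
Definition pw_eq (a b : R) (f g : R -> R) : Prop :=
  exists E : seq R, forall x, segment a b x -> x \notin E -> f x = g x.

(** The class of [f] is in [C^L[a,b]]; this holds for every [f] if [L = -1]. *)
Definition in_C (L : regularity) (a b : R) (f : R -> R) : Prop :=
  exists g, pw_eq a b f g /\ C_on (segment a b) L g.

Definition in_Cpw (a b : R) (f : R -> R) : Prop :=
  exists (g : R -> R) (E : seq R), pw_eq a b f g /\
    C_on (fun x => segment a b x /\ x \notin E) RegInf g.

Definition in_CLoo (L : regularity) (a b : R) (f : R -> R) : Prop :=
  [/\ in_C L a b f, in_Cpw a b f &
    exists E : seq R, forall x y, x < y ->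
      (forall t, x < t < y -> a < t < b /\ t \notin E) -> in_C RegInf x y f].

(** * The local behaviour *)

(** The [i]-th component of [A(d/dt) w] at [t]. For [w] in [C^oo_pw[a,b]^n] its
    value is meaningful off finitely many points of [[a,b]], whichever
    representatives of [w] and of the coefficients of [A] are used. *)
Definition diff_op (m n : nat) (A : 'M[skewpoly]_(m, n)) (w : 'I_n -> R -> R)
    (i : 'I_m) (t : R) : R :=
  (\sum_(j < n) \sum_(k < size (skew_poly (A i j)))
     mero_eval (skew_poly (A i j))`_k t * Derive_n (w j) k t)%R.

(** The sections over [[a,b]] for [a < b]. *)
Definition section (L : regularity) (m n : nat) (A : 'M[skewpoly]_(m, n))
    (a b : R) (w : 'I_n -> R -> R) : Prop :=
  (forall j, in_CLoo L a b (w j)) /\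
  (forall i, pw_eq a b (diff_op A w i) (fun=> 0)).

(** A superset of the sections over all [[b,b]]: those over [[b,b]] are the
    elements with first component [b]. The exponents [0 <= k <= L] index the
    factors of [(R^n)^(L+1)]. *)
Definition point_section (L : regularity) (n : nat) : Type :=
  (R * ({k : nat | reg_ge L k} -> 'cV[R]_n))%type.

(** The [C^L] function in the class of [f], unique on [[a,b]] if [L >= 0]. *)
Definition C_rep (L : regularity) (a b : R) (f : R -> R) : R -> R :=
  xget f (fun g => pw_eq a b f g /\ C_on (segment a b) L g).

(** The restriction from [[a,b]] to [[t,t]] for [t] in [[a,b]]. *)
Definition restr_point (L : regularity) (n : nat) (a b : R)
    (w : 'I_n -> R -> R) (t : R) : point_section L n :=
  (t, fun k => (\col_j
         derive_within_n (segment a b) (val k) (C_rep L a b (w j)) t)%R).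

Definition controllable (L : regularity) (m n : nat)
    (A : 'M[skewpoly]_(m, n)) : Prop :=
  forall a b c d : R, a < b -> b < c -> c < d ->
  forall f h : 'I_n -> R -> R, section L A a b f -> section L A c d h ->
  exists g : 'I_n -> R -> R, [/\ section L A b c g,
    restr_point L a b f b = restr_point L b c g b &
    restr_point L b c g c = restr_point L c d h c].

(* Main.v *)
(** If [A B = 1], then [w - B (A w)] is a projection onto the kernel of [A]. A
    section on [[a,b]] extends to a smooth function [F] near [b] by Borel's
    theorem, and [A F] vanishes to the left of [b]. Hence [B (A F)], a smooth
    function divided by an analytic one, is flat at [b], and subtracting it on
    the right of [b] only gives a section past [b] with the same jet. Applying a
    cutoff to [F] first makes this section vanish away from [b], so that it can
    be added to the one constructed likewise to the left of [c].

    Conversely suppose [deg r > 0] and put [W = V^-1]. Near a point [b] off all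
    poles there is a power series [y] with [r y = 0] and [y(b) = 1]. Take
    [f = V (y e_m)] and [h = 0]. For a connecting section [g], the function
    [v = (W g)_m] is piecewise a solution of [r v = 0]; the bound on [L] makes
    its derivatives of order [< deg r] continuous, and they vanish at [c].
    Gronwall's inequality gives [v(b) = 0], contradicting [v(b) = y(b) = 1]. So
    [r] is a unit, and [A] is right invertible. *)

From Stdlib Require Import Reals Lra Lia.
From mathcomp Require Import all_boot all_algebra.
From mathcomp Require Import boolp classical_sets Rstruct.
From Coquelicot Require Import Coquelicot.
Require Import Defs.
From mathcomp Require Import zify.

Set Implicit Arguments.
Unset Strict Implicit.
Unset Printing Implicit Defensive.

Import GRing.Theory.

Local Open Scope R_scope.

(** * Smooth functions *)

(** Coefficients have poles, and [mero_eval] depends on a chosen fraction, so an identity such as (A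
    B) w = A (B w) is only available off the zeros of an analytic function, which depends on the
    operators but not on w ([generically]). The two implications handle this differently. For
    necessity the point b can be chosen, and all four interval ends are put into a ball free of
    exceptional points. For sufficiency b and c are prescribed and may be poles; this is what forces
    the division of flat functions by analytic ones. The bound on [L] counts derivatives: a
    component of W g has order at most deg W in g, and its derivatives of order below deg r have
    order at most deg W + deg r - 1. The derivative of order deg r need not be continuous. It is
    only estimated through the equation, off finitely many points, which is enough for Gronwall's
    argument. If deg r > 0, the bound also forces L >= 0, so that every class has a unique
    continuous representative. *)

Lemma locally_Rabs (x : R) (P : R -> Prop) :
  locally x P <-> exists e, 0 < e /\ forall y, Rabs (y - x) < e -> P y.
Proof.
split=> [[e He]|[e [e0 He]]].
  by exists e; split; [exact: cond_pos|move=> y; exact: He].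
by exists (mkposreal _ e0) => y; exact: He.
Qed.

(** One neighbourhood serves all orders, so smoothness at a point is an open condition and passes to
    derivatives. *)
Definition smooth_at (f : R -> R) (t : R) : Prop :=
  locally t (fun u => forall k, ex_derive (Derive_n f k) u).

Lemma smooth_at_ext_loc (f g : R -> R) (t : R) :
  locally t (fun u => f u = g u) -> smooth_at f t -> smooth_at g t.
Proof.
move=> /locally_locally fg Hf; apply: filter_imp (filter_and _ _ fg Hf).
move=> u [{}fg {}Hf] k.
apply: (ex_derive_ext_loc (Derive_n f k)) => //.
apply: filter_imp (locally_locally _ _ fg) => v; exact: Derive_n_ext_loc.
Qed.

Lemma smooth_at_locally (f : R -> R) (t : R) :
  smooth_at f t -> locally t (smooth_at f).
Proof. by move=> H; exact: locally_locally. Qed.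

Lemma smooth_at_ex_derive (f : R -> R) (t : R) (k : nat) :
  smooth_at f t -> ex_derive (Derive_n f k) t.
Proof. by move=> /locally_singleton. Qed.

Lemma smooth_at_is_derive (f : R -> R) (t : R) (k : nat) :
  smooth_at f t -> is_derive (Derive_n f k) t (Derive_n f k.+1 t).
Proof. by move=> /locally_singleton H; apply: Derive_correct; exact: H. Qed.

Lemma smooth_at_continuous (f : R -> R) (t : R) (k : nat) :
  smooth_at f t -> continuous (Derive_n f k) t.
Proof. by move=> H; apply: ex_derive_continuous; exact: smooth_at_ex_derive. Qed.

Lemma smooth_at_Derive_n (f : R -> R) (t : R) (n : nat) :
  smooth_at f t -> smooth_at (Derive_n f n) t.
Proof.
apply: filter_imp => u Hu k.
apply: (ex_derive_ext (Derive_n f (k + n)%coq_nat)) (Hu _) => v.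
by rewrite Derive_n_comp.
Qed.

Lemma smooth_at_Derive (f : R -> R) (t : R) :
  smooth_at f t -> smooth_at (Derive f) t.
Proof. exact: (@smooth_at_Derive_n f t 1). Qed.

(** Coinduction: by induction on [k], the [k]-th derivative agrees on the open set [D] with some
    member of [P]. No formula for higher derivatives is required. *)
Lemma smooth_at_coind (D : R -> Prop) (P : (R -> R) -> Prop) :
  open D ->
  (forall f, P f -> exists g, P g /\ forall u, D u -> is_derive f u (g u)) ->
  forall f t, P f -> D t -> smooth_at f t.
Proof.
move=> oD HP f t Pf /oD; apply: filter_imp => u Du k.
suff [g [Pg [g' [_ gg']] fg]] : exists g, [/\ P g,
    exists g', P g' /\ forall u, D u -> is_derive g u (g' u) &
    forall u, D u -> Derive_n f k u = g u].
  exists (g' u); apply: (is_derive_ext_loc g) (gg' u Du).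
  by apply: filter_imp (oD u Du) => v Dv; rewrite fg.
elim: k {u Du} => [|k [g [Pg [g' [Pg' gg']] fg]]].
  by exists f; split=> //; exact: HP.
exists g'; split=> //; first exact: HP.
move=> u Du /=; rewrite -(is_derive_unique _ _ _ (gg' u Du)).
apply: Derive_ext_loc; apply: filter_imp (oD u Du) => v; exact: fg.
Qed.

(** The closure of the generators [P] and of the functions smooth on [D]. It lets the derivative of
    a generator be, say, a linear combination of generators instead of a single one. *)
Inductive smooth_alg (D : R -> Prop) (P : (R -> R) -> Prop) :
    (R -> R) -> Prop :=
| smooth_alg_gen f : P f -> smooth_alg D P f
| smooth_alg_base f : (forall u, D u -> smooth_at f u) -> smooth_alg D P f
| smooth_alg_plus f g : smooth_alg D P f -> smooth_alg D P g ->
    smooth_alg D P (fun u => f u + g u)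
| smooth_alg_mult f g : smooth_alg D P f -> smooth_alg D P g ->
    smooth_alg D P (fun u => f u * g u)
| smooth_alg_inv f : (forall u, D u -> f u <> 0) -> smooth_alg D P f ->
    smooth_alg D P (fun u => / f u)
| smooth_alg_comp f g : (forall u, smooth_at f u) -> smooth_alg D P g ->
    smooth_alg D P (fun u => f (g u)).

Lemma smooth_at_const (c t : R) : smooth_at (fun=> c) t.
Proof.
apply: (@smooth_at_coind (fun=> True) (fun f => exists c, f = fun=> c)) => //.
- exact: open_true.
- move=> _ [d ->]; exists (fun=> 0); split; first by exists 0.
  by move=> u _; exact: is_derive_const.
- by exists c.
Qed.

Lemma smooth_alg_derive (D : R -> Prop) (P : (R -> R) -> Prop) :
  (forall f, P f -> exists g,
     smooth_alg D P g /\ forall u, D u -> is_derive f u (g u)) ->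
  forall f, smooth_alg D P f -> exists g,
     smooth_alg D P g /\ forall u, D u -> is_derive f u (g u).
Proof.
move=> HP f; have sc c : smooth_alg D P (fun=> c).
  by apply: smooth_alg_base => u _; exact: smooth_at_const.
elim=> {f} [f|f Hf|f g Af [f' [Af' ff']] Ag [g' [Ag' gg']]|
    f g Af [f' [Af' ff']] Ag [g' [Ag' gg']]|f f0 Af [f' [Af' ff']]|
    f g Hf Ag [g' [Ag' gg']]].
- exact: HP.
- exists (Derive f); split.
    by apply: smooth_alg_base => u /Hf; exact: smooth_at_Derive.
  by move=> u /Hf H; exact: (@smooth_at_is_derive f u 0).
- exists (fun u => f' u + g' u); split; first exact: smooth_alg_plus.
  by move=> u Du; apply: (@is_derive_plus _ _ f g); auto.
- exists (fun u => f' u * g u + f u * g' u); split.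
    by apply: smooth_alg_plus; exact: smooth_alg_mult.
  move=> u Du; apply: (@is_derive_mult _ f g); auto.
  by move=> x y; exact: Rmult_comm.
- exists (fun u => (-1 * f' u) * (/ f u * / f u)); split.
    by apply: smooth_alg_mult; apply: smooth_alg_mult => //; exact: smooth_alg_inv.
  move=> u Du; have fu := f0 _ Du.
  have -> : -1 * f' u * (/ f u * / f u) = - f' u / f u ^ 2 by field.
  by apply: is_derive_inv; auto.
- exists (fun u => g' u * Derive f (g u)); split.
    apply: smooth_alg_mult => //; apply: smooth_alg_comp => // u.
    exact: smooth_at_Derive.
  move=> u Du; apply: (@is_derive_comp _ _ f g); last exact: gg'.
  exact: (@smooth_at_is_derive f _ 0).
Qed.

(* Coinduction up to algebraic operations. *)
Lemma smooth_alg_at (D : R -> Prop) (P : (R -> R) -> Prop) :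
  open D ->
  (forall f, P f -> exists g,
     smooth_alg D P g /\ forall u, D u -> is_derive f u (g u)) ->
  forall f t, smooth_alg D P f -> D t -> smooth_at f t.
Proof.
move=> oD HP; apply: smooth_at_coind => // g; exact: smooth_alg_derive.
Qed.

(** With this empty class of generators, [smooth_alg_at] gives the stability of smoothness under
    sums, products, inverses and composition. *)
Definition no_fun (f : R -> R) := False.

Lemma smooth_at_plus (f g : R -> R) (t : R) :
  smooth_at f t -> smooth_at g t -> smooth_at (fun u => f u + g u) t.
Proof.
move=> Hf Hg; apply: (@smooth_alg_at (fun u => smooth_at f u /\ smooth_at g u) no_fun) => //.
- by move=> u [Fu Gu]; apply: filter_and; exact: smooth_at_locally.
- by apply: smooth_alg_plus; apply: smooth_alg_base => u [].
Qed.

Lemma smooth_at_mult (f g : R -> R) (t : R) :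
  smooth_at f t -> smooth_at g t -> smooth_at (fun u => f u * g u) t.
Proof.
move=> Hf Hg; apply: (@smooth_alg_at (fun u => smooth_at f u /\ smooth_at g u) no_fun) => //.
- by move=> u [Fu Gu]; apply: filter_and; exact: smooth_at_locally.
- by apply: smooth_alg_mult; apply: smooth_alg_base => u [].
Qed.

Lemma continuous_neq0 (f : R -> R) (t : R) :
  continuous f t -> f t <> 0 -> locally t (fun u => f u <> 0).
Proof. by move=> Hf f0; exact: (Hf (fun v => v <> 0) (open_neq 0 _ f0)). Qed.

Lemma smooth_at_inv (f : R -> R) (t : R) :
  smooth_at f t -> f t <> 0 -> smooth_at (fun u => / f u) t.
Proof.
move=> Hf f0; apply: (@smooth_alg_at (fun u => smooth_at f u /\ f u <> 0) no_fun) => //.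
- move=> u [Fu u0]; apply: filter_and; first exact: smooth_at_locally.
  by apply: continuous_neq0 => //; exact: (@smooth_at_continuous _ _ 0).
- by apply: smooth_alg_inv => [u []//|]; apply: smooth_alg_base => u [].
Qed.

Lemma smooth_at_comp (f g : R -> R) (t : R) :
  (forall u, smooth_at f u) -> smooth_at g t -> smooth_at (fun u => f (g u)) t.
Proof.
move=> Hf Hg; apply: (@smooth_alg_at (smooth_at g) no_fun) => //.
- by move=> u; exact: smooth_at_locally.
- by apply: smooth_alg_comp => //; apply: smooth_alg_base.
Qed.

Lemma smooth_at_scal (c : R) (f : R -> R) (t : R) :
  smooth_at f t -> smooth_at (fun u => c * f u) t.
Proof. by apply: smooth_at_mult; exact: smooth_at_const. Qed.

Lemma smooth_at_opp (f : R -> R) (t : R) :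
  smooth_at f t -> smooth_at (fun u => - f u) t.
Proof.
move=> /(smooth_at_scal (-1)); apply: smooth_at_ext_loc.
by apply: filter_forall => u; ring.
Qed.

Lemma smooth_at_minus (f g : R -> R) (t : R) :
  smooth_at f t -> smooth_at g t -> smooth_at (fun u => f u - g u) t.
Proof. by move=> Hf Hg; apply: smooth_at_plus => //; exact: smooth_at_opp. Qed.

Lemma smooth_at_id (t : R) : smooth_at id t.
Proof.
pose P (f : R -> R) := f = id \/ exists c, f = fun=> c.
apply: (@smooth_at_coind (fun=> True) P _ _ id t).
- exact: open_true.
- move=> f [->|[c ->]].
    exists (fun=> 1); split; first by right; exists 1.
    by move=> u _; exact: is_derive_id.
  exists (fun=> 0); split; first by right; exists 0.
  by move=> u _; exact: is_derive_const.
- by left.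
- by [].
Qed.

Lemma smooth_at_pow (f : R -> R) (t : R) (n : nat) :
  smooth_at f t -> smooth_at (fun u => f u ^ n) t.
Proof.
move=> Hf; elim: n => [|n IHn] /=; first exact: smooth_at_const.
exact: smooth_at_mult.
Qed.

Lemma smooth_at_PSeries (a : nat -> R) (x : R) :
  Rbar_lt (Rabs x) (CV_radius a) -> smooth_at (PSeries a) x.
Proof.
pose P (f : R -> R) := exists b, CV_radius b = CV_radius a /\ f = PSeries b.
apply: (@smooth_at_coind (fun x => Rbar_lt (Rabs x) (CV_radius a)) P);
  last by exists a.
- move=> u; case: (CV_radius a) => [r| |] //= ur; last exact: filter_forall.
  apply/locally_Rabs; exists (r - Rabs u); split; first lra.
  move=> y yu; have -> : y = (y - u) + u by ring.
  by apply: Rle_lt_trans (Rabs_triang _ _) _; lra.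
- move=> _ [b [ba ->]]; exists (PSeries (PS_derive b)); split.
    by exists (PS_derive b); rewrite CV_radius_derive.
  by move=> u; rewrite -ba; exact: is_derive_PSeries.
Qed.

Lemma smooth_at_translate (f : R -> R) (b t : R) :
  smooth_at f (t - b) -> smooth_at (fun u => f (u - b)) t.
Proof.
move=> /locally_Rabs [e [e0 He]]; apply/locally_Rabs; exists e; split=> // u ut k.
have Hu : ex_derive (Derive_n f k) (u - b).
  by apply: He; have -> : u - b - (t - b) = u - t by ring.
apply: (ex_derive_ext (fun v => Derive_n f k (v + - b))) => [v|].
  by rewrite -Derive_n_comp_trans.
by apply: (ex_derive_comp (Derive_n f k) (fun v => v + - b)) => //; auto_derive.
Qed.

(** * Borel's theorem *)

(** Meant for points where a function is flat: a quadratic error bound is easier to obtain there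
    than a limit of difference quotients. *)
Lemma is_derive_quadratic (f : R -> R) (x l C : R) :
  locally x (fun y => Rabs (f y - f x - l * (y - x)) <= C * (y - x) ^ 2) ->
  is_derive f x l.
Proof.
move=> /locally_Rabs [d [d0 Hd]]; apply/is_derive_Reals => e e0.
have C1 : 0 < Rabs C + 1 by have := Rabs_pos C; lra.
have m0 : 0 < Rmin d (e / (Rabs C + 1)).
  by apply: Rmin_pos => //; exact: Rdiv_lt_0_compat.
exists (mkposreal _ m0) => h h0 /= hm.
have hd : Rabs h < d by apply: Rlt_le_trans hm _; exact: Rmin_l.
have he : Rabs h < e / (Rabs C + 1) by apply: Rlt_le_trans hm _; exact: Rmin_r.
have xh : x + h - x = h by ring.
have := Hd (x + h); rewrite xh => /(_ hd) Hf.
have ah : 0 < Rabs h by exact: Rabs_pos_lt.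
have -> : (f (x + h) - f x) / h - l = (f (x + h) - f x - l * h) / h by field.
rewrite /Rdiv Rabs_mult Rabs_inv; apply: (Rmult_lt_reg_r (Rabs h)) => //.
rewrite Rmult_assoc Rinv_l ?Rmult_1_r; last lra.
apply: Rle_lt_trans Hf _; rewrite -Rsqr_pow2 Rsqr_abs /Rsqr.
have CC := Rle_abs C.
have : Rabs h * (Rabs C + 1) < e.
  have := Rmult_lt_compat_r _ _ _ C1 he.
  by rewrite /Rdiv Rmult_assoc Rinv_l ?Rmult_1_r; lra.
by nra.
Qed.

(** [flat_exp 0] is the classical flat function. The powers of [/ x] are included because
    differentiation creates them: the derivative of [flat_exp N] is [flat_exp N.+2] minus [N] times
    [flat_exp N.+1]. *)
Definition flat_exp (N : nat) (x : R) : R :=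
  if Rlt_dec 0 x then exp (- / x) * (/ x) ^ N else 0.

(** For z = y / (k + 1), z <= exp z gives z^k <= (exp z)^k <= (exp z)^(k+1) = exp y. Dividing by k +
    1 instead of k covers k = 0 as well. *)
Lemma exp_ge_pow (k : nat) (y : R) : 0 < y -> y ^ k <= INR k.+1 ^ k * exp y.
Proof.
move=> y0.
have expM z : forall n, exp (INR n * z) = exp z ^ n.
  elim=> [|n IHn]; first by rewrite /= Rmult_0_l exp_0.
  by rewrite S_INR Rmult_plus_distr_r Rmult_1_l exp_plus IHn /= Rmult_comm.
have k0 : 0 < INR k.+1 by apply: lt_0_INR; lia.
have yE : y = INR k.+1 * (y / INR k.+1) by field; lra.
have z0 : 0 < y / INR k.+1 by exact: Rdiv_lt_0_compat.
rewrite {1}yE Rpow_mult_distr; apply: Rmult_le_compat_l; first by apply: pow_le; lra.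
rewrite {2}yE expM; move: (y / INR k.+1) z0 => z z0.
have ez := exp_ineq1_le z.
have : z ^ k <= exp z ^ k by apply: pow_incr; lra.
have : 1 <= exp z ^ 1 by rewrite /=; lra.
have := pow_lt (exp z) k (exp_pos z); rewrite [exp z ^ k.+1]/=; nra.
Qed.

(** This is [exp_ge_pow] at y = 1/x with exponent N + 2; the two spare powers become the factor x^2
    that [is_derive_quadratic] needs at 0. *)
Lemma flat_exp_quadratic (N : nat) (x : R) :
  Rabs (flat_exp N x) <= INR (N.+3) ^ (N.+2) * x ^ 2.
Proof.
rewrite /flat_exp; case: Rlt_dec => x0; last first.
  rewrite Rabs_R0; apply: Rmult_le_pos; last exact: pow2_ge_0.
  by apply: pow_le; exact: pos_INR.
have y0 : 0 < / x by exact: Rinv_0_lt_compat.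
have := exp_ge_pow N.+2 y0.
rewrite Rabs_right; last first.
  by apply: Rle_ge; apply: Rmult_le_pos; [have := exp_pos (- / x); lra|apply: pow_le; lra].
rewrite exp_Ropp; set K := INR _ ^ _; have ep := exp_pos (/ x).
have -> : (/ x) ^ N.+2 = (/ x) ^ N * (/ x) ^ 2 by rewrite /=; ring.
move=> H; apply: (Rmult_le_reg_l (exp (/ x))) => //.
rewrite -Rmult_assoc Rinv_r ?Rmult_1_l; last lra.
have x2 : 0 < x ^ 2 by apply: pow_lt.
have := Rmult_le_compat_r (x ^ 2) _ _ (Rlt_le _ _ x2) H.
have -> : (/ x) ^ N * (/ x) ^ 2 * x ^ 2 = (/ x) ^ N by field; lra.
lra.
Qed.

Lemma smooth_at_flat_exp (N : nat) (t : R) : smooth_at (flat_exp N) t.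
Proof.
pose P f := exists N, f = flat_exp N.
apply: (@smooth_alg_at (fun=> True) P) => //; first exact: open_true; last first.
  by apply: smooth_alg_gen; exists N.
move=> _ [M ->]; exists (fun u => flat_exp M.+2 u + - INR M * flat_exp M.+1 u).
split.
  apply: smooth_alg_plus; first by apply: smooth_alg_gen; exists M.+2.
  apply: smooth_alg_mult; last by apply: smooth_alg_gen; exists M.+1.
  by apply: smooth_alg_base => u _; exact: smooth_at_const.
move=> u _; rewrite {2 3}/flat_exp; case: Rlt_dec => u0.
  apply: (is_derive_ext_loc (fun x => exp (- / x) * (/ x) ^ M)).
    apply: filter_imp (open_gt 0 _ u0) => v v0.
    by rewrite /flat_exp; case: Rlt_dec.
  auto_derive; first by lra.
  case: M => [|M]; first by rewrite /=; field; lra.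
  by rewrite -[predn _]/M [INR M.+1]lock /= -lock; field; lra.
rewrite /=; have [u1|u1] : u < 0 \/ u = 0 by lra.
  rewrite !Rmult_0_r Rplus_0_r; apply: (is_derive_ext_loc (fun=> 0)).
    apply: filter_imp (open_lt 0 _ u1) => v v0.
    by rewrite /flat_exp; case: Rlt_dec => [?|//]; lra.
  exact: is_derive_const.
(* At 0 the two defining formulas meet; the value and the claimed derivative are both 0, and the
   quadratic bound applies. *)
rewrite u1 !Rmult_0_r Rplus_0_r; apply: (@is_derive_quadratic _ _ _ (INR (M.+3) ^ (M.+2))).
apply: filter_forall => y; have := flat_exp_quadratic M y.
have -> : flat_exp M 0 = 0 by rewrite /flat_exp; case: Rlt_dec => [?|//]; lra.
by rewrite Rmult_0_l !Rminus_0_r.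
Qed.

(** Equal to 1 on [-1, 1] and to 0 outside (-2, 2). The denominator is positive because 4 - x^2 and
    x^2 - 1 are never both non-positive. *)
Definition cutoff (x : R) : R :=
  flat_exp 0 (4 - x ^ 2) / (flat_exp 0 (4 - x ^ 2) + flat_exp 0 (x ^ 2 - 1)).

Lemma flat_exp0_gt0 (x : R) : 0 < x -> 0 < flat_exp 0 x.
Proof.
by move=> x0; rewrite /flat_exp; case: Rlt_dec => //= _; have := exp_pos (- / x); lra.
Qed.

Lemma flat_exp0_ge0 (x : R) : 0 <= flat_exp 0 x.
Proof.
by rewrite /flat_exp; case: Rlt_dec => //= _; have := exp_pos (- / x); lra.
Qed.

Lemma flat_exp0_eq0 (x : R) : x <= 0 -> flat_exp 0 x = 0.
Proof. by move=> x0; rewrite /flat_exp; case: Rlt_dec => [?|//]; lra. Qed.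

Lemma smooth_at_cutoff (t : R) : smooth_at cutoff t.
Proof.
have s2 : smooth_at (fun u => u ^ 2) t by apply: smooth_at_pow; exact: smooth_at_id.
have e1 : smooth_at (fun u => flat_exp 0 (4 - u ^ 2)) t.
  apply: (@smooth_at_comp (flat_exp 0)); first exact: smooth_at_flat_exp.
  by apply: smooth_at_minus => //; exact: smooth_at_const.
apply: smooth_at_mult => //; apply: smooth_at_inv.
  apply: smooth_at_plus => //.
  apply: (@smooth_at_comp (flat_exp 0)); first exact: smooth_at_flat_exp.
  by apply: smooth_at_minus => //; exact: smooth_at_const.
apply: Rgt_not_eq; have [H|H] := Rlt_le_dec (t ^ 2) 4.
  have := @flat_exp0_gt0 (4 - t ^ 2); have := @flat_exp0_ge0 (t ^ 2 - 1); lra.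
have := @flat_exp0_ge0 (4 - t ^ 2); have := @flat_exp0_gt0 (t ^ 2 - 1); lra.
Qed.

Lemma cutoff_eq1 (x : R) : Rabs x <= 1 -> cutoff x = 1.
Proof.
move=> x1; have x2 : x ^ 2 <= 1.
  by rewrite -Rsqr_pow2 Rsqr_abs /Rsqr; have := Rabs_pos x; nra.
have := @flat_exp0_gt0 (4 - x ^ 2); rewrite /cutoff (@flat_exp0_eq0 (x ^ 2 - 1)); last lra.
by move=> /(_ ltac:(lra)) ?; field; lra.
Qed.

Lemma cutoff_eq0 (x : R) : 2 <= Rabs x -> cutoff x = 0.
Proof.
move=> x2; rewrite /cutoff flat_exp0_eq0 ?Rdiv_0_l //.
have : 2 * 2 <= Rabs x * Rabs x by apply: Rmult_le_compat; lra.
by rewrite -/(Rsqr (Rabs x)) -Rsqr_abs Rsqr_pow2; lra.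
Qed.

Lemma geom_tail_cauchy (u : nat -> R -> R) (k N p : nat) (x : R) :
  (forall n y, (k < n)%N -> Rabs (u n y) <= (/ 2) ^ n) -> (k <= N)%N ->
  Rabs (sum_n (u^~ x) (N + p) - sum_n (u^~ x) N) <= (/ 2) ^ N - (/ 2) ^ (N + p).
Proof.
move=> Hu kN; elim: p => [|p IHp].
  by rewrite addn0 !Rminus_diag_eq // Rabs_R0; exact: Rle_refl.
rewrite addnS sum_Sn /plus /=.
have kS : (k < (N + p).+1)%N by rewrite ltnS (leq_trans kN) // leq_addr.
have := Hu _ x kS; rewrite /=.
set S := sum_n _ (N + p) in IHp *; set S0 := sum_n _ N in IHp *.
have -> : S + u (N + p).+1 x - S0 = (S - S0) + u (N + p).+1 x by ring.
have := Rabs_triang (S - S0) (u (N + p).+1 x); lra.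
Qed.

(** Weierstrass' test. Only terms beyond [k] are bounded because in Borel's construction the [k]-th
    derivative of term [n] is small only for n > k. *)
Lemma CVU_dom_geom (u : nat -> R -> R) (k : nat) :
  (forall n y, (k < n)%N -> Rabs (u n y) <= (/ 2) ^ n) ->
  CVU_dom (fun N x => sum_n (u^~ x) N) (fun=> True).
Proof.
move=> Hu; apply/CVU_dom_cauchy => e.
have [N HN] : exists N, forall n, (N <= n)%coq_nat -> (/ 2) ^ n < e.
  have [||N HN] := @pow_lt_1_zero (/ 2) _ e; first by rewrite Rabs_right; lra.
    exact: cond_pos.
  exists N => n /HN; rewrite Rabs_right // ; apply: Rle_ge; apply: pow_le; lra.
exists (maxn k N).
have key n m x : (maxn k N <= n)%N -> (n <= m)%N ->
    Rabs (sum_n (u^~ x) n - sum_n (u^~ x) m) < e.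
  rewrite geq_max => /andP[kn Nn] nm; rewrite Rabs_minus_sym.
  have := geom_tail_cauchy (m - n) x Hu kn; rewrite subnKC //.
  have := HN n (ltac:(apply/leP)); have : 0 <= (/ 2) ^ m by apply: pow_le; lra.
  move=> h1 h2 h3; have h4 := h2 Nn; lra.
move=> n m x _ /leP kn /leP km; case: (leqP n m) => nm; first exact: key.
by rewrite Rabs_minus_sym; apply: key => //; exact: ltnW.
Qed.

(** For each order the differentiated series converges uniformly, so the limits differentiate into
    one another, and smoothness follows by coinduction. *)
Lemma smooth_geom_series (psi : nat -> R -> R) :
  (forall n x, smooth_at (psi n) x) ->
  (forall k n x, (k < n)%N -> Rabs (Derive_n (psi n) k x) <= (/ 2) ^ n) ->
  exists F : R -> R, (forall x, smooth_at F x) /\ forall k x,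
    Derive_n F k x = Lim_seq (fun N => sum_n (fun n => Derive_n (psi n) k x) N).
Proof.
move=> Hs Hb.
pose fn k N x := sum_n (fun n => Derive_n (psi n) k x) N.
pose F k x : R := Lim_seq (fun N => fn k N x).
have dfn k N x : is_derive (fn k N) x (fn k.+1 N x).
  apply: (@is_derive_sum_n _ _ (fun n => Derive_n (psi n) k)) => n _.
  exact: smooth_at_is_derive.
have Dfn k N x : Derive (fn k N) x = fn k.+1 N x by exact: is_derive_unique.
have dF k x : is_derive (F k) x (F k.+1 x).
  have -> : F k.+1 x = Lim_seq (fun N => Derive (fn k N) x).
    by rewrite /F (Lim_seq_ext _ _ (fun N => Dfn k N x)).
  apply: (@CVU_Derive (fn k) (fun=> True)) => //.
  - exact: open_true.
  - by apply: (@CVU_dom_geom (fun n => Derive_n (psi n) k) k) => n y; exact: Hb.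
  - by move=> N y _; eexists; exact: dfn.
  - move=> N y _; apply/continuity_pt_filterlim.
    apply: (continuous_ext (fn k.+1 N)) => [z|]; first by rewrite Dfn.
    by apply: ex_derive_continuous; eexists; exact: dfn.
  - move=> e; have [N HN] :=
      @CVU_dom_geom (fun n => Derive_n (psi n) k.+1) k.+1 (fun n y => Hb _ n y) e.
    exists N => n nN y _; have := HN n nN y I.
    by rewrite Dfn (Lim_seq_ext _ _ (fun N => Dfn k N y)).
exists (F 0%N); split=> [x|k x].
  apply: (@smooth_at_coind (fun=> True) (fun f => exists k, f = F k)) => //.
  - exact: open_true.
  - by move=> _ [k ->]; exists (F k.+1); split; [exists k.+1|].
  - by exists 0%N.
rewrite -[RHS]/(F k x); elim: k x => [|k IHk] x //=.
by rewrite (Derive_ext _ _ _ IHk); exact: is_derive_unique.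
Qed.

Definition borel_term (n : nat) (x : R) : R := x ^ n * cutoff x / INR (Factorial.fact n).

Lemma smooth_at_borel_term (n : nat) (x : R) : smooth_at (borel_term n) x.
Proof.
apply: smooth_at_mult; last exact: smooth_at_const.
by apply: smooth_at_mult; [apply: smooth_at_pow; exact: smooth_at_id|exact: smooth_at_cutoff].
Qed.

Lemma borel_term_jet (n k : nat) :
  Derive_n (borel_term n) k 0 = if n == k then 1 else 0.
Proof.
have fn0 m := INR_fact_neq_0 m.
rewrite (@Derive_n_ext_loc _ (fun x => / INR (Factorial.fact n) * x ^ n)); last first.
  apply/locally_Rabs; exists 1; split; first lra.
  move=> y; rewrite Rminus_0_r => y1; rewrite /borel_term cutoff_eq1; last lra.
  by rewrite Rmult_1_r Rmult_comm.
rewrite Derive_n_scal_l; case: ltngtP => [nk|kn|->].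
- by rewrite Derive_n_pow_bigi ?Rmult_0_r //; apply/ltP.
- rewrite Derive_n_pow_smalli; last by apply/leP; exact: ltnW.
  by rewrite pow_i ?Rmult_0_r //; apply/ltP; move: kn; rewrite -subn_gt0.
- rewrite Derive_n_pow_smalli //.
  by rewrite PeanoNat.Nat.sub_diag /=; field; apply: fn0.
Qed.

Lemma borel_term_bounded (n k : nat) :
  exists M, forall x, Rabs (Derive_n (borel_term n) k x) <= M.
Proof.
have ct x : continuity_pt (Derive_n (borel_term n) k) x.
  apply/continuity_pt_filterlim; apply: smooth_at_continuous.
  exact: smooth_at_borel_term.
(* The term vanishes beyond 2; going up to 3 leaves room for the neighbourhoods of radius 1 used
   outside the interval. *)
have [x0 [Hx0 _]] := continuity_ab_maj (fun x => Rabs (Derive_n (borel_term n) k x)) (-3) 3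
  (ltac:(lra)) (fun c _ => continuity_pt_comp _ _ _ (ct c) (Rcontinuity_abs _)).
exists (Rabs (Derive_n (borel_term n) k x0)) => x.
have [H|H] := Rle_lt_dec (Rabs x) 3.
  by apply: Hx0; have [] := Rabs_le_between x 3; tauto.
rewrite (@Derive_n_ext_loc _ (fun=> 0)); last first.
  apply/locally_Rabs; exists 1; split; first lra.
  move=> y xy; rewrite /borel_term cutoff_eq0 ?Rmult_0_r ?Rdiv_0_l //.
  have := Rabs_triang (x - y) y; have -> : x - y + y = x by ring.
  rewrite Rabs_minus_sym; lra.
by case: k {ct Hx0} => [|k]; rewrite ?Derive_n_const /= Rabs_R0; exact: Rabs_pos.
Qed.

Lemma borel_term_bounded_below (n : nat) :
  exists M, 0 <= M /\
    forall k x, (k < n)%N -> Rabs (Derive_n (borel_term n) k x) <= M.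
Proof.
suff H m : exists M, 0 <= M /\
    forall k x, (k < m)%N -> Rabs (Derive_n (borel_term n) k x) <= M by exact: H.
elim: m => [|m [M [M0 HM]]]; first by exists 0; split=> //; lra.
have [M' HM'] := borel_term_bounded n m.
exists (Rmax M M'); split; first by apply: Rle_trans M0 _; exact: Rmax_l.
move=> k x; rewrite ltnS leq_eqVlt => /orP[/eqP->|km].
  by apply: Rle_trans (HM' x) _; exact: Rmax_r.
by apply: Rle_trans (HM k x km) _; exact: Rmax_l.
Qed.

(** Take psi(x) = c la^(-n) phi(la x) with phi = [borel_term n]. The only non-zero entry of the jet
    at 0 has order n and does not depend on [la], whereas a derivative of order k < n acquires the
    factor la^(k-n) <= 1/la. The choice of [la] gives |c| M / la <= 2^(-n). *)
Lemma borel_scaled_term (c : R) (n : nat) : exists psi : R -> R,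
  [/\ forall x, smooth_at psi x,
      forall k x, (k < n)%N -> Rabs (Derive_n psi k x) <= (/ 2) ^ n &
      forall k, Derive_n psi k 0 = if n == k then c else 0].
Proof.
have [M [M0 HM]] := borel_term_bounded_below n.
pose la := 1 + Rabs c * M * 2 ^ n.
have la1 : 1 <= la.
  suff : 0 <= Rabs c * M * 2 ^ n by rewrite /la; lra.
  apply: Rmult_le_pos; last by apply: pow_le; lra.
  by apply: Rmult_le_pos => //; exact: Rabs_pos.
have sx x : smooth_at (fun y => borel_term n (la * y)) x.
  apply: (@smooth_at_comp (borel_term n)); first exact: smooth_at_borel_term.
  by apply: smooth_at_scal; exact: smooth_at_id.
pose psi x := c * (/ la) ^ n * borel_term n (la * x).
have dpsi k x : Derive_n psi k x =
    c * (/ la) ^ n * (la ^ k * Derive_n (borel_term n) k (la * x)).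
  rewrite /psi Derive_n_scal_l Derive_n_comp_scal //.
  apply: filter_forall => y j _; case: j => // j.
  by apply: smooth_at_ex_derive; exact: smooth_at_borel_term.
exists psi; split=> [x|k x kn|k]; first exact: smooth_at_scal.
- rewrite dpsi.
  have -> : c * (/ la) ^ n * (la ^ k * Derive_n (borel_term n) k (la * x)) =
      (/ la) ^ (n - k) * (c * Derive_n (borel_term n) k (la * x)).
    have e1 : (/ la) ^ n = (/ la) ^ (n - k) * (/ la) ^ k.
      by rewrite -pow_add; congr (_ ^ _); rewrite -[RHS]/(n - k + k)%N subnK // ltnW.
    have e2 : (/ la) ^ k * la ^ k = 1.
      by rewrite -Rpow_mult_distr Rinv_l ?pow1 //; lra.
    move: (Derive_n _ _ _) => X; rewrite e1.
    transitivity ((/ la) ^ (n - k) * ((/ la) ^ k * la ^ k) * (c * X)); first ring.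
    by rewrite e2; ring.
  have il : 0 < / la by apply: Rinv_0_lt_compat; lra.
  have il1 : / la <= 1 by rewrite -Rinv_1; apply: Rinv_le_contravar; lra.
  rewrite !Rabs_mult Rabs_right; last by apply: Rle_ge; apply: pow_le; lra.
  have h1 : (/ la) ^ (n - k) <= / la.
    have : (0 < n - k)%N by rewrite subn_gt0.
    case: (n - k)%N => // j _ /=.
    by have := pow_incr (/ la) 1 j; rewrite pow1; nra.
  have h2 : Rabs c * Rabs (Derive_n (borel_term n) k (la * x)) <= Rabs c * M.
    by apply: Rmult_le_compat_l; [exact: Rabs_pos|exact: HM].
  have cM : 0 <= Rabs c * M by apply: Rmult_le_pos => //; exact: Rabs_pos.
  apply: Rle_trans (_ : / la * (Rabs c * M) <= _).
    apply: Rmult_le_compat => //; first by apply: pow_le; lra.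
    by apply: Rmult_le_pos; exact: Rabs_pos.
  apply: (Rmult_le_reg_l la); first lra.
  rewrite -Rmult_assoc Rinv_r ?Rmult_1_l; last lra.
  have p2 : 0 < 2 ^ n by apply: pow_lt; lra.
  have -> : (/ 2) ^ n = / 2 ^ n by rewrite pow_inv.
  apply: (Rmult_le_reg_r (2 ^ n)) => //.
  by rewrite (Rmult_assoc la) Rinv_l ?Rmult_1_r /la; lra.
- rewrite dpsi Rmult_0_r borel_term_jet; case: eqP => [->|_]; last by rewrite !Rmult_0_r.
  rewrite Rmult_1_r Rmult_assoc -Rpow_mult_distr Rinv_l; last lra.
  by rewrite pow1 Rmult_1_r.
Qed.

Lemma borel (c : nat -> R) : exists F : R -> R,
  (forall x, smooth_at F x) /\ forall k, Derive_n F k 0 = c k.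
Proof.
have [psi Hpsi] := choice (fun n => borel_scaled_term (c n) n).
have [||F [sF dF]] := @smooth_geom_series psi.
- by move=> n x; case: (Hpsi n).
- by move=> k n x; case: (Hpsi n) => _ + _; exact.
(* At 0 only the term of index [k] contributes to the [k]-th derivative, so the partial sums are
   eventually constant. *)
exists F; split=> // k; rewrite dF (Lim_seq_ext_loc _ (fun=> c k)) ?Lim_seq_const //.
have psi0 n : Derive_n (psi n) k 0 = if n == k then c k else 0.
  by case: (Hpsi n) => _ _ ->; case: eqP => [->|].
exists k => N /leP; elim: N => [|N IHN].
  by rewrite leqn0 => /eqP k0; rewrite sum_O psi0 k0.
rewrite leq_eqVlt sum_Sn psi0 /plus /= => /orP[/eqP kN|kN].
  rewrite kN eqxx -kN (@sum_n_ext_loc _ _ (fun=> 0)).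
    by rewrite sum_n_const Rmult_0_r Rplus_0_l.
  move=> n /leP nN; rewrite psi0; case: eqP => // nk.
  by move: nN; rewrite nk kN ltnn.
by rewrite IHN // gtn_eqF ?Rplus_0_r.
Qed.

(** * Derivatives relative to a set *)

Lemma is_derive_withinP (D : R -> Prop) (f : R -> R) (x l : R) :
  is_derive_within D f x l <-> forall e, 0 < e -> exists d, 0 < d /\
    forall y, Rabs (y - x) < d -> y <> x -> D y ->
      Rabs ((f y - f x) / (y - x) - l) < e.
Proof.
split=> [H e e0|H P /locally_Rabs [e [e0 He]]].
  have := H (fun z => Rabs (z - l) < e); case.
    by apply/locally_Rabs; exists e.
  by move=> d Hd; exists d; split; [exact: cond_pos|].
have [d [d0 Hd]] := H e e0.
by exists (mkposreal _ d0) => y yx y0 Dy; apply: He; exact: Hd.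
Qed.

Lemma is_derive_within_sub (D1 D2 : R -> Prop) (f : R -> R) (x l : R) :
  (forall y, D2 y -> D1 y) -> is_derive_within D1 f x l ->
  is_derive_within D2 f x l.
Proof.
move=> sub /is_derive_withinP H; apply/is_derive_withinP => e e0.
by have [d [d0 Hd]] := H e e0; exists d; split=> // y yx y0 /sub; exact: Hd.
Qed.

Lemma is_derive_within_ext (D : R -> Prop) (f g : R -> R) (x l : R) :
  D x -> (forall y, D y -> f y = g y) -> is_derive_within D f x l ->
  is_derive_within D g x l.
Proof.
move=> Dx fg /is_derive_withinP H; apply/is_derive_withinP => e e0.
have [d [d0 Hd]] := H e e0; exists d; split=> // y yx y0 Dy.
by rewrite -!fg //; exact: Hd.
Qed.

Lemma is_derive_within_is_derive (D : R -> Prop) (f : R -> R) (x l : R) :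
  is_derive f x l -> is_derive_within D f x l.
Proof.
move=> /is_derive_Reals H; apply/is_derive_withinP => e e0.
have [d Hd] := H e e0; exists d; split; first exact: cond_pos.
move=> y yx y0 _; have := Hd (y - x) (ltac:(lra)) yx.
by have -> : x + (y - x) = y by ring.
Qed.

(** Glues derivatives taken from the two sides of a point. *)
Lemma is_derive_within_union (D1 D2 : R -> Prop) (f : R -> R) (x l : R) :
  locally x (fun y => D1 y \/ D2 y) ->
  is_derive_within D1 f x l -> is_derive_within D2 f x l -> is_derive f x l.
Proof.
move=> /locally_Rabs [d [d0 Hd]] /is_derive_withinP H1 /is_derive_withinP H2.
apply/is_derive_Reals => e e0.
have [d1 [d10 Hd1]] := H1 e e0; have [d2 [d20 Hd2]] := H2 e e0.
have m0 : 0 < Rmin d (Rmin d1 d2) by do 2!apply: Rmin_pos => //.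
exists (mkposreal _ m0) => h h0 /= hm.
have [hd [hd1 hd2]] : Rabs h < d /\ Rabs h < d1 /\ Rabs h < d2.
  have := Rmin_l d (Rmin d1 d2); have := Rmin_r d (Rmin d1 d2).
  have := Rmin_l d1 d2; have := Rmin_r d1 d2; lra.
have xh : x + h - x = h by ring.
have xh0 : x + h <> x by lra.
have := Hd (x + h); have := Hd1 (x + h); have := Hd2 (x + h).
rewrite xh => h2 h1 /(_ hd) [/h1|/h2]; auto.
Qed.

Lemma continuous_withinP (D : R -> Prop) (f : R -> R) (x : R) :
  continuous_within D f x <-> forall e, 0 < e -> exists d, 0 < d /\
    forall y, Rabs (y - x) < d -> D y -> Rabs (f y - f x) < e.
Proof.
split=> [H e e0|H P /locally_Rabs [e [e0 He]]].
  have := H (fun z => Rabs (z - f x) < e); case.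
    by apply/locally_Rabs; exists e.
  by move=> d Hd; exists d; split; [exact: cond_pos|].
have [d [d0 Hd]] := H e e0.
by exists (mkposreal _ d0) => y yx Dy; apply: He; exact: Hd.
Qed.

Lemma continuous_within_sub (D1 D2 : R -> Prop) (f : R -> R) (x : R) :
  (forall y, D2 y -> D1 y) -> continuous_within D1 f x ->
  continuous_within D2 f x.
Proof.
move=> sub /continuous_withinP H; apply/continuous_withinP => e e0.
by have [d [d0 Hd]] := H e e0; exists d; split=> // y yx /sub; exact: Hd.
Qed.

Lemma continuous_within_ext (D : R -> Prop) (f g : R -> R) (x : R) :
  D x -> (forall y, D y -> f y = g y) -> continuous_within D f x ->
  continuous_within D g x.
Proof.
move=> Dx fg /continuous_withinP H; apply/continuous_withinP => e e0.
have [d [d0 Hd]] := H e e0; exists d; split=> // y yx Dy.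
by rewrite -!fg //; exact: Hd.
Qed.

Lemma continuous_within_continuous (D : R -> Prop) (f : R -> R) (x : R) :
  continuous f x -> continuous_within D f x.
Proof.
move=> H P /H [d Hd]; exists d => y yx _; exact: Hd.
Qed.

(** At other points every number is vacuously a derivative relative to [D], and [derive_within]
    would be an arbitrary choice. *)
Definition is_limit_point (D : R -> Prop) (x : R) : Prop :=
  forall d, 0 < d -> exists y, D y /\ y <> x /\ Rabs (y - x) < d.

Lemma is_derive_within_unique (D : R -> Prop) (f : R -> R) (x l1 l2 : R) :
  is_limit_point D x -> is_derive_within D f x l1 -> is_derive_within D f x l2 ->
  l1 = l2.
Proof.
move=> aD /is_derive_withinP H1 /is_derive_withinP H2; apply: contrapT => l12.
have e0 : 0 < Rabs (l1 - l2) / 2.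
  by have := Rabs_pos_lt (l1 - l2) (ltac:(lra)); lra.
have [d1 [d10 Hd1]] := H1 _ e0; have [d2 [d20 Hd2]] := H2 _ e0.
have [y [Dy [y0 yx]]] := aD _ (Rmin_pos _ _ d10 d20).
have := Rmin_l d1 d2; have := Rmin_r d1 d2 => m2 m1.
have := Hd1 y (ltac:(lra)) y0 Dy; have := Hd2 y (ltac:(lra)) y0 Dy.
set q := _ / _ => q2 q1.
have := Rabs_triang (l1 - q) (q - l2); have -> : l1 - q + (q - l2) = l1 - l2 by ring.
rewrite (Rabs_minus_sym l1 q); lra.
Qed.

Lemma derive_withinE (D : R -> Prop) (f : R -> R) (x l : R) :
  is_limit_point D x -> is_derive_within D f x l -> derive_within D f x = l.
Proof.
move=> aD Hl; rewrite /derive_within.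
apply: (is_derive_within_unique aD _ Hl).
exact: (xgetPex 0 (ex_intro _ l Hl : exists l, is_derive_within D f x l)).
Qed.

Lemma segment_limit_point (a b x : R) :
  a < b -> segment a b x -> is_limit_point (segment a b) x.
Proof.
move=> ab [ax xb] d d0; have [H|H] := Rle_lt_dec b x.
  have m0 : 0 < Rmin d (b - a) by apply: Rmin_pos; lra.
  have := Rmin_l d (b - a); have := Rmin_r d (b - a) => m2 m1.
  exists (x - Rmin d (b - a) / 2); rewrite /segment; do !split; try lra.
  by rewrite Rabs_left; lra.
have m0 : 0 < Rmin d (b - x) by apply: Rmin_pos; lra.
have := Rmin_l d (b - x); have := Rmin_r d (b - x) => m2 m1.
exists (x + Rmin d (b - x) / 2); rewrite /segment; do !split; try lra.
by rewrite Rabs_right; lra.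
Qed.

Lemma derive_within_n_smooth (D : R -> Prop) (f G : R -> R) (k : nat) (t : R) :
  (forall u, D u -> is_limit_point D u) -> (forall u, D u -> smooth_at G u) ->
  (forall u, D u -> f u = G u) -> D t ->
  derive_within_n D k f t = Derive_n G k t.
Proof.
move=> aD sG fG; elim: k t => [|k IHk] t Dt; first exact: fG.
apply: derive_withinE; first exact: aD.
apply: (is_derive_within_ext Dt) (_ : is_derive_within D (Derive_n G k) t _).
  by move=> y Dy; rewrite -IHk.
by apply: is_derive_within_is_derive; apply: smooth_at_is_derive; exact: sG.
Qed.

Lemma C_on_smooth (D : R -> Prop) (L : regularity) (f G : R -> R) :
  (forall u, D u -> is_limit_point D u) -> (forall u, D u -> smooth_at G u) ->
  (forall u, D u -> f u = G u) -> C_on D L f.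
Proof.
move=> aD sG fG; have dE k t := derive_within_n_smooth k (t := t) aD sG fG.
split=> k x _ Dx.
  exists (Derive_n G k.+1 x).
  apply: (is_derive_within_ext Dx) (_ : is_derive_within D (Derive_n G k) x _).
    by move=> y Dy; rewrite dE.
  by apply: is_derive_within_is_derive; apply: smooth_at_is_derive; exact: sG.
apply: (@continuous_within_ext _ (Derive_n G k)) => // [y Dy|]; first by rewrite dE.
apply: continuous_within_continuous; exact: smooth_at_continuous (sG _ Dx).
Qed.

(** Makes the two-sided [Derive_n] applicable at the ends of a piece. Borel's theorem supplies the
    functions attached beyond [a] and [b], with matching jets. *)
Lemma smooth_extension (a b : R) (f : R -> R) : a < b ->
  C_on (segment a b) RegInf f -> exists F : R -> R,
    (forall t, smooth_at F t) /\ forall t, segment a b t -> F t = f t.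
Proof.
move=> ab [Hd _]; pose d k := derive_within_n (segment a b) k f.
have dd k t : segment a b t -> is_derive_within (segment a b) (d k) t (d k.+1 t).
  move=> st; have [l Hl] := Hd k t isT st.
  have -> // : d k.+1 t = l.
  by apply: derive_withinE Hl; exact: segment_limit_point.
have jet c (u : nat -> R) : exists G : R -> R,
    (forall t, smooth_at G t) /\ forall k, Derive_n G k c = u k.
  have [F [sF Fu]] := borel u; exists (fun t => F (t + - c)); split=> [t|k].
    apply: (@smooth_at_comp F) => //; apply: smooth_at_plus.
      exact: smooth_at_id.
    exact: smooth_at_const.
  by rewrite Derive_n_comp_trans Rplus_opp_r.
have [G [sG Ga]] := jet a (fun k => d k a).
have [H [sH Hb]] := jet b (fun k => d k b).
(* [F k] is the intended [k]-th derivative. With all orders glued separately, it remains to see that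
   [F k] differentiates to [F k.+1], and at [a] and [b] this follows from the equality of the
   jets. *)
pose F k t := if Rlt_dec t a then Derive_n G k t else
  if Rle_dec t b then d k t else Derive_n H k t.
have FG k t : t <= a -> F k t = Derive_n G k t.
  rewrite /F => ta; case: Rlt_dec => //= ta'; have -> : t = a by lra.
  by rewrite Ga; case: Rle_dec => // ?; lra.
have Fd k t : segment a b t -> F k t = d k t.
  by rewrite /F => -[at_ tb]; case: Rlt_dec => [?|?] /=; [lra|case: Rle_dec].
have FH k t : b <= t -> F k t = Derive_n H k t.
  rewrite /F => tb; case: Rlt_dec => [?|?] /=; first lra.
  by case: Rle_dec => //= ?; have -> : t = b by lra.
have wG k t : t <= a -> is_derive_within (fun y => y <= a) (F k) t (F k.+1 t).
  move=> ta; rewrite FG //.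
  apply: (@is_derive_within_ext _ (Derive_n G k)) => // [y ya|]; first by rewrite FG.
  by apply: is_derive_within_is_derive; exact: smooth_at_is_derive.
have wH k t : b <= t -> is_derive_within (fun y => b <= y) (F k) t (F k.+1 t).
  move=> ta; rewrite FH //.
  apply: (@is_derive_within_ext _ (Derive_n H k)) => // [y ya|]; first by rewrite FH.
  by apply: is_derive_within_is_derive; exact: smooth_at_is_derive.
have wd k t : segment a b t -> is_derive_within (segment a b) (F k) t (F k.+1 t).
  move=> st; rewrite Fd //.
  apply: (@is_derive_within_ext _ (d k)) => // [y ya|]; first by rewrite Fd.
  exact: dd.
have dF k t : is_derive (F k) t (F k.+1 t).
  have lt c : t < c -> locally t (fun y => y < c) by move=> tc; exact: open_lt.
  have gt c : c < t -> locally t (fun y => c < y) by move=> tc; exact: open_gt.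
  have [ta|[ta|at_]] := Rtotal_order t a.
  - apply: (is_derive_within_union _ (wG k t _) (wG k t _)); try lra.
    by apply: filter_imp (lt _ ta) => y; lra.
  - apply: (is_derive_within_union _ (wG k t _) (wd k t _)); rewrite /segment; try lra.
    have tb : t < b by lra.
    by apply: filter_imp (lt _ tb) => y; lra.
  have [tb|[tb|bt]] := Rtotal_order t b.
  - apply: (is_derive_within_union _ (wd k t _) (wd k t _)); rewrite /segment; try lra.
    by apply: filter_imp (filter_and _ _ (lt _ tb) (gt _ at_)) => y; lra.
  - apply: (is_derive_within_union _ (wd k t _) (wH k t _)); rewrite /segment; try lra.
    by apply: filter_imp (gt _ at_) => y; lra.
  - apply: (is_derive_within_union _ (wH k t _) (wH k t _)); try lra.
    by apply: filter_imp (gt _ bt) => y; lra.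
exists (F 0%N); split=> [t|t]; last exact: Fd.
apply: (@smooth_at_coind (fun=> True) (fun g => exists k, g = F k)) => //.
- exact: open_true.
- by move=> _ [k ->]; exists (F k.+1); split; [exists k.+1|].
- by exists 0%N.
Qed.

(** * Finite exceptional sets *)

Lemma notin_near_left (E : seq R) (a b : R) : a < b ->
  exists x, a < x < b /\ forall y, x < y < b -> y \notin E.
Proof.
move=> ab; elim: E => [|e E [x [xab Hx]]].
  by exists ((a + b) / 2); split=> //; lra.
have [eb|eb] := Rlt_le_dec e b.
  exists (Rmax x e); have := Rmax_l x e; have := Rmax_r x e => m2 m1.
  split; first by split; [lra|apply: Rmax_lub_lt; lra].
  move=> y xy; rewrite inE negb_or Hx ?andbT; last lra.
  by apply/eqP; lra.
exists x; split=> // y xy; rewrite inE negb_or Hx ?andbT //.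
by apply/eqP; lra.
Qed.

Lemma notin_near_right (E : seq R) (a b : R) : a < b ->
  exists x, a < x < b /\ forall y, a < y < x -> y \notin E.
Proof.
move=> ab; have [x [xab Hx]] := @notin_near_left (map Ropp E) (- b) (- a) (ltac:(lra)).
exists (- x); split; first lra.
move=> y ay; apply/negP => yE; have := Hx (- y) (ltac:(lra)).
by rewrite map_f.
Qed.

Lemma notin_between (E : seq R) (a b : R) : a < b ->
  exists y, a < y < b /\ y \notin E.
Proof.
move=> /(notin_near_left E) [x [xab Hx]]; exists ((x + b) / 2).
by split; [|apply: Hx]; lra.
Qed.

Lemma notin_locally (E : seq R) (t : R) : t \notin E ->
  exists d, 0 < d /\ forall y, Rabs (y - t) < d -> y \notin E.
Proof.
move=> tE.
have [x [xt Hx]] := @notin_near_left E (t - 1) t (ltac:(lra)).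
have [z [zt Hz]] := @notin_near_right E t (t + 1) (ltac:(lra)).
exists (Rmin (t - x) (z - t)); split; first by apply: Rmin_pos; lra.
have := Rmin_l (t - x) (z - t); have := Rmin_r (t - x) (z - t) => m2 m1.
move=> y /Rabs_def2 [y1 y2]; have [yt|[->//|ty]] := Rtotal_order y t.
  by apply: Hx; lra.
by apply: Hz; lra.
Qed.

Lemma pw_eq_sym (a b : R) (f g : R -> R) : pw_eq a b f g -> pw_eq a b g f.
Proof. by move=> [E H]; exists E => x sx xE; rewrite H. Qed.

Lemma pw_eq_trans (a b : R) (f g h : R -> R) :
  pw_eq a b f g -> pw_eq a b g h -> pw_eq a b f h.
Proof.
move=> [E H] [E' H']; exists (E ++ E') => x sx.
by rewrite mem_cat negb_or => /andP[xE xE']; rewrite H // H'.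
Qed.

Lemma pw_eq_sub (a b c d : R) (f g : R -> R) :
  a <= c -> d <= b -> pw_eq a b f g -> pw_eq c d f g.
Proof.
move=> ac db [E H]; exists E => x [cx xd] xE; apply: H => //; split; lra.
Qed.

(** Arbitrarily close to [x] the segment contains points outside the exceptional set. This makes the
    continuous representative of a class unique. *)
Lemma pw_eq_continuous (a b : R) (f g : R -> R) : a < b ->
  (forall x, segment a b x -> continuous_within (segment a b) f x) ->
  (forall x, segment a b x -> continuous_within (segment a b) g x) ->
  pw_eq a b f g -> forall x, segment a b x -> f x = g x.
Proof.
move=> ab Hf Hg [E fg] x sx; apply: contrapT => fgx.
have e0 : 0 < Rabs (f x - g x) / 2.
  by have := Rabs_pos_lt (f x - g x) (ltac:(lra)); lra.
have [d1 [d10 H1]] := (continuous_withinP _ _ _).1 (Hf x sx) _ e0.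
have [d2 [d20 H2]] := (continuous_withinP _ _ _).1 (Hg x sx) _ e0.
have [y [[sy yx] yE]] : exists y, (segment a b y /\ Rabs (y - x) < Rmin d1 d2) /\ y \notin E.
  have m0 := Rmin_pos _ _ d10 d20; case: (sx) => ax xb.
  have [H|H] := Rle_lt_dec b x.
    have [|y [yab yE]] := @notin_between E (Rmax a (x - Rmin d1 d2)) x.
      by apply: Rmax_lub_lt; lra.
    have := Rmax_l a (x - Rmin d1 d2); have := Rmax_r a (x - Rmin d1 d2).
    exists y; split=> //; split; first by split; lra.
    by apply: Rabs_def1; lra.
  have [|y [yab yE]] := @notin_between E x (Rmin b (x + Rmin d1 d2)).
    by apply: Rmin_glb_lt; lra.
  have := Rmin_l b (x + Rmin d1 d2); have := Rmin_r b (x + Rmin d1 d2).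
  exists y; split=> //; split; first by split; lra.
  by apply: Rabs_def1; lra.
have := Rmin_l d1 d2; have := Rmin_r d1 d2 => m2 m1.
have := H1 y (ltac:(lra)) sy; have := H2 y (ltac:(lra)) sy; rewrite (fg y) // => h1 h2.
have := Rabs_triang (f x - g y) (g y - g x).
have -> : f x - g y + (g y - g x) = f x - g x by ring.
rewrite (Rabs_minus_sym (f x) (g y)); lra.
Qed.

(** * Dividing flat functions by analytic ones *)

Lemma smooth_at_analytic (f : R -> R) (t : R) : analytic f -> smooth_at f t.
Proof.
move=> Hf; apply: (@smooth_at_coind (fun=> True) analytic) => //.
- exact: open_true.
- move=> g Hg; exists (Derive g); split; first exact: analytic_Derive.
  by move=> u _; apply: Derive_correct; exact: analytic_ex_derive.
Qed.

Lemma smooth_at_anfun (p : anfun) (t : R) : smooth_at p t.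
Proof. by apply: smooth_at_analytic; exact: anfunP. Qed.

Lemma anfun_neq0_near (p : anfun) (t : R) : (p != 0)%R ->
  locally' t (fun u => p u <> 0).
Proof.
move=> p0; have [H|//] := analytic_dichotomy t (anfunP p).
by case/eqP: p0; apply: anfun_eq => x; exact: (analytic_vanishes (anfunP p) H).
Qed.

Lemma CV_radius_decr_n (a : nat -> R) (k : nat) :
  CV_radius (PS_decr_n a k) = CV_radius a.
Proof.
elim: k => [|k IHk]; first by apply: CV_radius_ext => n; rewrite /PS_decr_n.
rewrite -IHk -[RHS]CV_radius_decr_1; apply: CV_radius_ext => n.
by rewrite /PS_decr_1 /PS_decr_n /= PeanoNat.Nat.add_succ_r.
Qed.

(** [k] is the index of the first non-zero coefficient of the power series at [b]; it exists because
    an analytic function that vanishes near one point is zero. *)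
Lemma anfun_factor (p : anfun) (b : R) : (p != 0)%R ->
  exists (k : nat) (q : R -> R), [/\ smooth_at q b, q b <> 0 &
    locally b (fun t => p t = (t - b) ^ k * q t)].
Proof.
move=> p0; have [a [r [r0 Ha]]] := anfunP p b.
have [k ak kmin] : exists2 k, a k <> 0 & forall j, (j < k)%coq_nat -> a j = 0.
  have [k0 ak0] : exists k, a k <> 0.
    apply: contrapT => aN; case: (analytic_dichotomy b (anfunP p)) => [H|].
      by case/eqP: p0; apply: anfun_eq => x; exact: (analytic_vanishes (anfunP p) H).
    move=> H; have : locally' b (fun u => p u <> 0 /\ Rabs (u - b) < r).
      apply: filter_and => //; exists (mkposreal _ r0) => y yb _; exact: yb.
    move=> /locally'_point [y [py yr]]; apply: py.
    rewrite -(is_pseries_unique _ _ _ (Ha y yr)).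
    rewrite (PSeries_ext _ (fun=> 0)) ?PSeries_const_0 // => n.
    by apply: contrapT => an; apply: aN; exists n.
  have ex : exists k, `[< a k <> 0 >] by exists k0; apply/asboolP.
  exists (ex_minn ex); first by case: ex_minnP => k /asboolP.
  case: ex_minnP => k _ kmin j jk; apply: contrapT => aj.
  have : leq k j by apply: kmin; apply/asboolP.
  by move=> /leP; lia.
exists k, (fun t => PSeries (PS_decr_n a k) (t - b)).
have rad h : Rabs h < r -> Rbar_lt (Rabs h) (CV_radius (PS_decr_n a k)).
  by rewrite CV_radius_decr_n; apply: pseries_radius (shift_pseries Ha) _.
split.
- apply: (@smooth_at_translate (PSeries (PS_decr_n a k))).
  by apply: smooth_at_PSeries; apply: rad; rewrite Rminus_diag_eq // Rabs_R0.
- by rewrite Rminus_diag_eq // PSeries_0 /PS_decr_n PeanoNat.Nat.add_0_r.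
- apply/locally_Rabs; exists r; split=> // t tr.
  by rewrite -(is_pseries_unique _ _ _ (Ha t tr)) (PSeries_decr_n_aux _ _ _ kmin).
Qed.

(* [s = 1] selects the half-line [t > b], and [s = -1] the half-line [t < b]. *)
Definition on_side (s b : R) (f : R -> R) (t : R) : R :=
  if Rlt_dec 0 (s * (t - b)) then f t else 0.

(** The vanishing side is opposite to the one selected by [s] and contains [b], so that all
    derivatives vanish at [b]. *)
Definition side_flat (s b e : R) (z : R -> R) : Prop :=
  forall u, Rabs (u - b) < e ->
    smooth_at z u /\ (s * (u - b) <= 0 -> z u = 0).

Lemma locally_side_pos (s b t : R) : 0 < s * (t - b) ->
  locally t (fun u => 0 < s * (u - b)).
Proof.
move=> H; have : continuous (fun u => s * (u - b)) t.
  by apply: ex_derive_continuous; auto_derive.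
by move=> ct; exact: (ct (fun v => 0 < v) (open_gt 0 _ H)).
Qed.

Lemma locally_side_neg (s b t : R) : s * (t - b) < 0 ->
  locally t (fun u => s * (u - b) < 0).
Proof.
move=> H; have : continuous (fun u => s * (u - b)) t.
  by apply: ex_derive_continuous; auto_derive.
by move=> ct; exact: (ct (fun v => v < 0) (open_lt 0 _ H)).
Qed.

Lemma locally_Rabs_lt (b e u : R) : Rabs (u - b) < e ->
  locally u (fun v => Rabs (v - b) < e).
Proof.
move=> ue; apply/locally_Rabs; exists (e - Rabs (u - b)); split; first lra.
move=> y yu; have -> : y - b = (y - u) + (u - b) by ring.
by apply: Rle_lt_trans (Rabs_triang _ _) _; lra.
Qed.

Lemma side_flat_Derive (s b e : R) (z : R -> R) : s <> 0 ->
  side_flat s b e z -> side_flat s b e (Derive z).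
Proof.
move=> s0 Hz u ue; have [sz zu] := Hz u ue; split; first exact: smooth_at_Derive.
case=> [su|su].
  rewrite (Derive_ext_loc z (fun=> 0)) ?Derive_const //.
  apply: filter_imp (filter_and _ _ (locally_side_neg su) (locally_Rabs_lt ue)).
  by move=> v [vs ve]; apply: (Hz v ve).2; lra.
have ub : u = b by nra.
have e0 : 0 < e by rewrite ub Rminus_diag_eq // Rabs_R0 in ue.
(* At [b] the two-sided derivative exists, so it can be computed along the side on which [z] is
   0. *)
pose D v := s * (v - b) <= 0 /\ Rabs (v - b) < e.
apply: (@is_derive_within_unique D z u).
- move=> d d0; pose h := Rmin (d / 2) (e / 2).
  have h0 : 0 < h by apply: Rmin_pos; lra.
  have [hd he] : h <= d / 2 /\ h <= e / 2 by split; [exact: Rmin_l|exact: Rmin_r].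
  have [sp|sn] : 0 < s \/ s < 0 by lra.
    exists (b - h); rewrite ub /D; have -> : b - h - b = - h by ring.
    by rewrite Rabs_Ropp Rabs_right; [do !split; nra|lra].
  exists (b + h); rewrite ub /D; have -> : b + h - b = h by ring.
  by rewrite Rabs_right; [do !split; nra|lra].
- by apply: is_derive_within_is_derive; exact: (@smooth_at_is_derive z u 0).
- apply: (@is_derive_within_ext _ (fun=> 0)).
  + by split; [lra|].
  + by move=> y [ys ye]; rewrite (Hz y ye).2.
  + by apply: is_derive_within_is_derive; exact: is_derive_const.
Qed.

(** Induction on [M]: the derivative is flat in the same sense, hence bounded by C |u - b|^M, and
    the mean value theorem adds one factor |u - b|. *)
Lemma side_flat_bound (s b e : R) (M : nat) (z : R -> R) : s <> 0 -> 0 < e ->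
  side_flat s b e z -> exists C, 0 <= C /\
    locally b (fun u => Rabs (z u) <= C * Rabs (u - b) ^ M).
Proof.
move=> s0 e0; elim: M z => [|M IHM] z Hz.
  have be : Rabs (b - b) < e by rewrite Rminus_diag_eq // Rabs_R0.
  have [sz zb] := Hz b be; exists 1; split; first lra.
  have ct := @smooth_at_continuous z b 0 sz.
  have := ct (fun v => Rabs (v - z b) < 1); rewrite /= => H.
  have {H} : locally b (fun u => Rabs (z u - z b) < 1).
    by apply: H; apply/locally_Rabs; exists 1; split; [lra|].
  apply: filter_imp => u; rewrite zb ?Rminus_0_r; last by rewrite Rminus_diag_eq //; lra.
  lra.
have [C [C0 /locally_Rabs [d [d0 Hd]]]] := IHM _ (side_flat_Derive s0 Hz).
exists C; split=> //; apply/locally_Rabs; exists (Rmin d e); split.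
  exact: Rmin_pos.
move=> u um; have := Rmin_l d e; have := Rmin_r d e => m2 m1.
have inb c : Rmin b u <= c <= Rmax b u -> Rabs (c - b) <= Rabs (u - b).
  rewrite /Rmin /Rmax; case: Rle_dec => bu cb.
    by rewrite !Rabs_right; lra.
  by rewrite !Rabs_left1; lra.
have sm c : Rmin b u <= c <= Rmax b u -> smooth_at z c.
  by move=> /inb cb; apply: (Hz c _).1; lra.
have [||c [cb zE]] := @MVT_gen z b u (Derive z).
- move=> c cb; apply: (@smooth_at_is_derive z c 0); apply: sm; lra.
- move=> c cb; apply/continuity_pt_filterlim.
  by apply: (@smooth_at_continuous z c 0); exact: sm.
have zb : z b = 0.
  by apply: (Hz b _).2; rewrite Rminus_diag_eq ?Rabs_R0 //; lra.
rewrite zb Rminus_0_r in zE; rewrite zE Rabs_mult /=.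
have cu := inb c cb; have := Hd c (ltac:(lra)).
have := pow_incr (Rabs (c - b)) (Rabs (u - b)) M (conj (Rabs_pos _) cu).
have := Rabs_pos (u - b) => ? h1 h2.
have : Rabs (Derive z c) <= C * Rabs (u - b) ^ M by nra.
by nra.
Qed.

(** As for [flat_exp], the whole family of quotients z / (u - b)^M with flat [z] is treated at once,
    since differentiation leads to linear combinations of its members. *)
Lemma smooth_at_side_flat_div (s b e : R) (N : nat) (z : R -> R) (t : R) :
  s <> 0 -> side_flat s b e z -> Rabs (t - b) < e ->
  smooth_at (on_side s b (fun u => z u * (/ (u - b)) ^ N)) t.
Proof.
move=> s0 Hz te; have e0 : 0 < e by have := Rabs_pos (t - b); lra.
pose W M y := on_side s b (fun u => y u * (/ (u - b)) ^ M).
pose D u := Rabs (u - b) < e.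
pose P f := exists M y, side_flat s b e y /\ f = W M y.
apply: (@smooth_alg_at D P) => //; last by apply: smooth_alg_gen; exists N, z.
  by move=> u; exact: locally_Rabs_lt.
move=> _ [M [y [Hy ->]]]; exists (fun u => W M (Derive y) u + - INR M * W M.+1 y u).
have Hy' := side_flat_Derive s0 Hy; split.
  apply: smooth_alg_plus; first by apply: smooth_alg_gen; exists M, (Derive y).
  apply: smooth_alg_mult; last by apply: smooth_alg_gen; exists M.+1, y.
  by apply: smooth_alg_base => u _; exact: smooth_at_const.
move=> u Du; rewrite {2 3}/W /on_side; case: Rlt_dec => su.
  have ub : u - b <> 0 by move=> ub; rewrite ub in su; lra.
  apply: (is_derive_ext_loc (fun u => y u * (/ (u - b)) ^ M)).
    apply: filter_imp (locally_side_pos su) => v vs.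
    by rewrite /W /on_side; case: Rlt_dec.
  have := @smooth_at_is_derive y u 0 (Hy u Du).1; rewrite /= => dy.
  have -> : Derive y u * (/ (u - b)) ^ M + - INR M * (y u * (/ (u - b)) ^ M.+1) =
    Derive y u * (/ (u - b)) ^ M + y u * (- INR M * (/ (u - b)) ^ M.+1) by ring.
  apply: (@is_derive_mult _ y (fun u => (/ (u - b)) ^ M)) => //; last first.
    by move=> ? ?; exact: Rmult_comm.
  auto_derive; first by move: ub; rewrite /Rminus.
  case: M => [|M]; first by rewrite /=; field.
  move: (INR M.+1) => c; rewrite -[predn _]/M -[u + - b]/(u - b).
  by move: (u - b) ub => v v0; rewrite !pow_inv /=; field; split=> //; exact: pow_nonzero.
have [u1|u1] : s * (u - b) < 0 \/ s * (u - b) = 0 by lra.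
  rewrite /= Rmult_0_r Rplus_0_r; apply: (is_derive_ext_loc (fun=> 0)).
    apply: filter_imp (locally_side_neg u1) => v v0.
    by rewrite /W /on_side; case: Rlt_dec => [?|//]; lra.
  exact: is_derive_const.
have ub : u = b by nra.
rewrite /= Rmult_0_r Rplus_0_r ub.
(* Two orders more than the [M] lost in the division leave a quadratic bound. *)
have [C [C0 HC]] := side_flat_bound M.+2 s0 e0 Hy.
apply: (@is_derive_quadratic _ _ _ C); apply: filter_imp HC => v.
have -> : W M y b = 0.
  rewrite /W /on_side; case: Rlt_dec => [H|//].
  by exfalso; move: H; rewrite Rminus_diag_eq //; lra.
rewrite Rmult_0_l !Rminus_0_r /W /on_side; case: Rlt_dec => sv H; last first.
  by rewrite Rabs_R0; apply: Rmult_le_pos => //; exact: pow2_ge_0.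
have v0 : 0 < Rabs (v - b).
  by apply: Rabs_pos_lt => vb; rewrite vb in sv; lra.
rewrite Rabs_mult -RPow_abs Rabs_inv.
have -> : (v - b) ^ 2 = Rabs (v - b) ^ 2 by rewrite pow2_abs.
have p0 : 0 < Rabs (v - b) ^ M by exact: pow_lt.
rewrite pow_inv; apply: (Rmult_le_reg_r (Rabs (v - b) ^ M)) => //.
rewrite Rmult_assoc Rinv_l ?Rmult_1_r; last lra.
have -> : C * Rabs (v - b) ^ 2 * Rabs (v - b) ^ M = C * Rabs (v - b) ^ M.+2.
  by rewrite /=; ring.
by [].
Qed.

(** Write p = (u - b)^k q with q(b) <> 0. Then z / q is still flat, and only a power of u - b
    remains to be divided out. *)
Lemma smooth_at_side_div (s b e : R) (z : R -> R) (p : anfun) :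
  s <> 0 -> 0 < e -> (p != 0)%R -> side_flat s b e z ->
  smooth_at (on_side s b (fun u => z u / p u)) b.
Proof.
move=> s0 e0 p0 Hz; have [k [q [sq qb pE]]] := anfun_factor b p0.
have ct := @smooth_at_continuous q b 0 sq.
have /locally_Rabs [d [d0 Hd]] : locally b (fun t =>
    (smooth_at q t /\ q t <> 0) /\ p t = (t - b) ^ k * q t).
  apply: filter_and => //; apply: filter_and; first exact: smooth_at_locally.
  exact: continuous_neq0.
have Hy : side_flat s b (Rmin d e) (fun u => z u * / q u).
  move=> u um; have := Rmin_l d e; have := Rmin_r d e => m2 m1.
  have [[squ qu] _] := Hd u (ltac:(lra)); have [sz zu] := Hz u (ltac:(lra)).
  split; first by apply: smooth_at_mult => //; exact: smooth_at_inv.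
  by move=> /zu ->; rewrite Rmult_0_l.
have m0 : 0 < Rmin d e by exact: Rmin_pos.
apply: smooth_at_ext_loc (smooth_at_side_flat_div k s0 Hy (_ : Rabs (b - b) < _)); last first.
  by rewrite Rminus_diag_eq // Rabs_R0.
apply/locally_Rabs; exists d; split=> // u ud.
have [[_ qu] pu] := Hd u ud; rewrite /on_side; case: Rlt_dec => // su.
have ub : u - b <> 0 by move=> ub; rewrite ub in su; lra.
by rewrite /= pu pow_inv; field; split=> //; exact: pow_nonzero.
Qed.

(** * Differential operators off their poles *)

(** The exceptional points are among the zeros of one non-zero analytic function, so there are
    finitely many in each compact interval, and conjunction corresponds to the product. In
    [generically (fun t => forall w, ...)] they do not depend on [w]. *)
Definition generically (Q : R -> Prop) : Prop :=
  exists q : anfun, (q != 0)%R /\ forall t, q t <> 0 -> Q t.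

Lemma generically_true (Q : R -> Prop) : (forall t, Q t) -> generically Q.
Proof. by move=> H; exists 1%R; split; [exact: oner_neq0|]. Qed.

Lemma generically_imp (P Q : R -> Prop) :
  (forall t, P t -> Q t) -> generically P -> generically Q.
Proof. by move=> PQ [q [q0 H]]; exists q; split=> // t /H /PQ. Qed.

Lemma generically_and (P Q : R -> Prop) :
  generically P -> generically Q -> generically (fun t => P t /\ Q t).
Proof.
move=> [p [p0 Hp]] [q [q0 Hq]]; exists (p * q)%R; split; first by rewrite mulf_neq0.
move=> t pq; split; [apply: Hp|apply: Hq] => z; apply: pq;
  by rewrite -[LHS]/(p t * q t) z; ring.
Qed.

Lemma generically_all_seq (I : eqType) (s : seq I) (Q : I -> R -> Prop) :
  (forall i, generically (Q i)) ->
  generically (fun t => forall i, i \in s -> Q i t).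
Proof.
move=> HQ; elim: s => [|i s IHs]; first exact: generically_true.
apply: generically_imp (generically_and (HQ i) IHs) => t [Qi Qs] j.
by rewrite inE => /orP[/eqP->|/Qs].
Qed.

Lemma generically_all (I : finType) (Q : I -> R -> Prop) :
  (forall i, generically (Q i)) -> generically (fun t => forall i, Q i t).
Proof.
move=> /(generically_all_seq (enum I)); apply: generically_imp => t H i.
by apply: H; rewrite mem_enum.
Qed.

(** The zero set is closed. An identity between functions that holds generically can therefore be
    differentiated. *)
Lemma generically_locally (Q : R -> Prop) :
  generically Q -> generically (fun t => locally t Q).
Proof.
move=> [q [q0 H]]; exists q; split=> // t qt.
have ct := @smooth_at_continuous q t 0 (smooth_at_anfun q t).
by apply: filter_imp (continuous_neq0 ct qt) => u; exact: H.
Qed.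

Lemma generically_near (Q : R -> Prop) (b : R) :
  generically Q -> locally' b Q.
Proof.
by move=> [q [q0 H]]; apply: filter_imp (anfun_neq0_near b q0) => u; exact: H.
Qed.

Lemma anfun_gen (p : anfun) : (p != 0)%R -> generically (fun t => p t <> 0).
Proof. by move=> p0; exists p. Qed.

(** [mero_eval] uses a fraction chosen in the class [f]; off the zeros of both denominators every
    other fraction has the same value. *)
Lemma mero_evalE (f : mero) (n d : anfun) : (d != 0)%R ->
  (f = mero_of n / mero_of d)%R ->
  generically (fun t => d t <> 0 /\ mero_eval f t = n t / d t).
Proof.
move=> d0 fE; have f0 := mero_den_neq0 f.
apply: generically_imp (generically_and (anfun_gen d0) (anfun_gen f0)) => t [dt ft].
split=> //; have e : (mero_num f * d = n * mero_den f)%R.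
  apply/eqP; rewrite -subr_eq0 -mero_of_eq0 rmorphB !rmorphM subr_eq0 /=.
  rewrite -eqr_div ?mero_of_eq0 // -fE -mero_numden //.
have {}e : (mero_num f t * d t = n t * mero_den f t).
  exact: (congr1 (fun h : anfun => h t) e).
rewrite -[LHS]/(mero_num f t / mero_den f t).
apply: (Rmult_eq_reg_r (mero_den f t * d t)); last by apply: Rmult_integral_contrapositive.
transitivity (mero_num f t * d t); first by field.
by rewrite e; field.
Qed.

Lemma locally_all (I : finType) (P : I -> R -> Prop) (t : R) :
  (forall i, locally t (P i)) -> locally t (fun u => forall i, P i u).
Proof.
move=> HP; suff : locally t (fun u => forall i, i \in enum I -> P i u).
  by apply: filter_imp => u H i; apply: H; rewrite mem_enum.
elim: (enum I) => [|i s IHs]; first exact: filter_forall.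
apply: filter_imp (filter_and _ _ (HP i) IHs) => u [Pi Ps] j.
by rewrite inE => /orP[/eqP->|/Ps].
Qed.

(** Valid at every [t] because the chosen numerator of 0 is 0. Sums over coefficients can thus be
    padded without creating exceptional points. *)
Lemma mero_eval0 (t : R) : mero_eval 0%R t = 0.
Proof.
have : mero_num 0%R = 0%R.
  have := mero_numden 0%R; move/esym/eqP; rewrite mulf_eq0 invr_eq0.
  by rewrite !mero_of_eq0 (negbTE (mero_den_neq0 0%R)) orbF => /eqP.
by rewrite /mero_eval => ->; exact: mul0r.
Qed.

Lemma mero_eval1 : generically (fun t => mero_eval 1%R t = 1).
Proof.
have E : (1 = mero_of 1 / mero_of 1 :> mero)%R by rewrite rmorph1 divr1.
apply: generically_imp (mero_evalE (oner_neq0 _) E) => t [_ ->] /=.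
by field.
Qed.

Lemma mero_evalD (f g : mero) :
  generically (fun t => mero_eval (f + g)%R t = mero_eval f t + mero_eval g t).
Proof.
have f0 := mero_den_neq0 f; have g0 := mero_den_neq0 g.
have E : (f + g = mero_of (mero_num f * mero_den g + mero_num g * mero_den f)
    / mero_of (mero_den f * mero_den g))%R.
  rewrite {1}(mero_numden f) {1}(mero_numden g) addf_div ?mero_of_eq0 //.
  by rewrite rmorphD !rmorphM.
have := generically_and (mero_evalE (mulf_neq0 f0 g0) E)
  (generically_and (anfun_gen f0) (anfun_gen g0)).
apply: generically_imp => t [[_ ->] [ft gt]].
rewrite -[mero_eval f t]/(mero_num f t / mero_den f t).
rewrite -[mero_eval g t]/(mero_num g t / mero_den g t) /=.
by field.
Qed.

Lemma mero_evalM (f g : mero) :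
  generically (fun t => mero_eval (f * g)%R t = mero_eval f t * mero_eval g t).
Proof.
have f0 := mero_den_neq0 f; have g0 := mero_den_neq0 g.
have E : (f * g = mero_of (mero_num f * mero_num g)
    / mero_of (mero_den f * mero_den g))%R.
  by rewrite {1}(mero_numden f) {1}(mero_numden g) mulf_div !rmorphM.
have := generically_and (mero_evalE (mulf_neq0 f0 g0) E)
  (generically_and (anfun_gen f0) (anfun_gen g0)).
apply: generically_imp => t [[_ ->] [ft gt]].
rewrite -[mero_eval f t]/(mero_num f t / mero_den f t).
rewrite -[mero_eval g t]/(mero_num g t / mero_den g t) /=.
by field.
Qed.

Lemma mero_eval_smooth (f : mero) : generically (smooth_at (mero_eval f)).
Proof.
apply: generically_imp (anfun_gen (mero_den_neq0 f)) => t ft.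
apply: (@smooth_at_mult (mero_num f) (fun t => / mero_den f t)).
  exact: smooth_at_anfun.
by apply: smooth_at_inv => //; exact: smooth_at_anfun.
Qed.

Lemma mero_eval_derive (f : mero) : generically (fun t =>
  is_derive (mero_eval f) t (mero_eval (mero_derive f) t)).
Proof.
have f0 := mero_den_neq0 f.
have := generically_and (mero_evalE (expf_neq0 2 f0) (erefl (mero_derive f)))
  (anfun_gen f0).
apply: generically_imp => t [[_ ->] ft].
have D (p : anfun) : is_derive p t (anfun_derive p t).
  exact: (@smooth_at_is_derive p t 0 (smooth_at_anfun p t)).
have := is_derive_div _ _ _ _ _ (D (mero_num f)) (D (mero_den f)) ft.
set l := (X in is_derive _ _ X -> _); have -> // : (mero_den f ^+ 2)%R t =
  mero_den f t ^ 2 by rewrite -[LHS]/(mero_den f t * mero_den f t); ring.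
Qed.

(** An arbitrary sequence takes the place of the derivatives, so that the operator can also be fed
    with one-sided derivatives at the end of an interval. *)
Definition jet_op (a : skewpoly) (u : nat -> R) (t : R) : R :=
  (\sum_(k < size (skew_poly a)) mero_eval (skew_poly a)`_k t * u k)%R.

Lemma jet_op_wide (n : nat) (a : skewpoly) (u : nat -> R) (t : R) :
  (size (skew_poly a) <= n)%N ->
  jet_op a u t = (\sum_(k < n) mero_eval (skew_poly a)`_k t * u k)%R.
Proof.
move=> an; rewrite /jet_op.
rewrite (big_ord_widen n (fun k => mero_eval (skew_poly a)`_k t * u k)%R) //.
rewrite big_mkcond; apply: eq_bigr => i _.
by case: ltnP => // ai; rewrite nth_default // mero_eval0 mul0r.
Qed.

Lemma jet_opD (a b : skewpoly) : generically (fun t => forall u,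
  jet_op (a + b)%R u t = (jet_op a u t + jet_op b u t)%R).
Proof.
pose n := maxn (size (skew_poly a)) (size (skew_poly b)).
have H (k : 'I_n) := (mero_evalD (skew_poly a)`_k (skew_poly b)`_k)%R.
apply: generically_imp (generically_all H) => t {}H u.
rewrite !(@jet_op_wide n) ?leq_maxl ?leq_maxr //; last exact: size_polyD.
rewrite -[RHS]big_split /=; apply: eq_bigr => k _.
by rewrite /skew_poly coefD H [LHS]mulrDl.
Qed.

Lemma jet_opZ (c : mero) (a : skewpoly) : generically (fun t => forall u,
  jet_op (c *: skew_poly a)%R u t = (mero_eval c t * jet_op a u t)%R).
Proof.
pose n := size (skew_poly a).
have H (k : 'I_n) := (mero_evalM c (skew_poly a)`_k)%R.
apply: generically_imp (generically_all H) => t {}H u.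
rewrite !(@jet_op_wide n) ?size_scale_leq // [RHS]mulr_sumr.
by apply: eq_bigr => k _; rewrite /skew_poly coefZ H [RHS]mulrA.
Qed.

Lemma jet_op0 (u : nat -> R) (t : R) : jet_op 0%R u t = 0.
Proof. by rewrite /jet_op /skew_poly size_poly0 big_ord0. Qed.

Lemma jet_op_sum (I : eqType) (s : seq I) (F : I -> skewpoly) :
  generically (fun t => forall u,
    jet_op (\sum_(i <- s) F i)%R u t = (\sum_(i <- s) jet_op (F i) u t)%R).
Proof.
elim: s => [|i s IHs].
  by apply: generically_true => t u; rewrite !big_nil jet_op0.
have := generically_and IHs (jet_opD (F i) (\sum_(i <- s) F i)%R).
by apply: generically_imp => t [IH H] u; rewrite !big_cons H IH.
Qed.

Lemma jet_op1 : generically (fun t => forall u, jet_op 1%R u t = u 0%N).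
Proof.
apply: generically_imp mero_eval1 => t H u.
rewrite /jet_op /skew_poly size_poly1 big_ord1 coef1 H; exact: mul1r.
Qed.

Lemma Derive_sum (n : nat) (F : 'I_n -> R -> R) (t : R) :
  (forall i, ex_derive (F i) t) ->
  is_derive (fun t => (\sum_(i < n) F i t)%R) t (\sum_(i < n) Derive (F i) t)%R.
Proof.
move=> H; elim: n F H => [|n IHn] F H.
  apply: (is_derive_ext (fun=> 0)); first by move=> u; rewrite big_ord0.
  by rewrite big_ord0; exact: is_derive_const.
apply: (is_derive_ext (fun t =>
    (\sum_(i < n) F (widen_ord (leqnSn n) i) t)%R + F ord_max t)).
  by move=> u; rewrite big_ord_recr.
rewrite big_ord_recr /=; apply: @is_derive_plus; last exact: Derive_correct.
exact: IHn.
Qed.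

Lemma smooth_at_sum (n : nat) (F : 'I_n -> R -> R) (t : R) :
  (forall i, smooth_at (F i) t) -> smooth_at (fun t => (\sum_(i < n) F i t)%R) t.
Proof.
move=> H; elim: n F H => [|n IHn] F H.
  apply: smooth_at_ext_loc (smooth_at_const 0 t).
  by apply: filter_forall => u; rewrite big_ord0.
apply: smooth_at_ext_loc (smooth_at_plus
  (IHn (fun i => F (widen_ord (leqnSn n) i)) (fun i => H _)) (H ord_max)).
by apply: filter_forall => u; rewrite big_ord_recr.
Qed.

Lemma Derive_n_sum (n : nat) (F : 'I_n -> R -> R) (k : nat) (t : R) :
  (forall i, smooth_at (F i) t) ->
  Derive_n (fun t => (\sum_(i < n) F i t)%R) k t = (\sum_(i < n) Derive_n (F i) k t)%R.
Proof.
elim: k t => // k IHk t H /=.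
have H' : forall i, locally t (smooth_at (F i)) by move=> i; exact: smooth_at_locally.
have {H'} L : locally t (fun u => forall i, smooth_at (F i) u).
  exact: locally_all.
rewrite (Derive_ext_loc _ (fun t => (\sum_(i < n) Derive_n (F i) k t)%R)); last first.
  by apply: filter_imp L => u; exact: IHk.
apply: is_derive_unique; apply: Derive_sum => i.
exact: smooth_at_ex_derive.
Qed.

Definition op (a : skewpoly) (w : R -> R) (t : R) : R :=
  jet_op a (fun k => Derive_n w k t) t.

Lemma diff_opE (m n : nat) (A : 'M[skewpoly]_(m, n)) (w : 'I_n -> R -> R)
    (i : 'I_m) (t : R) :
  diff_op A w i t = (\sum_(j < n) op (A i j) (w j) t)%R.
Proof. by []. Qed.

Lemma op_ext_loc (a : skewpoly) (v w : R -> R) (t : R) :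
  locally t (fun u => v u = w u) -> op a v t = op a w t.
Proof.
by move=> vw; apply: eq_bigr => k _; congr (_ * _)%R; exact: Derive_n_ext_loc.
Qed.

Lemma diff_op_ext_loc (m n : nat) (A : 'M[skewpoly]_(m, n))
    (v w : 'I_n -> R -> R) (i : 'I_m) (t : R) :
  (forall j, locally t (fun u => v j u = w j u)) ->
  diff_op A v i t = diff_op A w i t.
Proof. by move=> vw; rewrite !diff_opE; apply: eq_bigr => j _; exact: op_ext_loc. Qed.

Lemma op_sum (n : nat) (a : skewpoly) (F : 'I_n -> R -> R) (t : R) :
  (forall i, smooth_at (F i) t) ->
  op a (fun t => (\sum_(i < n) F i t)%R) t = (\sum_(i < n) op a (F i) t)%R.
Proof.
move=> sF; rewrite /op /jet_op exchange_big /=; apply: eq_bigr => k _.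
by rewrite Derive_n_sum // mulr_sumr.
Qed.

Lemma op_smooth (a : skewpoly) :
  generically (fun t => forall w, smooth_at w t -> smooth_at (op a w) t).
Proof.
have H (k : 'I_(size (skew_poly a))) := mero_eval_smooth ((skew_poly a)`_k)%R.
apply: generically_imp (generically_all H) => t {}H w sw.
apply: smooth_at_sum => k; apply: smooth_at_mult; first exact: H.
exact: smooth_at_Derive_n.
Qed.

(** Leibniz' rule for each term, (b_k w^(k))' = b_k w^(k+1) + b_k' w^(k), is what [skew_mulD] does
    to the coefficients. *)
Lemma is_derive_op (b : skewpoly) : generically (fun t => forall w,
  smooth_at w t -> is_derive (op b w) t (op (skew_mulD b : skewpoly) w t)).
Proof.
pose n := size (skew_poly b).
have H (k : 'I_n) := mero_eval_derive ((skew_poly b)`_k)%R.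
have := jet_opD (skew_poly b * 'X : {poly mero})%R (map_poly mero_derive b).
move=> /(generically_and (generically_all H)).
apply: generically_imp => t [{}H Hadd] w sw.
have D k : is_derive (Derive_n w k) t (Derive_n w k.+1 t) by exact: smooth_at_is_derive.
have Dk (k : 'I_n) := is_derive_mult _ _ _ _ _ (H k) (D k) Rmult_comm.
have -> : op (skew_mulD b : skewpoly) w t =
  (\sum_(k < n) Derive (fun t => mero_eval (skew_poly b)`_k t * Derive_n w k t) t)%R.
  rewrite [op _ _ _]Hadd (@jet_op_wide n.+1); last first.
    by apply: leq_trans (size_polyMleq _ _) _; rewrite size_polyX addn2.
  rewrite (@jet_op_wide n (map_poly mero_derive b)); last exact: size_poly.
  rewrite big_ord_recl /skew_poly coefMX /= mero_eval0 mul0r add0r -big_split /=.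
  apply: eq_bigr => k _; rewrite (is_derive_unique _ _ _ (Dk k)).
  by rewrite coefMX /= coef_map_id0 ?mero_derive0 // [LHS]addrC.
by apply: Derive_sum => k; eexists; exact: Dk.
Qed.

Lemma op_iter_mulD (b : skewpoly) (i : nat) : generically (fun t => forall w,
  smooth_at w t ->
  op (iter i skew_mulD b : skewpoly) w t = Derive_n (op b w) i t).
Proof.
elim: i => [|i IHi]; first exact: generically_true.
have := generically_and (generically_locally IHi)
  (is_derive_op (iter i skew_mulD b : skewpoly)).
apply: generically_imp => t [IH H] w sw.
rewrite -(is_derive_unique _ _ _ (H w sw)) /=; apply: Derive_ext_loc.
apply: filter_imp (filter_and _ _ IH (smooth_at_locally sw)) => u [{}IH su].
exact: IH.
Qed.

Lemma jet_op_mul (a b : skewpoly) : generically (fun t => forall u,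
  jet_op (a * b)%R u t = (\sum_(k < size (skew_poly a))
    mero_eval (skew_poly a)`_k t * jet_op (iter k skew_mulD b : skewpoly) u t)%R).
Proof.
pose n := size (skew_poly a).
have H1 (i : 'I_n) := jet_opZ ((skew_poly a)`_i)%R (iter i skew_mulD b : skewpoly).
have H2 := jet_op_sum (enum 'I_n)
  (fun i : 'I_n => (skew_poly a)`_i *: iter i skew_mulD b : skewpoly)%R.
have := generically_and (generically_all H1) H2.
apply: generically_imp => t [{}H1 {}H2] u.
rewrite -[(a * b)%R]/(skew_mul a b) /skew_mul -big_enum H2 big_enum /=.
by apply: eq_bigr => i _; rewrite H1.
Qed.

Lemma op_mul (a b : skewpoly) : generically (fun t => forall w,
  smooth_at w t -> op (a * b)%R w t = op a (op b w) t).
Proof.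
have H (i : 'I_(size (skew_poly a))) := op_iter_mulD b i.
have := generically_and (generically_all H) (jet_op_mul a b).
apply: generically_imp => t [{}H H'] w sw.
by rewrite [LHS]H'; apply: eq_bigr => i _; congr (_ * _)%R; exact: H.
Qed.

Lemma jet_op_mx_sum (m n p : nat) (A : 'M[skewpoly]_(m, n))
    (B : 'M[skewpoly]_(n, p)) : generically (fun t => forall i k u,
  jet_op ((A *m B)%R i k) u t = (\sum_j jet_op (A i j * B j k)%R u t)%R).
Proof.
have H (i : 'I_m) := generically_all (fun k : 'I_p =>
  jet_op_sum (enum 'I_n) (fun j => A i j * B j k)%R).
apply: generically_imp (generically_all H) => t {}H i k u.
by rewrite mxE -big_enum H big_enum.
Qed.

Lemma diff_op_mul (m n p : nat) (A : 'M[skewpoly]_(m, n))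
    (B : 'M[skewpoly]_(n, p)) : generically (fun t => forall w,
  (forall k, smooth_at (w k) t) -> forall i,
  diff_op (A *m B)%R w i t = diff_op A (diff_op B w) i t).
Proof.
have H1 (i : 'I_m) := generically_all (fun k : 'I_p =>
  generically_all (fun j : 'I_n => op_mul (A i j) (B j k))).
have H2 (j : 'I_n) := generically_all (fun k : 'I_p => op_smooth (B j k)).
have := generically_and (generically_all H1)
  (generically_and (generically_all H2) (jet_op_mx_sum A B)).
apply: generically_imp => t [{}H1 [{}H2 H3]] w sw i.
rewrite !diff_opE.
have -> : (\sum_(j < n) op (A i j) (diff_op B w j) t)%R =
    (\sum_(j < n) \sum_(k < p) op (A i j) (op (B j k) (w k)) t)%R.
  by apply: eq_bigr => j _; rewrite [LHS]op_sum // => k; exact: H2.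
rewrite exchange_big /=; apply: eq_bigr => k _.
by rewrite [LHS]H3; apply: eq_bigr => j _; exact: H1.
Qed.

Lemma diff_op_smooth (m n : nat) (A : 'M[skewpoly]_(m, n)) :
  generically (fun t => forall w, (forall k, smooth_at (w k) t) ->
    forall i, smooth_at (diff_op A w i) t).
Proof.
have H (i : 'I_m) := generically_all (fun k : 'I_n => op_smooth (A i k)).
apply: generically_imp (generically_all H) => t {}H w sw i.
by apply: smooth_at_sum => k; exact: H.
Qed.

Lemma diff_op1 (n : nat) : generically (fun t =>
  forall (w : 'I_n -> R -> R) i, diff_op 1%:M%R w i t = w i t).
Proof.
apply: generically_imp jet_op1 => t H w i.
rewrite diff_opE (bigD1 i) //= big1 => [|j ji].
  by rewrite addr0 mxE eqxx [LHS]H.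
by rewrite mxE eq_sym (negbTE ji); exact: jet_op0.
Qed.

Lemma diff_op_minus (m n : nat) (A : 'M[skewpoly]_(m, n))
    (v w : 'I_n -> R -> R) (i : 'I_m) (t : R) :
  (forall j, smooth_at (v j) t) -> (forall j, smooth_at (w j) t) ->
  diff_op A (fun j u => v j u - w j u) i t = diff_op A v i t - diff_op A w i t.
Proof.
move=> sv sw; rewrite !diff_opE.
rewrite RminusE -sumrB; apply: eq_bigr => j _.
rewrite /op /jet_op -sumrB; apply: eq_bigr => k _; rewrite -mulrBr; congr (_ * _)%R.
apply: Derive_n_minus.
  apply: filter_imp (sv j) => u Hu [|l] _ //; exact: Hu.
apply: filter_imp (sw j) => u Hu [|l] _ //; exact: Hu.
Qed.

(** A class stable under differentiation and under multiplication by meromorphic functions. It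
    controls B (A F) around a point that may be a pole; the value of [v] at [b] itself does not
    matter. *)
Definition merolike (b : R) (v : R -> R) : Prop :=
  exists (s : R -> R) (p : anfun), [/\ (p != 0)%R, forall t, smooth_at s t &
    locally' b (fun t => p t <> 0 /\ v t = s t / p t)].

Lemma merolike_smooth (b : R) (v : R -> R) : (forall t, smooth_at v t) -> merolike b v.
Proof.
move=> sv; exists v, 1%R; split=> //; first exact: oner_neq0.
by apply: filter_forall => t /=; split; [lra|field].
Qed.

Lemma merolike_plus (b : R) (v w : R -> R) :
  merolike b v -> merolike b w -> merolike b (fun t => v t + w t).
Proof.
move=> [s [p [p0 ss vE]]] [s' [p' [p'0 ss' wE]]].
exists (fun t => s t * p' t + s' t * p t), (p * p')%R; split.
- by rewrite mulf_neq0.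
- by move=> t; apply: smooth_at_plus; apply: smooth_at_mult => //; exact: smooth_at_anfun.
- apply: filter_imp (filter_and _ _ vE wE) => t [[pt ->] [pt' ->]] /=; split.
    exact: Rmult_integral_contrapositive.
  by field.
Qed.

Lemma merolike_mult (b : R) (f : mero) (v : R -> R) :
  merolike b v -> merolike b (fun t => mero_eval f t * v t).
Proof.
move=> [s [p [p0 ss vE]]]; have f0 := mero_den_neq0 f.
exists (fun t => mero_num f t * s t), (mero_den f * p)%R; split.
- by rewrite mulf_neq0.
- by move=> t; apply: smooth_at_mult => //; exact: smooth_at_anfun.
- apply: filter_imp (filter_and _ _ vE (anfun_neq0_near b f0)) => t [[pt ->] ft] /=.
  split; first exact: Rmult_integral_contrapositive.
  by rewrite -[mero_eval f t]/(mero_num f t / mero_den f t); field.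
Qed.

Lemma locally'_locally (b : R) (P : R -> Prop) :
  locally' b P -> locally' b (fun t => locally t P).
Proof.
move=> /locally_Rabs [e [e0 He]]; exists (mkposreal _ e0) => t te tb.
apply: filter_imp (filter_and _ _ (locally_Rabs_lt te) (open_neq b t tb)).
by move=> u [ue ub]; exact: He.
Qed.

Lemma merolike_Derive (b : R) (v : R -> R) : merolike b v -> merolike b (Derive v).
Proof.
move=> [s [p [p0 ss vE]]].
exists (fun t => Derive s t * p t - s t * Derive p t), (p * p)%R; split.
- by rewrite mulf_neq0.
- move=> t; have sp := smooth_at_anfun p t.
  apply: smooth_at_minus; apply: smooth_at_mult => //; exact: smooth_at_Derive.
- apply: filter_imp (locally'_locally vE) => t Ht.
  have [pt _] := locally_singleton _ _ Ht.
  split; first exact: Rmult_integral_contrapositive.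
  rewrite (@Derive_ext_loc v (fun t => s t / p t)); last by apply: filter_imp Ht => u [].
  rewrite Derive_div //.
  + by rewrite -[(p * p)%R t]/(p t * p t); field.
  + exact: (@smooth_at_ex_derive s t 0).
  + exact: (@smooth_at_ex_derive p t 0 (smooth_at_anfun p t)).
Qed.

Lemma merolike_sum (b : R) (n : nat) (F : 'I_n -> R -> R) :
  (forall i, merolike b (F i)) -> merolike b (fun t => (\sum_(i < n) F i t)%R).
Proof.
elim: n F => [|n IHn] F H.
  have -> : (fun t => \sum_(i < 0) F i t)%R = (fun=> 0).
    by apply: funext => t; rewrite big_ord0.
  by apply: merolike_smooth => t; exact: smooth_at_const.
have -> : (fun t => \sum_(i < n.+1) F i t)%R = (fun t =>
    (\sum_(i < n) F (widen_ord (leqnSn n) i) t)%R + F ord_max t).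
  by apply: funext => t; rewrite big_ord_recr.
by apply: merolike_plus => //; apply: IHn.
Qed.

Lemma merolike_diff_op (m n : nat) (A : 'M[skewpoly]_(m, n)) (b : R)
    (w : 'I_n -> R -> R) (i : 'I_m) :
  (forall j, merolike b (w j)) -> merolike b (diff_op A w i).
Proof.
move=> Hw; apply: merolike_sum => j; apply: merolike_sum => k.
apply: merolike_mult; elim: (nat_of_ord k) => [|l IHl]; first exact: Hw.
exact: merolike_Derive.
Qed.

(** * Local structure of sections *)

Lemma op_plus (a : skewpoly) (v w : R -> R) (t : R) :
  smooth_at v t -> smooth_at w t ->
  op a (fun u => v u + w u) t = op a v t + op a w t.
Proof.
move=> sv sw; rewrite /op /jet_op RplusE -big_split; apply: eq_bigr => k _ /=.
rewrite -mulrDr; congr (_ * _)%R; apply: Derive_n_plus.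
  by apply: filter_imp sv => u Hu [|l] _ //; exact: Hu.
by apply: filter_imp sw => u Hu [|l] _ //; exact: Hu.
Qed.

Lemma diff_op_plus (m n : nat) (A : 'M[skewpoly]_(m, n))
    (v w : 'I_n -> R -> R) (i : 'I_m) (t : R) :
  (forall j, smooth_at (v j) t) -> (forall j, smooth_at (w j) t) ->
  diff_op A (fun j u => v j u + w j u) i t = diff_op A v i t + diff_op A w i t.
Proof.
move=> sv sw; rewrite !diff_opE RplusE -big_split.
by apply: eq_bigr => j _; exact: op_plus.
Qed.

Lemma op_zero (a : skewpoly) (t : R) : op a (fun=> 0) t = 0.
Proof.
rewrite /op /jet_op big1 // => k _; case: (nat_of_ord k) => [|l]; first exact: mulr0.
by rewrite Derive_n_const; exact: mulr0.
Qed.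

Lemma diff_op0 (m n : nat) (A : 'M[skewpoly]_(m, n)) (w : 'I_n -> R -> R)
    (i : 'I_m) (t : R) :
  (forall j, locally t (fun u => w j u = 0)) -> diff_op A w i t = 0.
Proof.
move=> w0; rewrite (diff_op_ext_loc _ _ w0) diff_opE big1 // => j _.
exact: op_zero.
Qed.

Lemma exceptions_all (I : finType) (Q : I -> R -> Prop) :
  (forall i, exists E : seq R, forall t, t \notin E -> Q i t) ->
  exists E : seq R, forall i t, t \notin E -> Q i t.
Proof.
move=> HQ.
suff [E HE] : exists E : seq R, forall i, i \in enum I -> forall t, t \notin E -> Q i t.
  by exists E => i t; apply: HE; rewrite mem_enum.
elim: (enum I) => [|i s [E HE]]; first by exists [::].
have [E' HE'] := HQ i; exists (E' ++ E) => j; rewrite inE => jis t.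
rewrite mem_cat negb_or => /andP[tE' tE].
by case/orP: jis => [/eqP->|js]; [exact: HE'|exact: HE].
Qed.

Lemma reg_ge_leq (L : regularity) (k l : nat) : (k <= l)%N ->
  reg_ge L l%:Z -> reg_ge L k%:Z.
Proof. by case: L => [|j|] //= kl; rewrite !lez_nat; exact: leq_trans. Qed.

Lemma C_repP (L : regularity) (a b : R) (f : R -> R) : in_C L a b f ->
  pw_eq a b f (C_rep L a b f) /\ C_on (segment a b) L (C_rep L a b f).
Proof.
by move=> Hf; exact: (@xgetPex _ f
  (fun g => pw_eq a b f g /\ C_on (segment a b) L g) Hf).
Qed.

Lemma segment_sub (a b x y : R) : a <= x -> y <= b ->
  forall t, segment x y t -> segment a b t.
Proof. by move=> ax yb t [xt ty]; split; lra. Qed.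

Lemma C_on_eq_smooth (L : regularity) (a b x y : R) (f G : R -> R) :
  a <= x -> x < y -> y <= b -> C_on (segment a b) L f -> reg_ge L 0 ->
  pw_eq x y f G -> (forall t, segment x y t -> smooth_at G t) ->
  forall t, segment x y t -> f t = G t.
Proof.
move=> ax xy yb [_ Hc] L0 fG sG; apply: pw_eq_continuous => //.
  move=> t st; apply: continuous_within_sub (segment_sub ax yb) _.
  by apply: (Hc 0%N t L0); exact: segment_sub st.
move=> t st; apply: continuous_within_continuous.
exact: (@smooth_at_continuous _ _ 0 (sG t st)).
Qed.

(** Even at an end of [[x, y]], the derivative relative to [[a, b]] is determined by the values on
    [[x, y]]. Up to order [L], the jet of the representative can thus be read off from any piece
    that contains the point. *)
Lemma C_on_jet (L : regularity) (a b x y : R) (f G : R -> R) (k : nat) :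
  a <= x -> x < y -> y <= b -> C_on (segment a b) L f -> reg_ge L k ->
  pw_eq x y f G -> (forall t, segment x y t -> smooth_at G t) ->
  forall t, segment x y t -> derive_within_n (segment a b) k f t = Derive_n G k t.
Proof.
move=> ax xy yb Hf Lk fG sG.
have L0 : reg_ge L 0 by exact: reg_ge_leq Lk.
have ab : a < b by lra.
elim: k Lk => [|k IHk] Lk t st; first exact: (C_on_eq_smooth ax xy yb Hf).
have {}IHk : forall u, segment x y u ->
    derive_within_n (segment a b) k f u = Derive_n G k u.
  by apply: IHk; exact: reg_ge_leq Lk.
have sabt : segment a b t := segment_sub ax yb st.
have [l Hl] := Hf.1 k t Lk sabt.
rewrite [LHS](derive_withinE (segment_limit_point ab sabt) Hl).
apply: (is_derive_within_unique (segment_limit_point xy st)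
  (is_derive_within_sub (segment_sub ax yb) Hl)).
apply: (@is_derive_within_ext _ (Derive_n G k)) => // [u su|]; first by rewrite -IHk.
by apply: is_derive_within_is_derive; apply: smooth_at_is_derive; exact: sG.
Qed.

Lemma in_CLoo_smooth (L : regularity) (a b : R) (f : R -> R) : a < b ->
  (forall t, segment a b t -> smooth_at f t) -> in_CLoo L a b f.
Proof.
have pw_refl c d : pw_eq c d f f by exists [::].
have C_seg M c d : c < d -> (forall t, segment c d t -> smooth_at f t) ->
    C_on (segment c d) M f.
  by move=> cd sf; apply: (@C_on_smooth _ _ _ f) => // t; exact: segment_limit_point.
move=> ab sf; split.
- by exists f; split=> //; exact: C_seg.
- exists f, [::]; split=> //; apply: (@C_on_smooth _ _ _ f) => // [t [st _]|t [st _]].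
    move=> d d0; have [y [sy [yt yd]]] := segment_limit_point ab st d0.
    by exists y.
  exact: sf.
- exists [::] => x y xy Hxy; exists f; split=> //; apply: C_seg => //.
  have ax : a <= x.
    apply: Rnot_lt_le => xa; have := Rmin_l a y; have := Rmin_r a y => m1 m2.
    have xm : x < Rmin a y by apply: Rmin_glb_lt.
    by have [+ _] := Hxy ((x + Rmin a y) / 2) (ltac:(lra)); lra.
  have yb : y <= b.
    apply: Rnot_lt_le => xa; have := Rmax_l b x; have := Rmax_r b x => m1 m2.
    have xm : Rmax b x < y by apply: Rmax_lub_lt.
    by have [+ _] := Hxy ((y + Rmax b x) / 2) (ltac:(lra)); lra.
  by move=> t /(segment_sub ax yb); exact: sf.
Qed.

(** The ends [x] and [y] may themselves be exceptional points or ends of [[a, b]]: each piece is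
    smooth up to its ends, so [smooth_extension] applies. *)
Lemma section_pieces (L : regularity) (m n : nat) (A : 'M[skewpoly]_(m, n))
    (a b : R) (f : 'I_n -> R -> R) : section L A a b f ->
  exists E : seq R, forall x y, a <= x -> x < y -> y <= b ->
    (forall t, x < t < y -> t \notin E) ->
    exists F : 'I_n -> R -> R,
      (forall j t, smooth_at (F j) t) /\ forall j, pw_eq x y (f j) (F j).
Proof.
move=> [Hf _].
have [E' HE'] : exists E' : seq R, forall j x y, x < y ->
    (forall t, x < t < y -> a < t < b /\ t \notin E') -> in_C RegInf x y (f j).
  suff [E' HE'] : exists E' : seq R, forall j, j \in enum 'I_n -> forall x y, x < y ->
      (forall t, x < t < y -> a < t < b /\ t \notin E') -> in_C RegInf x y (f j).
    by exists E' => j; apply: HE'; rewrite mem_enum.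
  elim: (enum 'I_n) => [|j s [E1 HE1]]; first by exists [::].
  have [_ _ [E2 HE2]] := Hf j; exists (E2 ++ E1) => k; rewrite inE => kjs x y xy Hxy.
  case/orP: kjs => [/eqP->|ks]; [apply: HE2|apply: (HE1 k)] => // t /Hxy;
    by rewrite mem_cat negb_or => -[? /andP[]].
exists E' => x y ax xy yb Hxy.
have Hj j : exists F, (forall t, smooth_at F t) /\ pw_eq x y (f j) F.
  have [|g [fg Cg]] := HE' j x y xy; first by move=> t xty; split; [lra|exact: Hxy].
  have [F [sF Fg]] := smooth_extension xy Cg; exists F; split=> //.
  by apply: pw_eq_trans fg _; exists [::] => t st _; rewrite Fg.
have [F HF] := choice Hj; exists F; split=> [j t|j]; first exact: (HF j).1.
exact: (HF j).2.
Qed.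

(** Operators are local: [F] inherits the equation at the points around which it coincides with [f].
    The set [E] gathers the points where the two differ or the equation for [f] fails. *)
Lemma section_piece_kernel (L : regularity) (m n : nat) (A : 'M[skewpoly]_(m, n))
    (a b x y : R) (f F : 'I_n -> R -> R) : section L A a b f ->
  a <= x -> y <= b -> (forall j, pw_eq x y (f j) (F j)) ->
  exists E : seq R, forall x' y', x <= x' -> y' <= y ->
    (forall t, x' < t < y' -> t \notin E) ->
    forall t, x' < t < y' -> forall i, diff_op A F i t = 0.
Proof.
move=> [_ HA] ax yb fF.
have [E HE] : exists E : seq R, forall j t, t \notin E -> segment x y t -> f j t = F j t.
  apply: exceptions_all => j; have [E HE] := fF j.
  by exists E => t tE st; exact: HE.
have [E' HE'] : exists E : seq R, forall i t, t \notin E -> segment a b t ->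
    diff_op A f i t = 0.
  apply: exceptions_all => i; have [E' HE'] := HA i.
  by exists E' => t tE st; exact: HE'.
exists (E ++ E') => x' y' xx yy Hxy t xty i.
have := Hxy t xty; rewrite mem_cat negb_or => /andP[tE tE'].
rewrite -(HE' i t tE'); last by split; lra.
apply: diff_op_ext_loc => j.
apply: filter_imp (filter_and _ _ (open_gt _ t xty.1) (open_lt _ t xty.2)) => u [u1 u2].
have := Hxy u (conj u1 u2); rewrite mem_cat negb_or => /andP[uE _].
by rewrite HE //; split; lra.
Qed.

(** Close enough to [b] on the left there are no exceptional points, so a single smooth solution
    represents the section up to [b]. *)
Lemma section_left_end (L : regularity) (m n : nat) (A : 'M[skewpoly]_(m, n))
    (a b : R) (f : 'I_n -> R -> R) : a < b -> section L A a b f ->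
  exists x (F : 'I_n -> R -> R), [/\ a <= x < b, forall j t, smooth_at (F j) t,
    forall j, pw_eq x b (f j) (F j) &
    forall t i, x < t < b -> diff_op A F i t = 0].
Proof.
move=> ab Hf; have [E HE] := section_pieces Hf.
have [x [xab Hx]] := notin_near_left E ab.
have [|F [sF fF]] := HE x b (ltac:(lra)) xab.2 (Rle_refl _); first exact: Hx.
have [E' HE'] := section_piece_kernel Hf (Rlt_le _ _ xab.1) (Rle_refl _) fF.
have [x' [xab' Hx']] := notin_near_left E' xab.2.
exists x', F; split=> //; first lra.
  by move=> j; apply: pw_eq_sub (fF j); lra.
by move=> t i xt; apply: (HE' x' b) => //; lra.
Qed.

Lemma section_right_end (L : regularity) (m n : nat) (A : 'M[skewpoly]_(m, n))
    (a b : R) (f : 'I_n -> R -> R) : a < b -> section L A a b f ->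
  exists y (F : 'I_n -> R -> R), [/\ a < y <= b, forall j t, smooth_at (F j) t,
    forall j, pw_eq a y (f j) (F j) &
    forall t i, a < t < y -> diff_op A F i t = 0].
Proof.
move=> ab Hf; have [E HE] := section_pieces Hf.
have [x [xab Hx]] := notin_near_right E ab.
have [|F [sF fF]] := HE a x (Rle_refl _) xab.1 (ltac:(lra)); first exact: Hx.
have [E' HE'] := section_piece_kernel Hf (Rle_refl _) (Rlt_le _ _ xab.2) fF.
have [x' [xab' Hx']] := notin_near_right E' xab.1.
exists x', F; split=> //; first lra.
  by move=> j; apply: pw_eq_sub (fF j); lra.
by move=> t i xt; apply: (HE' a x') => //; lra.
Qed.

(** * Extending sections past an endpoint *)

Lemma side_flat_Derive_n (s b e : R) (z : R -> R) (k : nat) : s <> 0 ->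
  side_flat s b e z -> side_flat s b e (Derive_n z k).
Proof. by move=> s0 Hz; elim: k => // k; exact: side_flat_Derive. Qed.

Lemma side_flat_jet (s b e : R) (z : R -> R) (k : nat) : s <> 0 -> 0 < e ->
  side_flat s b e z -> Derive_n z k b = 0.
Proof.
move=> s0 e0 /(side_flat_Derive_n k s0) /(_ b); rewrite Rminus_diag_eq // Rabs_R0.
by move=> /(_ e0) [_]; apply; lra.
Qed.

(** The difference is smooth and vanishes on one side of [b], so all its derivatives vanish at
    [b]. *)
Lemma eq_jet_one_side (s b e : R) (f g : R -> R) (k : nat) : s <> 0 -> 0 < e ->
  (forall t, smooth_at f t) -> (forall t, smooth_at g t) ->
  (forall t, Rabs (t - b) < e -> s * (t - b) <= 0 -> f t = g t) ->
  Derive_n f k b = Derive_n g k b.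
Proof.
move=> s0 e0 sf sg fg.
have : Derive_n (fun t => f t - g t) k b = 0.
  apply: (@side_flat_jet s b e) => // u ue; split.
    exact: smooth_at_minus.
  by move=> us; rewrite fg //; lra.
rewrite Derive_n_minus; first lra.
  by apply: filter_forall => u [|l] _ //; apply: smooth_at_ex_derive.
by apply: filter_forall => u [|l] _ //; apply: smooth_at_ex_derive.
Qed.

(** [F] solves the equation where s (t - b) < 0, and the solution is continued to the other side.
    With Phi the localized [F], and u equal to B (A Phi) on the new side and 0 elsewhere, G = Phi -
    u. *)
Lemma kernel_one_side (m n : nat) (A : 'M[skewpoly]_(m, n))
    (B : 'M[skewpoly]_(n, m)) (s b e delta : R) (F : 'I_n -> R -> R) :
  (A *m B = 1%:M)%R -> s <> 0 -> 0 < e -> 0 < delta ->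
  (forall j t, smooth_at (F j) t) ->
  (forall t i, Rabs (t - b) < e -> s * (t - b) < 0 -> diff_op A F i t = 0) ->
  exists G : 'I_n -> R -> R, [/\ forall j t, smooth_at (G j) t,
    forall j k, Derive_n (G j) k b = Derive_n (F j) k b,
    forall j t, delta <= Rabs (t - b) -> G j t = 0 &
    forall i t, 0 < s * (t - b) -> diff_op A G i t = 0].
Proof.
move=> AB s0 e0 d0 sF HA.
have Hgen := generically_and (diff_op_smooth A) (generically_and (diff_op_smooth B)
  (generically_and (diff_op_mul A B) (diff_op1 m))).
have [/= e1 He1] := generically_near b Hgen; have e1p := cond_pos e1.
(* Within [eps] of [b] no point except possibly [b] is exceptional, [F] solves the equation on its
   side, and the required support radius [delta] is respected. *)
pose eps := Rmin (pos e1) (Rmin e delta).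
have eps0 : 0 < eps by do 2!apply: Rmin_pos => //.
have [epse1 [epse epsd]] : eps <= e1 /\ eps <= e /\ eps <= delta.
  have := Rmin_l e1 (Rmin e delta); have := Rmin_r e1 (Rmin e delta).
  have := Rmin_l e delta; have := Rmin_r e delta; rewrite -/eps; lra.
(* This is [F] up to distance eps/4 and 0 from distance eps/2 on, so exceptional points farther away
   only meet the zero function. *)
pose Phi j t := cutoff (4 / eps * (t - b)) * F j t.
have c0 : 0 < 4 / eps by apply: Rdiv_lt_0_compat; lra.
have cabs t : Rabs (4 / eps * (t - b)) = 4 / eps * Rabs (t - b).
  by rewrite Rabs_mult Rabs_right //; lra.
have sPhi j t : smooth_at (Phi j) t.
  apply: smooth_at_mult => //; apply: (@smooth_at_comp cutoff).
    exact: smooth_at_cutoff.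
  apply: smooth_at_scal; apply: smooth_at_minus; first exact: smooth_at_id.
  exact: smooth_at_const.
have Phi1 j t : Rabs (t - b) <= eps / 4 -> Phi j t = F j t.
  move=> tb; rewrite /Phi cutoff_eq1 ?Rmult_1_l // cabs.
  have := Rmult_le_compat_l (4 / eps) _ _ (Rlt_le _ _ c0) tb.
  by have -> : 4 / eps * (eps / 4) = 1 by field; lra.
have Phi0 j t : eps / 2 <= Rabs (t - b) -> Phi j t = 0.
  move=> tb; rewrite /Phi cutoff_eq0 ?Rmult_0_l // cabs.
  have := Rmult_le_compat_l (4 / eps) _ _ (Rlt_le _ _ c0) tb.
  by have -> : 4 / eps * (eps / 2) = 2 by field; lra.
pose u j := on_side s b (diff_op B (diff_op A Phi) j).
have ltP r t : Rabs (t - b) < r -> locally t (fun v => Rabs (v - b) < r).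
  exact: locally_Rabs_lt.
have gtP r t : r < Rabs (t - b) -> locally t (fun v => r < Rabs (v - b)).
  move=> H; apply/locally_Rabs; exists (Rabs (t - b) - r); split; first lra.
  move=> y; have := Rabs_triang (t - y) (y - b).
  have -> : t - y + (y - b) = t - b by ring.
  by rewrite (Rabs_minus_sym t y); lra.
have APhi_far i t : eps / 2 < Rabs (t - b) -> diff_op A Phi i t = 0.
  move=> /gtP tb; apply: diff_op0 => j; apply: filter_imp tb => v vb.
  by apply: Phi0; lra.
have BAPhi_far j t : eps / 2 < Rabs (t - b) -> diff_op B (diff_op A Phi) j t = 0.
  by move=> /gtP tb; apply: diff_op0 => i; apply: filter_imp tb => v /APhi_far.
have BAPhi_side j t : Rabs (t - b) < eps / 4 -> s * (t - b) < 0 ->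
    diff_op B (diff_op A Phi) j t = 0.
  move=> tb ts; apply: diff_op0 => i.
  apply: filter_imp (filter_and _ _ (ltP _ _ tb) (locally_side_neg ts)) => v [vb vs].
  rewrite -(HA v i _ vs); last lra.
  apply: diff_op_ext_loc => k; apply: filter_imp (ltP _ _ vb) => y yb.
  by apply: Phi1; lra.
have u_far j t : eps / 2 < Rabs (t - b) -> u j t = 0.
  by move=> tb; rewrite /u /on_side BAPhi_far //; case: Rlt_dec.
have good t : Rabs (t - b) < eps -> t <> b -> forall j, smooth_at (diff_op A Phi j) t.
  by move=> tb tb0; have [H _] := He1 t (Rlt_le_trans _ _ _ tb epse1) tb0; exact: H.
have good2 t : Rabs (t - b) < eps -> t <> b ->
    forall j, smooth_at (diff_op B (diff_op A Phi) j) t.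
  move=> tb tb0; have [_ [H _]] := He1 t (Rlt_le_trans _ _ _ tb epse1) tb0.
  by apply: H; exact: good.
have su j t : smooth_at (u j) t.
  have [tb|tb] := Rlt_le_dec (eps / 2) (Rabs (t - b)).
    apply: smooth_at_ext_loc (smooth_at_const 0 t).
    by apply: filter_imp (gtP _ _ tb) => v vb; rewrite u_far.
  have te : Rabs (t - b) < eps by lra.
  have [ts|[ts|ts]] := Rtotal_order (s * (t - b)) 0.
  - apply: smooth_at_ext_loc (smooth_at_const 0 t).
    apply: filter_imp (locally_side_neg ts) => v vs.
    by rewrite /u /on_side; case: Rlt_dec => [?|//]; lra.
  - have tb0 : t = b by nra.
    rewrite {t tb te ts}tb0.
    (* The only point where a pole can interfere. On the old side z / p is 0 off [b], so [z]
       vanishes there, and at [b] by continuity. Hence [z] is flat, and [smooth_at_side_div]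
       applies. *)
    have [z [p [p0 sz /locally_Rabs [r [r0 Hr]]]]] :
        merolike b (diff_op B (diff_op A Phi) j).
      apply: merolike_diff_op => i; apply: merolike_diff_op => k.
      exact: merolike_smooth.
    pose r' := Rmin r (eps / 4).
    have r'0 : 0 < r' by apply: Rmin_pos; lra.
    have [r'r r'e] : r' <= r /\ r' <= eps / 4 by split; [exact: Rmin_l|exact: Rmin_r].
    have zneg v : Rabs (v - b) < r' -> s * (v - b) < 0 -> z v = 0.
      move=> vb vs; have vb0 : v <> b by move=> vb0; rewrite vb0 in vs; lra.
      have [pv] := Hr v (ltac:(lra)) vb0; rewrite BAPhi_side //; last lra.
      move=> zp; have : z v = z v / p v * p v by field.
      by rewrite -zp; lra.
    have zb : z b = 0.
      apply: contrapT => zb; have cz := @smooth_at_continuous z b 0 (sz b).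
      have /locally_Rabs [r2 [r20 Hr2]] := continuous_neq0 cz zb.
      pose h := Rmin (r' / 2) (r2 / 2).
      have h0 : 0 < h by apply: Rmin_pos; lra.
      have [h1 h2] : h <= r' / 2 /\ h <= r2 / 2 by split; [exact: Rmin_l|exact: Rmin_r].
      have [sp|sn] : 0 < s \/ s < 0 by lra.
        have E : b - h - b = - h by ring.
        have hE : Rabs (b - h - b) = h by rewrite E Rabs_Ropp Rabs_right; lra.
        apply: (Hr2 (b - h)); first by rewrite hE; lra.
        by apply: zneg; [rewrite hE; lra|rewrite E; nra].
      have E : b + h - b = h by ring.
      have hE : Rabs (b + h - b) = h by rewrite E Rabs_right; lra.
      apply: (Hr2 (b + h)); first by rewrite hE; lra.
      by apply: zneg; [rewrite hE; lra|rewrite E; nra].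
    have Hz : side_flat s b r' z.
      move=> v vr; split=> // -[vs|vs]; first exact: zneg.
      by have -> : v = b by nra.
    apply: smooth_at_ext_loc (smooth_at_side_div s0 r'0 p0 Hz).
    apply/locally_Rabs; exists r; split=> // v vr.
    rewrite /u /on_side; case: Rlt_dec => //= vs.
    have vb0 : v <> b by move=> vb0; rewrite vb0 in vs; lra.
    by have [_ ->] := Hr v vr vb0.
  - have tb0 : t <> b by move=> tb0; rewrite tb0 in ts; lra.
    apply: smooth_at_ext_loc (good2 t te tb0 j).
    apply: filter_imp (locally_side_pos ts) => v vs.
    by rewrite /u /on_side; case: Rlt_dec.
exists (fun j t => Phi j t - u j t); split.
- by move=> j t; exact: smooth_at_minus.
(* On the old side near [b] nothing is subtracted and [Phi] is [F]; agreement on one side determines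
   the jet. *)
- move=> j k; apply: (@eq_jet_one_side s b (eps / 4)) => //; first lra.
    by move=> t; exact: smooth_at_minus.
  move=> t tb ts; rewrite Phi1; last lra.
  by rewrite /u /on_side; case: Rlt_dec => [?|?] /=; lra.
- by move=> j t td; rewrite Phi0 ?u_far; lra.
- move=> i t ts; have tb0 : t <> b by move=> tb0; rewrite tb0 in ts; lra.
  have [tb|tb] := Rlt_le_dec (eps / 2) (Rabs (t - b)).
    apply: diff_op0 => j; apply: filter_imp (gtP _ _ tb) => v vb.
    by rewrite Phi0 ?u_far; lra.
  have te : Rabs (t - b) < eps by lra.
  have [_ [_ [H1 H2]]] := He1 t (Rlt_le_trans _ _ _ te epse1) tb0.
  (* Around [t] the function [u] is B (A Phi), so the value is A Phi - (A B) (A Phi) = 0. *)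
  rewrite diff_op_minus // (@diff_op_ext_loc _ _ _ u (diff_op B (diff_op A Phi))).
    by rewrite -H1 ?AB ?H2; [lra|exact: good].
  move=> j; apply: filter_imp (locally_side_pos ts) => v vs.
  by rewrite /u /on_side; case: Rlt_dec.
Qed.

(** Reduces the matching of sections over two different segments to the jets of smooth functions
    that represent them near [t]. *)
Lemma restr_point_eq (L : regularity) (n : nat) (a b b' c x y x' y' t : R)
    (f g F G : 'I_n -> R -> R) :
  a <= x -> x < y -> y <= b -> b' <= x' -> x' < y' -> y' <= c ->
  (forall j, in_C L a b (f j)) -> (forall j, in_C L b' c (g j)) ->
  (forall j u, smooth_at (F j) u) -> (forall j u, smooth_at (G j) u) ->
  (forall j, pw_eq x y (f j) (F j)) -> (forall j, pw_eq x' y' (g j) (G j)) ->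
  segment x y t -> segment x' y' t ->
  (forall j k, Derive_n (F j) k t = Derive_n (G j) k t) ->
  restr_point L a b f t = restr_point L b' c g t.
Proof.
move=> ax xy yb b'x' x'y' y'c Hf Hg sF sG fF gG st st' FG.
congr pair; apply: funext => -[k Lk]; apply/colP => j; rewrite !mxE /=.
have [fr Cf] := C_repP (Hf j); have [gr Cg] := C_repP (Hg j).
rewrite (C_on_jet ax xy yb Cf Lk (G := F j)) //; last first.
  by apply: pw_eq_trans (fF j); apply: pw_eq_sub (pw_eq_sym fr).
rewrite (C_on_jet b'x' x'y' y'c Cg Lk (G := G j)) //.
by apply: pw_eq_trans (gG j); apply: pw_eq_sub (pw_eq_sym gr).
Qed.

Lemma right_invertible_controllable (L : regularity) (m n : nat)
    (A : 'M[skewpoly]_(m, n)) : right_invertible A -> controllable L A.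
Proof.
move=> [B AB] a b c d ab bc cd f h Sf Sh.
have [x [F [axb sF fF AF]]] := section_left_end ab Sf.
have [y [H [cyd sH hH AH]]] := section_right_end cd Sh.
(* With this support radius only [G] contributes to the jet at [b], and only [K] to the jet at
   [c]. *)
have d0 : 0 < (c - b) / 2 by lra.
(* At [b] the solution is continued to the right (s = 1), at [c] to the left (s = -1). *)
have [||G [sG Gjet G0 AG]] :=
  @kernel_one_side _ _ A B 1 b (b - x) _ F AB (ltac:(lra)) _ d0 sF; first lra.
  by move=> t i /Rabs_def2 tx tb; apply: AF; lra.
have [||K [sK Kjet K0 AK]] :=
  @kernel_one_side _ _ A B (-1) c (y - c) _ H AB (ltac:(lra)) _ d0 sH; first lra.
  by move=> t i /Rabs_def2 tx tb; apply: AH; lra.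
pose g j t := G j t + K j t.
have sg j t : smooth_at (g j) t by exact: smooth_at_plus.
have Sg : section L A b c g.
  split=> [j|i]; first by apply: in_CLoo_smooth.
  exists [:: b; c] => t [bt tc]; rewrite !inE negb_or => /andP[/eqP tb /eqP tc'].
  by rewrite diff_op_plus // AG ?AK; lra.
have g_b j k : Derive_n (F j) k b = Derive_n (g j) k b.
  rewrite -Gjet; apply: Derive_n_ext_loc; apply/locally_Rabs.
  exists ((c - b) / 2); split=> // t /Rabs_def2 tb.
  by rewrite /g K0 ?Rplus_0_r // Rabs_left; lra.
have g_c j k : Derive_n (g j) k c = Derive_n (H j) k c.
  rewrite -Kjet; apply: Derive_n_ext_loc; apply/locally_Rabs.
  exists ((c - b) / 2); split=> // t /Rabs_def2 tc.
  by rewrite /g G0 ?Rplus_0_l // Rabs_right; lra.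
have inC M a' b' w : section M A a' b' w -> forall j, in_C M a' b' (w j).
  by move=> [Hw _] j; have [] := Hw j.
have refl j : pw_eq b c (g j) (g j) by exists [::].
exists g; split=> //.
  by apply: (@restr_point_eq L n a b b c x b b c b f g F g);
    rewrite /segment; try lra; try (by apply: inC); auto.
by apply: (@restr_point_eq L n b c c d b c c y c g h g H);
  rewrite /segment; try lra; try (by apply: inC); auto.
Qed.

(** * Power series solutions *)

Lemma strong_recursion (Phi : nat -> (nat -> R) -> R) : exists a : nat -> R,
  forall m, a m = Phi m (fun j => if (j < m)%N then a j else 0).
Proof.
(* [S m] tabulates the first [m] values and is 0 beyond them. *)
pose fix S m : nat -> R := if m is m'.+1 then
  fun j => if j == m' then Phi m' (S m') else S m' j else fun=> 0.
exists (fun m => S m.+1 m) => m; rewrite /= eqxx; congr Phi.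
elim: m => [//|m IHm]; apply: funext => j.
rewrite ltnS leq_eqVlt [LHS]/=; case: eqP => [->|_] /=; first by rewrite eqxx.
by rewrite IHm.
Qed.

(** The product (j + 1) ... (j + k), which is the coefficient of t^j in the k-th derivative of
    t^(j+k). *)
Definition rising (k j : nat) : R :=
  INR (Factorial.fact (j + k)) / INR (Factorial.fact j).

Lemma rising_gt0 (k j : nat) : 0 < rising k j.
Proof. by apply: Rdiv_lt_0_compat; exact: INR_fact_lt_0. Qed.

Lemma risingS (k j : nat) : rising k.+1 j = rising k j * INR (j + k).+1.
Proof.
rewrite /rising addnS -[Factorial.fact (j + k).+1]/((j + k).+1 * Factorial.fact (j + k))%N.
by rewrite mult_INR; field; apply: INR_fact_neq_0.
Qed.

Lemma rising_le (k d j n : nat) : (k <= d)%N -> (j <= n)%N ->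
  rising k j <= rising d n.
Proof.
move=> kd jn; apply: (@Rle_trans _ (rising k n)).
  elim: k {kd} => [|k IHk].
    by rewrite /rising !addn0 !Rdiv_diag; try exact: INR_fact_neq_0; lra.
  rewrite !risingS; apply: Rmult_le_compat => //.
  - exact/Rlt_le/rising_gt0.
  - exact: pos_INR.
  - by apply: le_INR; apply/leP; rewrite ltnS leq_add2r.
elim: d kd => [|d IHd]; first by rewrite leqn0 => /eqP ->; exact: Rle_refl.
rewrite leq_eqVlt => /orP[/eqP->|kd]; first exact: Rle_refl.
apply: Rle_trans (IHd kd) _; rewrite risingS.
have := rising_gt0 d n; have : 1 <= INR (n + d).+1.
  by rewrite S_INR; have := pos_INR (n + d); lra.
nra.
Qed.

(* The coefficient of [t^n] in [sum_(k <= d) P_k y^(k)], where [P_k] and [y]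
   are the power series with coefficients [P k] and [u]. *)
Definition ode_coef (P : nat -> nat -> R) (d : nat) (u : nat -> R) (n : nat) : R :=
  sum_f_R0 (fun k => sum_f_R0 (fun i =>
    P k i * (rising k (n - i) * u (n - i + k)%N)) n) d.

Lemma sum_f_R0_delta0 (x : R) (n : nat) :
  sum_f_R0 (fun i => if i == 0%N then x else 0) n = x.
Proof. by elim: n => // n IHn; rewrite /= IHn Rplus_0_r. Qed.

Lemma sum_f_R0_eq0 (f : nat -> R) (n : nat) :
  (forall i, (i <= n)%N -> f i = 0) -> sum_f_R0 f n = 0.
Proof.
elim: n => [|n IHn] H /=; first exact: H.
by rewrite IHn ?H ?Rplus_0_r // => i ni; apply: H; exact: leqW.
Qed.

Lemma sum_f_R0_delta (x : R) (n : nat) :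
  sum_f_R0 (fun i => if i == n then x else 0) n = x.
Proof.
case: n => [//|n]; rewrite /= eqxx sum_f_R0_eq0 ?Rplus_0_l // => i ni.
by rewrite ltn_eqF.
Qed.

(** The index n + d occurs only for k = d and i = 0. Solving for this term gives the recursion for
    the coefficients. *)
Lemma ode_coef_last (P : nat -> nat -> R) (d : nat) (u : nat -> R) (n : nat) :
  ode_coef P d u n = ode_coef P d (fun j => if (j < n + d)%N then u j else 0) n
    + P d 0%N * (rising d n * u (n + d)%N).
Proof.
rewrite -[X in _ = _ + X](sum_f_R0_delta _ d) /ode_coef -sum_plus.
apply: PartSum.sum_eq => k /leP kd /=; rewrite -[X in _ = _ + X](sum_f_R0_delta0 _ n) -sum_plus.
apply: PartSum.sum_eq => i /leP ni /=.
case: (altP (i =P 0%N)) => [->|i0].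
  rewrite subn0; case: (altP (k =P d)) => [->|kd'] /=; first by rewrite ltnn; ring.
  by rewrite ltn_add2l ltn_neqAle kd' kd /=; ring.
have -> : (n - i + k < n + d)%N.
  have : (n - i < n)%N by rewrite ltn_subrL lt0n i0 (leq_trans _ ni) // lt0n.
  by move=> h; rewrite -addSn leq_add.
by ring.
Qed.

Lemma sum_half_le (n : nat) : sum_f_R0 (fun i => (/ 2) ^ i) n <= 2.
Proof.
suff -> : sum_f_R0 (fun i => (/ 2) ^ i) n = 2 - (/ 2) ^ n.
  by have := pow_le (/ 2) n; lra.
elim: n => [|n IHn]; first by rewrite /=; lra.
by rewrite -[LHS]/(sum_f_R0 (fun i => (/ 2) ^ i) n + (/ 2) ^ n.+1) IHn /=; lra.
Qed.

(** Since n - i + k < n + d, one power of [rho] is saved; it comes from i > 0 if k = d, and from k <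
    d otherwise. This produces the factor [2 * sg / rho], which is small for large [rho], while sg
    <= rho / 2 makes the sum over [i] geometric. *)
Lemma majorant_term (C sg rho : R) (d n k i : nat) :
  0 < C -> 1 <= sg -> 2 * sg <= rho -> (k <= d)%N -> (i <= n)%N ->
  (n - i + k < n + d)%N ->
  C * sg ^ i * rho ^ (n - i + k) <= C * (2 * sg / rho) * rho ^ (n + d) * (/ 2) ^ i.
Proof.
move=> C0 sg1 sr kd ni lt.
have r0 : 0 < rho by lra.
have key j : sg ^ j <= rho ^ j * (/ 2) ^ j.
  by rewrite -Rpow_mult_distr; apply: pow_incr; lra.
have [N NE] : exists N, (n + d = N.+1)%N.
  by exists (n + d).-1; rewrite prednK // (leq_ltn_trans _ lt).
have -> : C * (2 * sg / rho) * rho ^ (n + d) * (/ 2) ^ i =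
    C * (2 * sg * rho ^ N * (/ 2) ^ i).
  by rewrite NE /=; field; lra.
rewrite Rmult_assoc; apply: Rmult_le_compat_l; first lra.
have h0 j : 0 < (/ 2) ^ j by apply: pow_lt; lra.
have p0 j : 0 < rho ^ j by exact: pow_lt.
move: kd; rewrite leq_eqVlt => /orP[/eqP kd|kd].
  case: i ni lt => [|i] ni lt; first by move: lt; rewrite subn0 kd ltnn.
  have E : (i + (n - i.+1 + k) = N)%N by move: NE; rewrite kd; lia.
  have -> : rho ^ N = rho ^ i * rho ^ (n - i.+1 + k) by rewrite -pow_add -E.
  have := key i; have := p0 (n - i.+1 + k)%N; rewrite /=.
  set x := rho ^ (_ - _ + _); set y := rho ^ i; set z := (/ 2) ^ i; set w := sg ^ i.
  move=> x0 wyz; have : sg * x * w <= sg * x * (y * z).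
    by apply: Rmult_le_compat_l => //; nra.
  lra.
have E : (n - i + k <= N)%N by move: NE; lia.
apply: (@Rle_trans _ (rho ^ (i + (n - i + k)) * (/ 2) ^ i)).
  rewrite (pow_add rho i).
  by have := Rmult_le_compat_r _ _ _ (Rlt_le _ _ (p0 (n - i + k)%N)) (key i); lra.
apply: Rmult_le_compat_r; first exact/Rlt_le.
apply: (@Rle_trans _ (rho ^ N)); last first.
  by have := p0 N; have := Rmult_le_compat_r _ _ _ (Rlt_le _ _ (p0 N)) sg1; lra.
by apply: Rle_pow; [lra|lia].
Qed.

Lemma ode_coef_bound (P : nat -> nat -> R) (d : nat) (C sg rho : R) (u : nat -> R)
    (n : nat) :
  0 < C -> 1 <= sg -> 2 * sg <= rho ->
  (forall k i, (k <= d)%N -> Rabs (P k i) <= C * sg ^ i) ->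
  (forall j, (j < n + d)%N -> Rabs (u j) <= rho ^ j) ->
  Rabs (ode_coef P d (fun j => if (j < n + d)%N then u j else 0) n) <=
  rising d n * (C * (2 * sg / rho) * rho ^ (n + d)) * (2 * INR d.+1).
Proof.
move=> C0 sg1 sr HP Hu; set K := C * _ * _.
have r0 : 0 < rho by lra.
have K0 : 0 <= K.
  apply: Rmult_le_pos; last exact/Rlt_le/pow_lt.
  by apply: Rmult_le_pos; [lra|apply: Rlt_le; apply: Rdiv_lt_0_compat; lra].
have rd := rising_gt0 d n.
rewrite /ode_coef; apply: Rle_trans (Rsum_abs _ _) _.
have -> : rising d n * K * (2 * INR d.+1) = rising d n * K * 2 * INR d.+1 by ring.
rewrite -sum_cte; apply: sum_Rle => k /leP kd.
apply: Rle_trans (Rsum_abs _ _) _.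
apply: (@Rle_trans _ (sum_f_R0 (fun i => (/ 2) ^ i * (rising d n * K)) n)); last first.
  rewrite -scal_sum; apply: Rmult_le_compat_l; last exact: sum_half_le.
  by apply: Rmult_le_pos => //; lra.
apply: sum_Rle => i /leP ni; rewrite Rabs_mult (Rabs_mult (rising _ _)).
have h0 : 0 < (/ 2) ^ i by apply: pow_lt; lra.
case: ifP => lt; last first.
  rewrite Rabs_R0 !Rmult_0_r; apply: Rmult_le_pos; first lra.
  by apply: Rmult_le_pos => //; lra.
have rk := rising_gt0 k (n - i); rewrite (Rabs_right (rising _ _)); last lra.
have rkd : rising k (n - i) <= rising d n by apply: rising_le => //; exact: leq_subr.
have := majorant_term C0 sg1 sr kd ni lt; rewrite -/K.
have := HP k i kd; have := Hu _ lt => h1 h2 h3.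
have a0 := Rabs_pos (P k i); have b0 := Rabs_pos (u (n - i + k)%N).
have h4 : Rabs (P k i) * Rabs (u (n - i + k)%N) <= K * (/ 2) ^ i.
  by apply: Rle_trans h3; apply: Rmult_le_compat.
have ab := Rmult_le_pos _ _ a0 b0.
have : rising k (n - i) * (Rabs (P k i) * Rabs (u (n - i + k)%N)) <=
    rising d n * (K * (/ 2) ^ i) by apply: Rmult_le_compat; lra.
lra.
Qed.

(** Cauchy's majorants. The first [d] coefficients are free and taken as 1, 0, ..., 0; the later
    ones are bounded inductively by means of [ode_coef_bound]. *)
Lemma ode_formal_solution (P : nat -> nat -> R) (d : nat) (C sg : R) :
  (0 < d)%N -> 0 < C -> 1 <= sg ->
  (forall k i, (k <= d)%N -> Rabs (P k i) <= C * sg ^ i) -> P d 0%N <> 0 ->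
  exists (a : nat -> R) (rho : R), [/\ 0 < rho, forall j, Rabs (a j) <= rho ^ j,
    a 0%N = 1 & forall n, ode_coef P d a n = 0].
Proof.
move=> d0 C0 sg1 HP P0.
pose Phi m (u : nat -> R) := if (m < d)%N then (if m == 0%N then 1 else 0)
  else - ode_coef P d u (m - d) / (P d 0%N * rising d (m - d)).
have [a Ha] := strong_recursion Phi.
have Pd : 0 < Rabs (P d 0%N) by exact: Rabs_pos_lt.
(* Large enough for [rhoP], so that division by the leading coefficient reproduces the bound
   rho^j. *)
pose rho := 2 * sg + C * (2 * sg) * (2 * INR d.+1) / Rabs (P d 0%N).
have dS : 0 < INR d.+1 by apply: lt_0_INR; lia.
have q0 : 0 < C * (2 * sg) * (2 * INR d.+1) / Rabs (P d 0%N).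
  by apply: Rdiv_lt_0_compat => //; apply: Rmult_lt_0_compat; nra.
have sr : 2 * sg <= rho by rewrite /rho; lra.
have r0 : 0 < rho by lra.
have rhoP : C * (2 * sg / rho) * (2 * INR d.+1) <= Rabs (P d 0%N).
  apply: (Rmult_le_reg_r rho) => //.
  have -> : C * (2 * sg / rho) * (2 * INR d.+1) * rho = C * (2 * sg) * (2 * INR d.+1).
    by field; lra.
  rewrite /rho Rmult_plus_distr_l.
  have -> : Rabs (P d 0%N) * (C * (2 * sg) * (2 * INR d.+1) / Rabs (P d 0%N)) =
    C * (2 * sg) * (2 * INR d.+1) by field; lra.
  by nra.
have aE n : a (n + d)%N = - ode_coef P d (fun j => if (j < n + d)%N then a j else 0) n
    / (P d 0%N * rising d n).
  by rewrite Ha /Phi ltnNge leq_addl /= addnK.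
exists a, rho; split=> //.
- move=> j; have [N] := ubnP j; elim: N j => // N IHN j; rewrite ltnS => jN.
  case: (ltnP j d) => jd.
    rewrite Ha /Phi jd; have p0 : 0 < rho ^ j by exact: pow_lt.
    case: eqP => [->|_]; last by rewrite Rabs_R0; lra.
    by rewrite Rabs_R1 /=; lra.
  have jE : (j = (j - d) + d)%N by rewrite subnK.
  rewrite jE; set n := (j - d)%N in jE *.
  have rd := rising_gt0 d n.
  have := @ode_coef_bound P d C sg rho a n C0 sg1 sr HP.
  have IH l : (l < n + d)%N -> Rabs (a l) <= rho ^ l.
    by rewrite -jE => lj; apply: IHN; exact: leq_trans lj jN.
  move=> /(_ IH); rewrite aE Rabs_mult Rabs_Ropp Rabs_inv (Rabs_mult (P d 0%N)).
  rewrite (Rabs_right (rising _ _)); last lra.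
  set Q := Rabs (ode_coef _ _ _ _) => HQ.
  have p0 : 0 < rho ^ (n + d) by exact: pow_lt.
  apply: (Rmult_le_reg_r (Rabs (P d 0%N) * rising d n)).
    exact: Rmult_lt_0_compat.
  rewrite Rmult_assoc Rinv_l ?Rmult_1_r; last by apply: Rmult_integral_contrapositive; lra.
  apply: Rle_trans HQ _.
  have -> : rising d n * (C * (2 * sg / rho) * rho ^ (n + d)) * (2 * INR d.+1) =
    rho ^ (n + d) * rising d n * (C * (2 * sg / rho) * (2 * INR d.+1)) by ring.
  have -> : rho ^ (n + d) * (Rabs (P d 0%N) * rising d n) =
    rho ^ (n + d) * rising d n * Rabs (P d 0%N) by ring.
  by apply: Rmult_le_compat_l => //; apply: Rlt_le; exact: Rmult_lt_0_compat.
- by rewrite Ha /Phi d0.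
- move=> n; rewrite ode_coef_last aE; field; split=> //.
  by have := rising_gt0 d n; lra.
Qed.

(** For some z > 0 the terms a_n z^n are bounded, by M say, so |a_n| <= M z^(-n). Adding 1 to M and
    to 1/z gives the required signs. *)
Lemma analytic_coef_bound (a : nat -> R) (r : R) (g : R -> R) : 0 < r ->
  (forall h, Rabs h < r -> is_pseries a h (g h)) ->
  exists C sg, [/\ 0 < C, 1 <= sg & forall i, Rabs (a i) <= C * sg ^ i].
Proof.
move=> r0 Hg.
have [z [z0 [M HM]]] : exists z, 0 < z /\ exists M, forall n, Rabs (a n * z ^ n) <= M.
  apply: contrapT => H; have [_ lub] := CV_radius_bounded a.
  have : Rbar_lt (Rabs (r / 2)) (CV_radius a).
    by apply: (pseries_radius Hg); rewrite Rabs_right; lra.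
  apply: Rbar_le_not_lt; apply: lub => z [M HM] /=.
  have [z0|z0] := Rle_lt_dec z 0; first by have := Rabs_pos (r / 2); lra.
  by exfalso; apply: H; exists z; split=> //; exists M.
have iz : 0 < / z by exact: Rinv_0_lt_compat.
have M0 : 0 <= M by apply: Rle_trans (HM 0%N); exact: Rabs_pos.
exists (M + 1), (1 + / z); split; try lra.
move=> i; have zi : 0 < z ^ i by exact: pow_lt.
have := HM i; rewrite Rabs_mult (Rabs_right (z ^ i)); last lra.
move=> h; have ai : Rabs (a i) <= M * (/ z) ^ i.
  rewrite pow_inv; apply: (Rmult_le_reg_r (z ^ i)) => //.
  by rewrite Rmult_assoc Rinv_l ?Rmult_1_r //; lra.
apply: Rle_trans ai _; apply: Rmult_le_compat; try lra.
  by apply: pow_le; lra.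
by apply: pow_incr; lra.
Qed.

Lemma anfun_coef_bound (p : nat -> anfun) (b : R) (d : nat) :
  exists (P : nat -> nat -> R) (r C sg : R), [/\ 0 < r, 0 < C, 1 <= sg,
    forall k i, (k <= d)%N -> Rabs (P k i) <= C * sg ^ i &
    forall k t, (k <= d)%N -> Rabs (t - b) < r -> is_pseries (P k) (t - b) (p k t)].
Proof.
suff H : exists P : nat -> nat -> R, exists r C sg : R, [/\ 0 < r, 0 < C, 1 <= sg,
    forall k i, (k < d.+1)%N -> Rabs (P k i) <= C * sg ^ i &
    forall k t, (k < d.+1)%N -> Rabs (t - b) < r -> is_pseries (P k) (t - b) (p k t)].
  by have [P [r [C [sg H']]]] := H; exists P, r, C, sg.
elim: d.+1 => [|m [P [r [C [sg [r0 C0 sg1 HP Hp]]]]]].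
  by exists (fun _ _ => 0), 1, 1, 1; split=> //; lra.
have [a [r' [r'0 Ha]]] := anfunP (p m) b.
have [C' [sg' [C'0 sg'1 HC']]] := analytic_coef_bound r'0 (shift_pseries Ha).
have [R1 R2] := (Rmin_l r r', Rmin_r r r').
have [C1 C2] := (Rmax_l C C', Rmax_r C C').
have [s1 s2] := (Rmax_l sg sg', Rmax_r sg sg').
exists (fun k => if k == m then a else P k), (Rmin r r'), (Rmax C C'), (Rmax sg sg').
have bd x y i : 0 < x -> 1 <= y -> x <= Rmax C C' -> y <= Rmax sg sg' ->
    x * y ^ i <= Rmax C C' * Rmax sg sg' ^ i.
  move=> x0 y1 xC ys; apply: Rmult_le_compat => //; try lra.
    by apply: pow_le; lra.
  by apply: pow_incr; lra.
split; try lra; first exact: Rmin_pos.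
- move=> k i; rewrite ltnS leq_eqVlt => /orP[/eqP->|km].
    by rewrite eqxx; apply: Rle_trans (HC' i) _; exact: bd.
  by rewrite ltn_eqF //; apply: Rle_trans (HP k i km) _; exact: bd.
- move=> k t; rewrite ltnS leq_eqVlt => /orP[/eqP->|km] tb.
    by rewrite eqxx; apply: Ha; lra.
  by rewrite ltn_eqF //; apply: Hp => //; lra.
Qed.

Lemma is_pseries_sum (Q : nat -> nat -> R) (l : nat -> R) (h : R) (d : nat) :
  (forall k, (k <= d)%N -> is_pseries (Q k) h (l k)) ->
  is_pseries (fun n => sum_f_R0 (fun k => Q k n) d) h (sum_f_R0 l d).
Proof.
elim: d => [|d IHd] HQ /=; first exact: HQ.
by apply: is_pseries_plus; [apply: IHd => k kd; apply: HQ; exact: leqW|exact: HQ].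
Qed.

Lemma analytic_ode_solution (p : nat -> anfun) (b : R) (d : nat) :
  (0 < d)%N -> p d b <> 0 ->
  exists y : R -> R, [/\ smooth_at y b, y b = 1 &
    locally b (fun t => sum_f_R0 (fun k => p k t * Derive_n y k t) d = 0)].
Proof.
move=> d0 pb; have [P [r [C [sg [r0 C0 sg1 HP Hp]]]]] := anfun_coef_bound p b d.
have P0 : P d 0%N <> 0.
  have := Hp d b (leqnn d); rewrite Rminus_diag_eq // Rabs_R0 => /(_ r0) H.
  by rewrite -PSeries_0 (is_pseries_unique _ _ _ H).
have [a [rho [rho0 Ha a0 Hode]]] := ode_formal_solution d0 C0 sg1 HP P0.
have irho : 0 < / rho by exact: Rinv_0_lt_compat.
have rad h : Rabs h < / rho -> Rbar_lt (Rabs h) (CV_radius a).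
  move=> hr; apply: (Rbar_lt_le_trans _ (/ rho)) => //.
  have [ub _] := CV_radius_bounded a; apply: ub; exists 1 => n.
  rewrite Rabs_mult (Rabs_right ((/ rho) ^ n)); last by apply/Rle_ge/pow_le; lra.
  have pn : 0 < rho ^ n by exact: pow_lt.
  rewrite pow_inv; apply: (Rmult_le_reg_r (rho ^ n)) => //.
  by rewrite Rmult_assoc Rinv_l ?Rmult_1_r ?Rmult_1_l; [exact: Ha|lra].
have D k t : Derive_n (fun t => PSeries a (t - b)) k t = Derive_n (PSeries a) k (t - b).
  exact: Derive_n_comp_trans.
exists (fun t => PSeries a (t - b)); split.
- apply: smooth_at_translate; apply: smooth_at_PSeries; apply: rad.
  by rewrite Rminus_diag_eq // Rabs_R0.
- by rewrite Rminus_diag_eq // PSeries_0.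
apply/locally_Rabs; exists (Rmin r (/ rho)); split; first exact: Rmin_pos.
move=> t tb; have [R1 R2] := (Rmin_l r (/ rho), Rmin_r r (/ rho)).
have tr : Rabs (t - b) < r by lra.
have hrho : Rabs (t - b) < / rho by lra.
have Hk k : (k <= d)%N -> is_pseries (PS_mult (P k) (PS_derive_n k a)) (t - b)
    (p k t * Derive_n (fun t => PSeries a (t - b)) k t).
  move=> kd; rewrite D Derive_n_PSeries; last exact: rad.
  have ra : Rbar_lt (Rabs (t - b)) (CV_radius (PS_derive_n k a)).
    by rewrite CV_radius_derive_n; exact: rad.
  apply: is_pseries_mult => //.
  - exact: Hp.
  - by apply: PSeries_correct; exact: CV_radius_inside.
  - apply: (@pseries_radius (P k) r (fun h => p k (h + b))) => // h hr.
    have hb : h + b - b = h by ring.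
    by have := Hp k (h + b) kd; rewrite hb; apply.
(* The coefficients of this sum of Cauchy products are convertible to [ode_coef P d a n], which is
   0. *)
rewrite -(is_pseries_unique _ _ _ (is_pseries_sum Hk)).
by rewrite (PSeries_ext _ (fun=> 0)) ?PSeries_const_0 // => n; exact: Hode.
Qed.

(** * Uniqueness of solutions *)

Lemma nondecreasing_off_finite (E : seq R) (F : R -> R) (x y : R) : x < y ->
  (forall t, x <= t <= y -> continuous F t) ->
  (forall t, x < t < y -> t \notin E -> exists l, 0 <= l /\ is_derive F t l) ->
  F x <= F y.
Proof.
elim: E x y => [|e E IHE] x y xy ctF dF.
  (* The mean value theorem may return an end of the interval, where nothing is known about the
     derivative; [df] is set to 0 there. *)
  pose df t := if Rlt_dec x t then if Rlt_dec t y then Derive F t else 0 else 0.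
  have df0 t : 0 <= df t.
    rewrite /df; case: Rlt_dec => xt /=; last lra; case: Rlt_dec => ty /=; last lra.
    by have [l [l0 H]] := dF t (conj xt ty) isT; rewrite (is_derive_unique _ _ _ H).
  have [||t [_ FE]] := @MVT_gen F x y df.
  - rewrite Rmin_left ?Rmax_right; try lra; move=> t [xt ty].
    rewrite /df; case: Rlt_dec => //= _; case: Rlt_dec => //= _.
    have [l [_ H]] := dF t (conj xt ty) isT.
    by apply: Derive_correct; exists l.
  - rewrite Rmin_left ?Rmax_right; try lra.
    by move=> t /ctF; rewrite continuity_pt_filterlim.
  have := Rmult_le_pos _ _ (df0 t) (ltac:(lra) : 0 <= y - x); lra.
have [ex|ex] := Rle_lt_dec e x.
  apply: IHE => // t txy tE; apply: dF => //; rewrite inE negb_or tE andbT.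
  by apply/eqP; lra.
have [ey|ey] := Rle_lt_dec y e.
  apply: IHE => // t txy tE; apply: dF => //; rewrite inE negb_or tE andbT.
  by apply/eqP; lra.
apply: (Rle_trans _ (F e)); apply: IHE => // t txy; try (apply: ctF; lra).
  by move=> tE; apply: dF; [lra|rewrite inE negb_or tE andbT; apply/eqP; lra].
by move=> tE; apply: dF; [lra|rewrite inE negb_or tE andbT; apply/eqP; lra].
Qed.

Lemma nondecreasing_within (E : seq R) (F : R -> R) (b c : R) : b < c ->
  (forall t, segment b c t -> continuous_within (segment b c) F t) ->
  (forall t, b < t < c -> t \notin E -> exists l, 0 <= l /\ is_derive F t l) ->
  F b <= F c.
Proof.
move=> bc ctF dF; apply: Rnot_lt_le => cb.
have e0 : 0 < (F b - F c) / 3 by lra.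
have [d1 [d10 H1]] := (continuous_withinP _ _ _).1 (ctF b (ltac:(split; lra))) _ e0.
have [d2 [d20 H2]] := (continuous_withinP _ _ _).1 (ctF c (ltac:(split; lra))) _ e0.
(* Dividing by 3 keeps b + h < c - h. Moving inwards by [h] makes [F] continuous in the usual sense
   and loses less than a third of the gap F b - F c at each end. *)
pose h := Rmin (Rmin d1 d2) (c - b) / 3.
have [m1 m2] := (Rmin_l (Rmin d1 d2) (c - b), Rmin_r (Rmin d1 d2) (c - b)).
have [m3 m4] := (Rmin_l d1 d2, Rmin_r d1 d2).
have h0 : 0 < h by apply: Rdiv_lt_0_compat; [apply: Rmin_pos; [exact: Rmin_pos|lra]|lra].
have hh : 3 * h = Rmin (Rmin d1 d2) (c - b) by rewrite /h; field.
have /Rabs_def2 := H1 (b + h) (ltac:(rewrite Rabs_right; lra)) (ltac:(split; lra)).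
have /Rabs_def2 := H2 (c - h) (ltac:(rewrite Rabs_left; lra)) (ltac:(split; lra)).
have : F (b + h) <= F (c - h); last lra.
apply: (@nondecreasing_off_finite E) => [|t ht|t ht tE]; try lra; last by apply: dF => //; lra.
move=> P /locally_Rabs [e [e0' He]].
have [d [d0 Hd]] := (continuous_withinP _ _ _).1 (ctF t (ltac:(split; lra))) _ e0'.
apply/locally_Rabs; exists (Rmin d h); split; first exact: Rmin_pos.
have [k1 k2] := (Rmin_l d h, Rmin_r d h).
by move=> y yt; apply: He; apply: Hd; [|move: yt => /Rabs_def2; split]; lra.
Qed.

Lemma continuous_within_plus (D : R -> Prop) (f g : R -> R) (x : R) :
  continuous_within D f x -> continuous_within D g x ->
  continuous_within D (fun t => f t + g t) x.
Proof.
move=> Hf Hg; apply: (filterlim_comp_2 f g Rplus) Hf Hg _.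
exact: (filterlim_plus (f x) (g x)).
Qed.

Lemma continuous_within_mult (D : R -> Prop) (f g : R -> R) (x : R) :
  continuous_within D f x -> continuous_within D g x ->
  continuous_within D (fun t => f t * g t) x.
Proof.
move=> Hf Hg; apply: (filterlim_comp_2 f g Rmult) Hf Hg _.
exact: (filterlim_mult (f x) (g x)).
Qed.

Lemma continuous_within_sum_f_R0 (D : R -> Prop) (F : nat -> R -> R) (d : nat)
    (x : R) : (forall k, (k <= d)%N -> continuous_within D (F k) x) ->
  continuous_within D (fun t => sum_f_R0 (F^~ t) d) x.
Proof.
elim: d => [|d IHd] H; first exact: (H 0%N).
by apply: continuous_within_plus; [apply: IHd => k kd; apply: H; exact: leqW|exact: H].
Qed.

Lemma is_derive_sum_f_R0 (F : nat -> R -> R) (dF : nat -> R) (d : nat) (x : R) :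
  (forall k, (k <= d)%N -> is_derive (F k) x (dF k)) ->
  is_derive (fun t => sum_f_R0 (F^~ t) d) x (sum_f_R0 dF d).
Proof.
elim: d => [|d IHd] H; first exact: (H 0%N).
apply: (@is_derive_plus _ _ (fun t => sum_f_R0 (F^~ t) d) (F d.+1)); last exact: H.
by apply: IHd => k kd; apply: H; exact: leqW.
Qed.

Lemma sum_f_R0_ge (f : nat -> R) (d k : nat) : (forall i, 0 <= f i) ->
  (k <= d)%N -> f k <= sum_f_R0 f d.
Proof.
move=> f0; elim: d => [|d IHd]; first by rewrite leqn0 => /eqP->; exact: Rle_refl.
rewrite leq_eqVlt => /orP[/eqP->|kd] /=.
  by have := cond_pos_sum f d f0; lra.
by have := IHd kd; have := f0 d.+1; lra.
Qed.

(* Gronwall's argument for the energy [sum_(k <= d) v_k^2]. *)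
Lemma linear_ode_unique (d : nat) (v : nat -> R -> R) (b c C : R) (E : seq R) :
  b < c -> 0 <= C ->
  (forall k t, (k <= d)%N -> segment b c t -> continuous_within (segment b c) (v k) t) ->
  (forall t, b < t < c -> t \notin E ->
    (forall k, (k <= d)%N -> is_derive (v k) t (v k.+1 t)) /\
    Rabs (v d.+1 t) <= C * sum_f_R0 (fun k => Rabs (v k t)) d) ->
  (forall k, (k <= d)%N -> v k c = 0) -> forall k, (k <= d)%N -> v k b = 0.
Proof.
move=> bc C0 ctv Hv vc.
pose e t := sum_f_R0 (fun k => v k t * v k t) d.
have e_ge k t : (k <= d)%N -> v k t * v k t <= e t.
  by move=> kd; apply: (sum_f_R0_ge (f := fun k => v k t * v k t)) => // i; nra.
have e0 t : 0 <= e t by apply: cond_pos_sum => k; nra.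
(* [M] is chosen so that |v_k| <= M sqrt(e) for all k <= d + 1, and [K] below so that e' >= - K e.
   Hence e exp(K t) is non-decreasing, and its zero at [c] forces one at [b]. *)
pose M := 1 + C * INR d.+1.
have dS := pos_INR d.+1.
have CS : 0 <= C * INR d.+1 by exact: Rmult_le_pos.
pose K := 2 * (M * M) * INR d.+1.
have key : e b * exp (K * b) <= e c * exp (K * c).
  apply: (@nondecreasing_within E (fun t => e t * exp (K * t))) => // [t st|t bt tE].
    apply: continuous_within_mult.
      apply: (@continuous_within_sum_f_R0 _ (fun k t => v k t * v k t)) => k kd.
      by apply: continuous_within_mult; exact: ctv.
    apply: continuous_within_continuous; apply: ex_derive_continuous.
    by auto_derive.
  have [dv vd] := Hv t bt tE.
  have de : is_derive e t (sum_f_R0 (fun k => 2 * (v k t * v k.+1 t)) d).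
    apply: (@is_derive_sum_f_R0 (fun k t => v k t * v k t)) => k kd.
    have -> : 2 * (v k t * v k.+1 t) = v k.+1 t * v k t + v k t * v k.+1 t by ring.
    by apply: (@is_derive_mult _ (v k) (v k)); try exact: dv; exact: Rmult_comm.
  have dexp : is_derive (fun t => exp (K * t)) t (K * exp (K * t)).
    by auto_derive=> //; ring.
  have ep := exp_pos (K * t).
  exists (sum_f_R0 (fun k => 2 * (v k t * v k.+1 t)) d * exp (K * t) + e t * (K * exp (K * t))).
  split; last by apply: (@is_derive_mult _ e (fun t => exp (K * t))) => //; exact: Rmult_comm.
  suff : - (K * e t) <= sum_f_R0 (fun k => 2 * (v k t * v k.+1 t)) d by nra.
  pose s := sqrt (e t).
  have ss : s * s = e t by exact: sqrt_sqrt.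
  have s0 : 0 <= s by exact: sqrt_pos.
  have v_le k : (k <= d)%N -> Rabs (v k t) <= s.
    move=> kd; rewrite -(Rabs_right s); last lra.
    by apply: Rsqr_le_abs_0; rewrite /Rsqr ss; exact: e_ge.
  have v_leM k : (k <= d.+1)%N -> Rabs (v k t) <= M * s.
    rewrite leq_eqVlt => /orP[/eqP->|kd].
      apply: Rle_trans vd _; apply: (@Rle_trans _ (C * (s * INR d.+1))).
        apply: Rmult_le_compat_l => //; rewrite -sum_cte.
        by apply: sum_Rle => i /leP; exact: v_le.
      by rewrite /M; nra.
    by have := v_le k kd; rewrite /M; nra.
  have -> : - (K * e t) = (- 2 * (M * s) * (M * s)) * INR d.+1.
    by rewrite -ss /K; ring.
  rewrite -sum_cte; apply: sum_Rle => k /leP kd.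
  have := v_leM k (leqW kd); have := v_leM k.+1 kd.
  have := Rabs_pos (v k t); have := Rabs_pos (v k.+1 t) => p1 p2 q1 q2.
  have : Rabs (v k t * v k.+1 t) <= (M * s) * (M * s).
    by rewrite Rabs_mult; apply: Rmult_le_compat.
  by have := Rabs_maj2 (v k t * v k.+1 t); lra.
have ec : e c = 0.
  by apply: sum_f_R0_eq0 => k kd; rewrite vc // Rmult_0_l.
rewrite ec Rmult_0_l in key.
have eb : e b = 0 by have := exp_pos (K * b); have := e0 b; nra.
by move=> k kd; have := e_ge k b kd; rewrite eb; nra.
Qed.

(** * Equations with meromorphic coefficients *)

Lemma common_denominator (f : nat -> mero) (N : nat) :
  exists (P : anfun) (p : nat -> anfun), (P != 0)%R /\
    forall k, (k < N)%N -> (mero_of (p k) = f k * mero_of P)%R.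
Proof.
elim: N => [|N [P [p [P0 Hp]]]].
  by exists 1%R, (fun=> 0%R); split; [exact: oner_neq0|].
have f0 := mero_den_neq0 (f N).
exists (P * mero_den (f N))%R, (fun k => if k == N then mero_num (f N) * P
  else p k * mero_den (f N))%R; split; first by rewrite mulf_neq0.
move=> k; rewrite ltnS leq_eqVlt => /orP[/eqP->|kN]; last first.
  by rewrite ltn_eqF // !rmorphM /= Hp // mulrA.
rewrite eqxx !rmorphM /= {2}(mero_numden (f N)) mulrCA.
by rewrite divfK ?mero_of_eq0 // mulrC.
Qed.

(** Clearing denominators gives analytic coefficients, and at a generic point the leading one is
    non-zero, as the power series solution requires. *)
Lemma mero_ode_solution (r : skewpoly) (d : nat) :
  size (skew_poly r) = d.+2 -> generically (fun b => exists y : R -> R,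
    [/\ smooth_at y b, y b = 1 & locally b (fun t => op r y t = 0)]).
Proof.
move=> hs; have [P [p [P0 Hp]]] := common_denominator (fun k => (skew_poly r)`_k)%R d.+2.
have pd0 : (p d.+1 != 0)%R.
  rewrite -mero_of_eq0 Hp // mulf_neq0 ?mero_of_eq0 //.
  have -> : d.+1 = (size (skew_poly r)).-1 by rewrite hs.
  by rewrite -[X in X != _]/(lead_coef _) lead_coef_eq0 -size_poly_eq0 hs.
have H (k : 'I_d.+2) : generically (fun t =>
    P t <> 0 /\ mero_eval ((skew_poly r)`_k)%R t = p k t / P t).
  by apply: (@mero_evalE _ (p k) P) => //; rewrite Hp // mulfK ?mero_of_eq0.
have := generically_and (anfun_gen pd0) (generically_locally (generically_all H)).
apply: generically_imp => b [pb {}H].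
have [y [sy y1 yode]] := @analytic_ode_solution p b d.+1 isT pb.
exists y; split=> //; apply: filter_imp (filter_and _ _ H yode) => t [{}H].
rewrite sum_f_R0E big_mkord => yt.
rewrite /op (@jet_op_wide d.+2) ?hs //.
have [Pt _] := H ord0.
have -> : (\sum_(k < d.+2) mero_eval (skew_poly r)`_k t * Derive_n y k t)%R =
    (/ P t * \sum_(k < d.+2) p k t * Derive_n y k t)%R.
  rewrite mulr_sumr; apply: eq_bigr => k _; rewrite (H k).2.
  have E (x z w : R) : x / z * w = / z * (x * w) by rewrite /Rdiv; ring.
  exact: E.
by rewrite yt; exact: mulr0.
Qed.

(** * Observations of a section *)

Lemma size_skew_mulD (b : {poly mero}) : (size (skew_mulD b) <= (size b).+1)%N.
Proof.
apply: leq_trans (size_polyD _ _) _; rewrite geq_max; apply/andP; split.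
  by apply: leq_trans (size_polyMleq _ _) _; rewrite size_polyX addn2.
by apply: leq_trans (size_poly _ _) _; exact: leqnSn.
Qed.

Lemma size_iter_mulD (b : {poly mero}) (k : nat) :
  (size (iter k skew_mulD b) <= size b + k)%N.
Proof.
elim: k => [|k IHk]; first by rewrite addn0.
by apply: leq_trans (size_skew_mulD _) _; rewrite addnS ltnS.
Qed.

Lemma continuous_within_sum (D : R -> Prop) (n : nat) (F : 'I_n -> R -> R) (x : R) :
  (forall i, continuous_within D (F i) x) ->
  continuous_within D (fun t => (\sum_(i < n) F i t)%R) x.
Proof.
move=> H; elim: n F H => [|n IHn] F H.
  have -> : (fun t => \sum_(i < 0) F i t)%R = (fun=> 0).
    by apply: funext => t; rewrite big_ord0.
  by apply: continuous_within_continuous; exact: continuous_const.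
have -> : (fun t => \sum_(i < n.+1) F i t)%R = (fun t =>
    (\sum_(i < n) F (widen_ord (leqnSn n) i) t)%R + F ord_max t).
  by apply: funext => t; rewrite big_ord_recr.
by apply: continuous_within_plus => //; exact: IHn.
Qed.

Lemma is_derive_sum (n : nat) (F : 'I_n -> R -> R) (dF : 'I_n -> R) (t : R) :
  (forall i, is_derive (F i) t (dF i)) ->
  is_derive (fun t => (\sum_(i < n) F i t)%R) t (\sum_(i < n) dF i)%R.
Proof.
move=> H; have -> : (\sum_(i < n) dF i)%R = (\sum_(i < n) Derive (F i) t)%R.
  by apply: eq_bigr => i _; rewrite (is_derive_unique _ _ _ (H i)).
by apply: Derive_sum => i; exists (dF i).
Qed.

Lemma continuous_bounded (b c : R) (f : R -> R) : b < c ->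
  (forall t, segment b c t -> continuous f t) ->
  exists C, 0 <= C /\ forall t, segment b c t -> Rabs (f t) <= C.
Proof.
move=> bc ctf.
have [x0 [Hx0 _]] := continuity_ab_maj (fun t => Rabs (f t)) b c (Rlt_le _ _ bc)
  (fun t st => continuity_pt_comp _ _ _ ((continuity_pt_filterlim f t).2 (ctf t st))
    (Rcontinuity_abs _)).
by exists (Rabs (f x0)); split; [exact: Rabs_pos|].
Qed.

Lemma continuous_bounded_all (b c : R) (f : nat -> R -> R) (d : nat) : b < c ->
  (forall k t, (k <= d)%N -> segment b c t -> continuous (f k) t) ->
  exists C, 0 <= C /\ forall k t, (k <= d)%N -> segment b c t -> Rabs (f k t) <= C.
Proof.
move=> bc ctf; elim: d ctf => [|d IHd] ctf.
  have [C [C0 HC]] := continuous_bounded bc (fun t => ctf 0%N t isT).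
  by exists C; split=> // k t; rewrite leqn0 => /eqP->; exact: HC.
have [C1 [C10 HC1]] := IHd (fun k t kd => ctf k t (leqW kd)).
have [C2 [C20 HC2]] := continuous_bounded bc (fun t => ctf d.+1 t (leqnn _)).
have [m1 m2] := (Rmax_l C1 C2, Rmax_r C1 C2).
exists (Rmax C1 C2); split; first lra.
move=> k t; rewrite leq_eqVlt => /orP[/eqP->|kd] st.
  by have := HC2 t st; lra.
by have := HC1 k t kd st; lra.
Qed.

(** Covers every order, also above the regularity of the section: the equation of order d + 1 for an
    observation involves one derivative more than the bound on [L] makes continuous. *)
Lemma derive_within_n_interior (b c x y : R) (f F : R -> R) (l : nat) :
  b <= x -> y <= c -> (forall u, x < u < y -> f u = F u) ->
  (forall u, smooth_at F u) ->
  forall u, x < u < y -> derive_within_n (segment b c) l f u = Derive_n F l u.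
Proof.
move=> bx yc fF sF; elim: l => [|l IHl] u [xu uy]; first by rewrite /= fF.
apply: derive_withinE; first by apply: segment_limit_point; [|split]; lra.
apply: is_derive_within_is_derive.
apply: (is_derive_ext_loc (Derive_n F l)); last exact: smooth_at_is_derive.
apply: filter_imp (filter_and _ _ (open_gt _ u xu) (open_lt _ u uy)) => v [xv vy].
by rewrite -IHl.
Qed.

Lemma section_interior (L : regularity) (m n : nat) (A : 'M[skewpoly]_(m, n))
    (b c : R) (g : 'I_n -> R -> R) : b < c -> reg_ge L 0 -> section L A b c g ->
  exists E : seq R, forall t, b < t < c -> t \notin E ->
    exists F : 'I_n -> R -> R, [/\ forall j u, smooth_at (F j) u,
      locally t (fun u => forall j l,
        derive_within_n (segment b c) l (C_rep L b c (g j)) u = Derive_n (F j) l u) &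
      locally t (fun u => forall i, diff_op A F i u = 0)].
Proof.
move=> bc L0 Sg; have [E1 HE1] := section_pieces Sg.
have [Hg HA] := Sg.
have gC j : in_C L b c (g j) by have [] := Hg j.
have [E2 HE2] : exists E : seq R, forall j t, t \notin E -> segment b c t ->
    g j t = C_rep L b c (g j) t.
  apply: exceptions_all => j; have [[E HE] _] := C_repP (gC j).
  by exists E => t tE st; exact: HE.
have [E3 HE3] : exists E : seq R, forall i t, t \notin E -> segment b c t ->
    diff_op A g i t = 0.
  apply: exceptions_all => i; have [E HE] := HA i.
  by exists E => t tE st; exact: HE.
exists (E1 ++ E2 ++ E3) => t bt tE; have [e [e0 He]] := notin_locally tE.
pose h := Rmin e (Rmin (t - b) (c - t)) / 2.
have [m1 m2] := (Rmin_l e (Rmin (t - b) (c - t)), Rmin_r e (Rmin (t - b) (c - t))).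
have [m3 m4] := (Rmin_l (t - b) (c - t), Rmin_r (t - b) (c - t)).
have h0 : 0 < h.
  by apply: Rdiv_lt_0_compat; [apply: Rmin_pos; [|apply: Rmin_pos; lra]|lra].
have hE : 2 * h = Rmin e (Rmin (t - b) (c - t)) by rewrite /h; field.
have near u : t - h < u < t + h -> [/\ u \notin E1, u \notin E2 & u \notin E3].
  move=> ut; have := He u (ltac:(apply: Rabs_def1; lra)).
  by rewrite !mem_cat !negb_or => /and3P[].
have [bx [xy yc]] : b <= t - h /\ t - h < t + h /\ t + h <= c by lra.
have [|F [sF gF]] := HE1 _ _ bx xy yc; first by move=> u /near [].
have cF j u : t - h < u < t + h -> C_rep L b c (g j) u = F j u.
  move=> ut; apply: (C_on_eq_smooth bx xy yc (C_repP (gC j)).2 L0) => //; last by split; lra.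
  by apply: pw_eq_trans (gF j); apply: pw_eq_sub (pw_eq_sym (C_repP (gC j)).1).
have nb : locally t (fun u => t - h < u < t + h).
  apply/locally_Rabs; exists h; split=> // u /Rabs_def2; lra.
exists F; split=> //.
  apply: filter_imp nb => u ut j l.
  by apply: (@derive_within_n_interior b c (t - h) (t + h)) => // v; exact: cF.
apply: filter_imp (locally_locally _ _ nb) => u ut i.
have ut' := locally_singleton _ _ ut; have [_ _ uE3] := near u ut'.
rewrite -(HE3 i u uE3); last by split; lra.
apply: diff_op_ext_loc => j; apply: filter_imp ut => v vt.
have [_ vE2 _] := near v vt; rewrite HE2 //; last by split; lra.
by rewrite cF.
Qed.

(** Formed from relative derivatives of the representative instead of by [diff_op], so that its
    values at [b] and [c] are functions of the restrictions of [g] to these points as long as the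
    orders stay within [L]. *)
Definition observation (L : regularity) (n : nat) (b c : R) (g : 'I_n -> R -> R)
    (row : 'I_n -> skewpoly) (t : R) : R :=
  (\sum_(j < n) jet_op (row j)
    (fun l => derive_within_n (segment b c) l (C_rep L b c (g j)) t) t)%R.

Lemma jet_op_eq (a : skewpoly) (u v : nat -> R) (t : R) :
  (forall l, (l < size (skew_poly a))%N -> u l = v l) -> jet_op a u t = jet_op a v t.
Proof. by move=> uv; apply: eq_bigr => l _; rewrite uv. Qed.

(* If [r] composed with the observation [v = row(d/dt) w] is a consequence of
   [A(d/dt) w = 0], then [v] solves the equation [r v = 0], of order [d + 1].
   The regularity of [w] makes the derivatives of [v] of order at most [d]
   continuous, so that [v] is determined by the jet of [w] at one point. *)
Lemma observation_vanishes (L : regularity) (m n : nat) (A : 'M[skewpoly]_(m, n))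
    (row : 'I_n -> skewpoly) (T : 'rV[skewpoly]_m) (r : skewpoly) (d K : nat) :
  size (skew_poly r) = d.+2 -> (forall j, size (skew_poly (row j)) <= K.+1)%N ->
  (forall j, (r * row j)%R = (T *m A)%R ord0 j) -> reg_ge L (K + d)%N ->
  exists q : anfun, (q != 0)%R /\ forall (b c : R) (g : 'I_n -> R -> R), b < c ->
    (forall t, segment b c t -> q t <> 0) -> section L A b c g ->
    (forall j l, reg_ge L l%:Z ->
       derive_within_n (segment b c) l (C_rep L b c (g j)) c = 0) ->
    observation L b c g row b = 0.
Proof.
move=> hs hrow hT LK.
pose D k j : skewpoly := iter k skew_mulD (row j).
have G1 (k : 'I_d.+1) := generically_all (fun j => is_derive_op (D k j)).
have G2 := generically_all (fun j => jet_op_mul r (row j)).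
have G3 := diff_op_mul T A.
have G4 (k : 'I_d.+2) := mero_eval_smooth ((skew_poly r)`_k)%R.
have G5 (k : 'I_d.+1) := generically_all (fun j => generically_all
  (fun l : 'I_(size (skew_poly (D k j))) => mero_eval_smooth ((skew_poly (D k j))`_l)%R)).
have r0 : ((skew_poly r)`_d.+1 != 0)%R.
  have -> : d.+1 = (size (skew_poly r)).-1 by rewrite hs.
  by rewrite -[X in X != _]/(lead_coef _) lead_coef_eq0 -size_poly_eq0 hs.
have n0 : (mero_num (skew_poly r)`_d.+1 != 0)%R.
  apply: contraNneq r0 => n0; rewrite (mero_numden (skew_poly r)`_d.+1)%R n0.
  by rewrite rmorph0 mul0r.
(* [q] vanishes at the exceptional points of all operators involved, and at the zeros of the
   numerator and denominator of the leading coefficient of [r]. *)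
have [q [q0 Hq]] := generically_and (generically_all G1) (generically_and G2
  (generically_and G3 (generically_and (generically_all G4) (generically_and
  (generically_all G5) (generically_and (anfun_gen n0)
  (anfun_gen (mero_den_neq0 ((skew_poly r)`_d.+1)%R))))))).
exists q; split=> // b c g bc qbc Sg gc.
have rd0 t : segment b c t -> mero_eval ((skew_poly r)`_d.+1)%R t <> 0.
  move=> /qbc /Hq [_ [_ [_ [_ [_ [nt dt]]]]]].
  by apply: Rmult_integral_contrapositive; split=> //; exact: Rinv_neq_0_compat.
have sr k t : (k <= d.+1)%N -> segment b c t ->
    smooth_at (mero_eval ((skew_poly r)`_k)%R) t.
  move=> kd /qbc /Hq [_ [_ [_ [H _]]]].
  by exact: (H (Ordinal (kd : (k < d.+2)%N))).
(* [D k] is D^k times the row, so [v k] plays the part of the [k]-th derivative of the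
   observation. *)
pose v k t := observation L b c g (D k) t.
have gC j : in_C L b c (g j) by case: Sg => Hg _; have [] := Hg j.
(* The bound on [L] enters here: for k <= d no derivative of order above K + d occurs. *)
have sD k j : (k <= d)%N -> (size (skew_poly (D k j)) <= (K + d).+1)%N.
  move=> kd; apply: leq_trans (size_iter_mulD _ _) _.
  by rewrite -addSn; exact: (leq_add (hrow j) kd).
have Ll k j l : (k <= d)%N -> (l < size (skew_poly (D k j)))%N -> reg_ge L l%:Z.
  move=> kd lD; apply: reg_ge_leq LK; rewrite -ltnS.
  exact: leq_trans lD (sD k j kd).
have L0 : reg_ge L 0 by exact: reg_ge_leq LK.
(* The coefficients of the monic equation, which expresses [v d.+1] through the lower [v k] with
   bounded factors. *)
pose c_ k t := mero_eval ((skew_poly r)`_k)%R t / mero_eval ((skew_poly r)`_d.+1)%R t.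
have ctc k t : (k <= d)%N -> segment b c t -> continuous (c_ k) t.
  move=> kd st; apply: (@smooth_at_continuous (c_ k) t 0).
  apply: smooth_at_mult; first by apply: sr => //; exact: leqW.
  by apply: smooth_at_inv; [exact: sr|exact: rd0].
have [C [C0 HC]] := continuous_bounded_all bc ctc.
have [E HE] := section_interior bc L0 Sg.
apply: (@linear_ode_unique d v b c C E bc C0 _ _ _ 0%N) => //.
- move=> k t kd st; apply: continuous_within_sum => j; apply: continuous_within_sum => l.
  apply: continuous_within_mult.
    have [_ [_ [_ [_ [H _]]]]] := Hq t (qbc t st).
    apply: continuous_within_continuous; apply: (@smooth_at_continuous _ t 0).
    exact: (H (Ordinal (kd : (k < d.+1)%N)) j l).
  by apply: ((C_repP (gC j)).2).2 => //; exact: (Ll k j).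
- move=> t bt tE; have [F [sF gF AF]] := HE t bt tE.
  have st : segment b c t by split; lra.
  have [H1 [H2 [H3 _]]] := Hq t (qbc t st).
  have vF k u : (forall j l,
      derive_within_n (segment b c) l (C_rep L b c (g j)) u = Derive_n (F j) l u) ->
      v k u = (\sum_(j < n) op (D k j) (F j) u)%R.
    by move=> Hu; apply: eq_bigr => j _; apply: jet_op_eq.
  have vt k := vF k t (locally_singleton _ _ gF).
  split.
    move=> k kd; apply: (is_derive_ext_loc (fun u => (\sum_(j < n) op (D k j) (F j) u)%R)).
      by apply: filter_imp gF => u Hu; rewrite vF.
    rewrite vt; apply: is_derive_sum => j.
    exact: (H1 (Ordinal (kd : (k < d.+1)%N)) j (F j) (sF j t)).
  (* The sum is r times the row applied to F, that is, T (A F), and A F vanishes near [t]. *)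
  have : sum_f_R0 (fun k => mero_eval ((skew_poly r)`_k)%R t * v k t) d.+1 = 0.
    have <- : diff_op (T *m A)%R F ord0 t = 0.
      rewrite H3; last by move=> j; exact: sF.
      apply: diff_op0 => i; exact: filter_imp AF.
    rewrite sum_f_R0E diff_opE.
    have -> : (\sum_(j < n) op ((T *m A)%R ord0 j) (F j) t)%R = (\sum_(j < n)
        \sum_(0 <= k < d.+2) mero_eval (skew_poly r)`_k t * op (D k j) (F j) t)%R.
      apply: eq_bigr => j _; rewrite -hT [LHS]H2.
      by rewrite -(big_mkord xpredT (fun k => mero_eval (skew_poly r)`_k t *
        jet_op (D k j) (fun l => Derive_n (F j) l t) t)%R) hs.
    rewrite exchange_big /=; apply: eq_bigr => k _.
    by rewrite -mulr_sumr vt.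
  have rt := rd0 t st; rewrite /= => eq0.
  have -> : v d.+1 t = - sum_f_R0 (fun k => c_ k t * v k t) d.
    have -> : sum_f_R0 (fun k => c_ k t * v k t) d = / mero_eval ((skew_poly r)`_d.+1)%R t *
        sum_f_R0 (fun k => mero_eval ((skew_poly r)`_k)%R t * v k t) d.
      rewrite scal_sum; apply: PartSum.sum_eq => k _.
      by rewrite /c_ /Rdiv; ring.
    apply: (Rmult_eq_reg_l (mero_eval ((skew_poly r)`_d.+1)%R t)) => //.
    rewrite -Ropp_mult_distr_r -Rmult_assoc Rinv_r // Rmult_1_l.
    have E1 (x y : R) : x + y = 0 -> y = - x by lra.
    exact: E1.
  rewrite Rabs_Ropp; apply: Rle_trans (Rsum_abs _ _) _.
  rewrite scal_sum; apply: sum_Rle => k /leP kd.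
  rewrite Rabs_mult Rmult_comm; apply: Rmult_le_compat_l; first exact: Rabs_pos.
  exact: HC.
- move=> k kd; rewrite /v /observation big1 // => j _; rewrite /jet_op big1 // => l _.
  by rewrite gc ?mulr0 //; exact: (Ll k j).
Qed.

(** * The factorization *)

Local Open Scope ring_scope.

Lemma row_tn_middle (m n : nat) (r : skewpoly) (W : 'M[skewpoly]_n) (i : 'I_m)
    (j : 'I_n) : val i = val j -> i.+1 = m ->
  row i (tn_middle m n r *m W) = \row_k (r * W j k).
Proof.
move=> ij im; apply/rowP => k; rewrite !mxE (bigD1 j) //= big1 => [|l lj].
  by rewrite addr0 mxE im ij !eqxx.
rewrite mxE; case: eqP => [il|_]; last by rewrite mul0r.
by case/eqP: lj; apply: val_inj; rewrite /= -ij.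
Qed.

(** If n < m, the middle matrix has a zero row at index [n]; the row of [U] with this index is then
    a non-zero left annihilator of [A]. *)
Lemma tn_factorization_leq (m n : nat) (A : 'M[skewpoly]_(m, n))
    (U : 'M[skewpoly]_m) (r : skewpoly) (V : 'M[skewpoly]_n) :
  full_row_rank A -> tn_factorization A U r V -> (m <= n)%N.
Proof.
move=> frr [uU _ _ AE]; rewrite leqNgt; apply/negP => nm.
have [UUi UiU] := skew_invmxP uU.
have x0 : delta_mx ord0 (Ordinal nm) *m U = 0 :> 'rV[skewpoly]_m.
  apply: frr; rewrite AE !mulmxA -(mulmxA _ U) UUi mulmx1.
  suff -> : delta_mx ord0 (Ordinal nm) *m tn_middle m n r = 0 :> 'rV[skewpoly]_n.
    by rewrite mul0mx.
  apply/rowP => j; rewrite -rowE !mxE /=.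
  by case: eqP => // nj; have := ltn_ord j; rewrite -nj ltnn.
have : delta_mx ord0 (Ordinal nm) = 0 :> 'rV[skewpoly]_m.
  by rewrite -[LHS]mulmx1 -UUi mulmxA x0 mul0mx.
by move/rowP/(_ (Ordinal nm))/eqP; rewrite !mxE !eqxx oner_eq0.
Qed.

Lemma skew_deg0_inv (r : skewpoly) : r != 0 -> skew_deg r = 0%N ->
  exists s : skewpoly, r * s = 1.
Proof.
rewrite -[r != 0]/(skew_poly r != 0) -size_poly_gt0 /skew_deg => r0 d0.
have r1 : size (skew_poly r) = 1%N by rewrite -(prednK r0) d0.
have [c c0 rE] : exists2 c, c != 0 & skew_poly r = c%:P.
  by move: r1 => /eqP/size_poly1P.
exists ((c^-1)%:P : {poly mero}).
rewrite -[LHS]/(skew_mul r (c^-1)%:P) (@skew_mul_wide 1) ?r1 // big_ord1 /=.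
by rewrite rE coefC eqxx -mul_polyC -polyCM divff.
Qed.

Lemma tn_middle_right_inverse (m n : nat) (r s : skewpoly) : (m <= n)%N ->
  r * s = 1 -> tn_middle m n r *m (\matrix_(j < n, i < m)
    (if val j == val i then (if i.+1 == m then s else 1) else 0)) = 1%:M.
Proof.
move=> mn rs; apply/matrixP => i k; rewrite !mxE.
rewrite (bigD1 (widen_ord mn i)) //= big1 => [|l li].
  rewrite addr0 !mxE /= eqxx; case: (altP (i =P k)) => [<-|ik].
    by rewrite eqxx; case: ifP => _; rewrite ?mul1r.
  by rewrite (negbTE (_ : val i != val k)) ?mulr0.
rewrite [tn_middle _ _ _ _ _]mxE; case: eqP => [il|_]; last by rewrite mul0r.
by case/eqP: li; apply: val_inj.
Qed.

Lemma tn_deg0_right_invertible (m n : nat) (A : 'M[skewpoly]_(m, n))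
    (U : 'M[skewpoly]_m) (r : skewpoly) (V : 'M[skewpoly]_n) :
  (m <= n)%N -> tn_factorization A U r V -> skew_deg r = 0%N ->
  right_invertible A.
Proof.
move=> mn [uU uV r0 AE] d0; have [s rs] := skew_deg0_inv r0 d0.
have [UUi UiU] := skew_invmxP uU; have [VW WV] := skew_invmxP uV.
have := tn_middle_right_inverse mn rs; set S := (\matrix_(_, _) _) => HS.
exists (V *m S *m U); rewrite AE !mulmxA -(mulmxA _ (skew_invmx V)) WV mulmx1.
by rewrite -(mulmxA _ _ S) HS mulmx1.
Qed.

Lemma leq_mx_deg (m n : nat) (A : 'M[skewpoly]_(m, n)) (i : 'I_m) (j : 'I_n) :
  (size (skew_poly (A i j)) <= (mx_deg A).+1)%N.
Proof.
apply: leq_trans (leqSpred _) _; rewrite ltnS /mx_deg.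
apply: leq_trans (leq_bigmax i).
exact: (leq_bigmax (F := fun j => skew_deg (A i j)) j).
Qed.

Local Open Scope R_scope.

(** * Necessity of right invertibility *)

Lemma restr_point_jet (L : regularity) (n : nat) (a b b' c t : R)
    (f g : 'I_n -> R -> R) :
  restr_point L a b f t = restr_point L b' c g t ->
  forall j l, reg_ge L l%:Z ->
    derive_within_n (segment a b) l (C_rep L a b (f j)) t =
    derive_within_n (segment b' c) l (C_rep L b' c (g j)) t.
Proof.
move=> E j l Ll.
have := congr1 (fun x : point_section L n => x.2 (exist _ l Ll) j ord0) E.
by rewrite !mxE.
Qed.

Lemma smooth_section_jet (L : regularity) (a b : R) (f : R -> R) (l : nat) :
  a < b -> (forall t, segment a b t -> smooth_at f t) -> reg_ge L l%:Z ->
  forall t, segment a b t ->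
    derive_within_n (segment a b) l (C_rep L a b f) t = Derive_n f l t.
Proof.
move=> ab sf Ll t st; have [Hf _ _] := in_CLoo_smooth L ab sf.
have [fr Cf] := C_repP Hf.
exact: (C_on_jet (Rle_refl _) ab (Rle_refl _) Cf Ll (pw_eq_sym fr) sf).
Qed.

Lemma tn_controllable_deg0 (m n : nat) (A : 'M[skewpoly]_(m, n))
    (U : 'M[skewpoly]_m) (r : skewpoly) (V : 'M[skewpoly]_n) (L : regularity) :
  (0 < m)%N -> (m <= n)%N -> tn_factorization A U r V ->
  reg_ge L ((mx_deg (skew_invmx V))%:Z + (skew_deg r)%:Z - 1)%R ->
  controllable L A -> skew_deg r = 0%N.
Proof.
move=> m0 mn [uU uV r0 AE] HL ctrl.
case rE : (skew_deg r) => [//|d]; exfalso.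
have [UUi UiU] := skew_invmxP uU; have [VW WV] := skew_invmxP uV.
set W := skew_invmx V in HL AE VW WV; set Ui := skew_invmx U in AE UUi UiU.
have rs : size (skew_poly r) = d.+2.
  by move: rE; rewrite /skew_deg; case: (size _) => //= k ->.
have LK : reg_ge L (mx_deg W + d)%N%:Z.
  move: HL; rewrite rE.
  have -> // : ((mx_deg W)%:Z + d.+1%:Z - 1 = (mx_deg W + d)%N%:Z)%R by lia.
(* [im] and [jm] are the row and the column in which [r] stands. *)
have im_lt : (m.-1 < m)%N by rewrite prednK.
pose im := Ordinal im_lt; pose jm : 'I_n := Ordinal (leq_trans im_lt mn).
have imm : im.+1 = m by rewrite /= prednK.
have UA : (U *m A = tn_middle m n r *m W)%R by rewrite AE !mulmxA UUi mul1mx.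
have AV : (A *m V = Ui *m tn_middle m n r)%R by rewrite AE -mulmxA WV mulmx1.
(* This row of U A shows that r applied to the observation [W jm] is a consequence of the
   equation. *)
have hT j : (r * W jm j)%R = (row im U *m A)%R ord0 j.
  by rewrite -row_mul UA (@row_tn_middle _ _ _ _ _ jm) // mxE.
have [q [q0 Hq]] := observation_vanishes rs (leq_mx_deg W jm) hT LK.
(* All conditions are generic, so they hold together at some point near 0, and on a whole ball
   around it. *)
have Gen := generically_and (generically_locally (generically_and (anfun_gen q0)
  (generically_and (diff_op_smooth V) (generically_and (diff_op_mul A V)
  (generically_and (diff_op_mul Ui (tn_middle m n r)) (generically_and
  (diff_op_mul W V) (diff_op1 n))))))) (mero_ode_solution rs).
have [b [Hb [y [sy y1 yode]]]] := locally'_point (generically_near 0 Gen).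
have [e [e0 He]] := (locally_Rabs _ _).1 (filter_and _ _ Hb
  (filter_and _ _ (smooth_at_locally sy) yode)).
pose Y (j : 'I_n) : R -> R := if j == jm then y else fun=> 0.
have sY t : Rabs (t - b) < e -> forall j, smooth_at (Y j) t.
  move=> /He [_ [st _]] j; rewrite /Y; case: ifP => // _.
  exact: smooth_at_const.
pose f := diff_op V Y.
have sf t : Rabs (t - b) < e -> forall j, smooth_at (f j) t.
  by move=> te; have [[_ [H _]] _] := He t te; apply: H; exact: sY.
(* Every row but [im] meets only zero components of [Y]; the row [im] gives r y = 0. *)
have mid0 i t : Rabs (t - b) < e -> diff_op (tn_middle m n r) Y i t = 0.
  move=> te; have [_ [_ rt]] := He t te; rewrite diff_opE big1 // => j _.
  rewrite /Y; case: eqP => [->|_]; last exact: op_zero.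
  rewrite mxE /=; case: eqP => [iE|_]; last exact: jet_op0.
  by rewrite iE prednK // eqxx.
have Af i t : Rabs (t - b) < e -> diff_op A f i t = 0.
  move=> te; have [[_ [_ [H1 [H2 _]]]] _] := He t te.
  rewrite -H1 ?AV; last exact: sY.
  rewrite H2; last exact: sY.
  by apply: diff_op0 => k; apply: filter_imp (locally_Rabs_lt te) => u; exact: mid0.
pose a := b - e / 4; pose c := b + e / 4; pose d' := b + e / 2.
have [ab [bc cd]] : a < b /\ b < c /\ c < d' by rewrite /a /c /d'; lra.
have nab t : segment a b t -> Rabs (t - b) < e.
  by rewrite /segment /a => st; apply: Rabs_def1; lra.
have nbc t : segment b c t -> Rabs (t - b) < e.
  by rewrite /segment /c => st; apply: Rabs_def1; lra.
have sfab j t : segment a b t -> smooth_at (f j) t by move=> /nab /sf.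
have Sf : section L A a b f.
  split=> [j|i]; first by apply: in_CLoo_smooth => // t; exact: sfab.
  by exists [::] => t /nab te _; exact: Af.
pose h (j : 'I_n) (t : R) : R := 0.
have sh j t : smooth_at (h j) t by exact: smooth_at_const.
have Sh : section L A c d' h.
  split=> [j|i]; first by apply: in_CLoo_smooth => // t _; exact: sh.
  by exists [::] => t _ _; apply: diff_op0 => j; exact: filter_forall.
have [g [Sg fg gh]] := ctrl a b c d' ab bc cd f h Sf Sh.
have : observation L b c g (W jm) b = 0.
  apply: Hq => //; first by move=> t /nbc te; have [[] ] := He t te.
  move=> j l Ll; rewrite (restr_point_jet gh) //.
  rewrite smooth_section_jet //; last by split; lra.
  by rewrite /h; case: l {Ll} => // l; rewrite Derive_n_const.
(* Only derivatives up to deg W <= L are read, and in these [g] agrees with [f] at [b]. *)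
have -> : observation L b c g (W jm) b = diff_op W f jm b.
  rewrite diff_opE; apply: eq_bigr => j _; apply: jet_op_eq => l lW; symmetry.
  have Ll : reg_ge L l%:Z.
    apply: reg_ge_leq LK; rewrite -ltnS; apply: leq_trans lW _.
    by apply: leq_trans (leq_mx_deg W jm j) _; rewrite ltnS leq_addr.
  rewrite -(restr_point_jet fg) // smooth_section_jet //; last by split; lra.
  exact: sfab.
have be : Rabs (b - b) < e by rewrite Rminus_diag_eq // Rabs_R0.
have [[_ [_ [_ [_ [H1 H2]]]]] _] := He b be.
(* W V = 1 turns W f back into [Y], whose component [jm] is 1 at [b]. *)
rewrite -H1 ?WV ?H2; last exact: sY.
by rewrite /Y eqxx y1; lra.
Qed.

Local Open Scope ring_scope.

Theorem theorem3p16 (m n : nat) (A : 'M[skewpoly]_(m, n))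
    (U : 'M[skewpoly]_m) (r : skewpoly) (V : 'M[skewpoly]_n) (L : regularity) :
  (0 < m)%N ->
  full_row_rank A ->
  tn_factorization A U r V ->
  reg_ge L ((mx_deg (skew_invmx V))%:Z + (skew_deg r)%:Z - 1) ->
  controllable L A <-> right_invertible A.
Proof.
move=> m0 frr tn HL; have mn := tn_factorization_leq frr tn.
split; last exact: right_invertible_controllable.
move=> /(tn_controllable_deg0 m0 mn tn HL).
exact: tn_deg0_right_invertible mn tn.
Qed.
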